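(* Let $\mathbb{K}$ be a subfield of $\mathbb{C}$, $q\ge1$, $A\in M_q(\mathbb{K}(z))$, let $\mathcal S$ be the $q$-dimensional $\mathbb{C}$-vector space of solutions of $Y'=AY$, and let $\mathcal F$ be a non-zero subspace of $\mathcal S$ which is nondegenerate over $\mathbb{K}$. There is a constant $c_1>0$ depending only on $A$ such that the following holds. Let $0\le\varepsilon\le\frac1{q+1}$, $w\in\mathbb{R}_{\ge0}$ and $n\in\mathbb{N}$, with $n$ sufficiently large in terms of $w$ and $A$. Let $P_1,\dots,P_q\in\mathbb{K}[z]$ be polynomials of degree at most $n$, not all zero, such that for every $Y=(y_1,\dots,y_q)\in\mathcal F$ the remainder $R(Y)(z)=\sum_{i=1}^qP_i(z)y_i(z)$ belongs to the Nilsson class at $0$ and vanishes at $0$ with order at least $\frac{(q-\varepsilon)n}{\dim\mathcal F}-w$. Then $\mathcal R[P_1,\dots,P_q]=\{0\}$, and for every $\alpha\in\mathbb{C}^*$ which is not a singularity of $Y'=AY$, the matrix $(P_{k,i}(\alpha))_{1\le i\le q,\ 1\le k<c_1+(w+1)q+n\varepsilon}$ has rank $q$.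
   Context: For $P_1,\dots,P_q\in\mathbb{C}[z]$, $\mathcal R[P_1,\dots,P_q]$ denotes the space of $Y=(y_1,\dots,y_q)\in\mathcal S$ with $\sum_{i=1}^qP_i(z)y_i(z)\equiv0$; it is called proper if it is neither $\{0\}$ nor $\mathcal S$. The subspace $\mathcal F$ is nondegenerate over $\mathbb{K}$ if for all $P_1,\dots,P_q\in\mathbb{K}[z]$ such that $\mathcal R[P_1,\dots,P_q]$ is proper, $\frac{\dim(\mathcal F\cap\mathcal R[P_1,\dots,P_q])}{\dim\mathcal R[P_1,\dots,P_q]}<\frac{\dim\mathcal F}{\dim\mathcal S}$. The rational functions $P_{k,i}$ ($k\ge1$, $1\le i\le q$) are defined by ${}^t(P_{k,1},\dots,P_{k,q})=(\frac{d}{dz}+{}^tA)^{k-1}\,{}^t(P_1,\dots,P_q)$. The Nilsson class at $0$ is the set of functions $\sum_{e\in E}\sum_{i\in I}h_{e,i}(z)z^e(\log z)^i$ with $E\subset\mathbb{C}$, $I\subset\mathbb{N}$ finite and $h_{e,i}$ holomorphic at $0$; for a non-zero such function (normalized so that for each $e\in E$ some $h_{e,i}(0)\neq0$), its order at $0$ is the minimal real part of an element of $E$; ''vanishes with order at least $T$'' means the function is identically zero or has order $\ge T$. *)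

(* Defs.v *)
From HB Require Import structures.
From mathcomp Require Import all_boot all_order all_algebra.
From mathcomp Require Import all_classical all_reals all_analysis.
From mathcomp Require Import complex.
Set Implicit Arguments. Unset Strict Implicit. Unset Printing Implicit Defensive.
Import Order.TTheory GRing.Theory Num.Theory.
Local Open Scope ring_scope.
Local Open Scope classical_set_scope.

Section Defs.
Variable R : realType.
Local Notation C := (R[i]).

Definition fregular (x : {fraction {poly C}}) (a : C) : Prop :=
  exists n d : {poly C}, d.[a] != 0 /\ x = tofrac n / tofrac d.

(* value of the rational function x at a (meaningful when fregular x a) *)
Definition feval (x : {fraction {poly C}}) (a : C) : C :=
  xget 0 [set v | exists n d : {poly C},
           [/\ d.[a] != 0, x = tofrac n / tofrac d & v = n.[a] / d.[a]]].

Definition in_Kz (K : {pred C}) (x : {fraction {poly C}}) : Prop :=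
  exists n d : {poly C}, [/\ n \is a polyOver K, d \is a polyOver K, d != 0
                           & x = tofrac n / tofrac d].

Definition fderiv (x : {fraction {poly C}}) : {fraction {poly C}} :=
  let n := (generic_quotient.repr x).1 in let d := (generic_quotient.repr x).2 in
  tofrac (deriv n * d - n * deriv d) / tofrac (d * d).

Definition singular q (A : 'M[{fraction {poly C}}]_q) (a : C) : Prop :=
  exists i j, ~ fregular (A i j) a.

(* Pk A P k = column vector t(P_{k+1,1},...,P_{k+1,q}),
   i.e. (d/dz + tA)^k t(P_1,...,P_q) *)
Fixpoint Pk q (A : 'M[{fraction {poly C}}]_q) (P : 'I_q -> {poly C}) (k : nat)
  : 'cV[{fraction {poly C}}]_q :=
  match k with
  | O => \col_i tofrac (P i)
  | k'.+1 => let V := Pk A P k' in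
             map_mx fderiv V + A^T *m V
  end.

Definition Pmat q (A : 'M[{fraction {poly C}}]_q) (P : 'I_q -> {poly C})
  (m : nat) (a : C) : 'M[C]_(q, m) :=
  \matrix_(i < q, k < m) feval (Pk A P k i ord0) a.

Definition cabs (z : C) : R :=
  Num.sqrt (complex.Re z ^+ 2 + complex.Im z ^+ 2).

Definition holo_at (f : C -> C) (a : C) : Prop :=
  exists2 rho : R, 0 < rho &
    forall z : C, cabs (z - a) < rho -> derivable (f : C^o -> C^o) z 1.

Definition carg (z : C) : R :=
  if 0 <= complex.Im z then acos (complex.Re z / cabs z)
  else - acos (complex.Re z / cabs z).
Definition cexp (z : C) : C :=
  Complex (expR (complex.Re z) * cos (complex.Im z))
          (expR (complex.Re z) * sin (complex.Im z)).
Definition clog (z : C) : C := Complex (ln (cabs z)) (carg z).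
Definition cpow (z e : C) : C := cexp (e * clog z).

Definition slitdisk (r : R) : set C :=
  [set z | 0 < cabs z < r /\ ~ (complex.Im z = 0 /\ complex.Re z < 0)].

Definition nilsson_rep (r : R) (f : C -> C) (E : seq C) (I : nat)
  (h : C -> nat -> C -> C) : Prop :=
  [/\ uniq E,
      forall e i, e \in E -> (i < I)%N -> holo_at (h e i) 0
    & exists2 rho : R, 0 < rho & forall z, slitdisk r z -> cabs z < rho ->
        f z = \sum_(e <- E) \sum_(i < I) h e i z * cpow z e * clog z ^+ i].

Definition normalized (E : seq C) (I : nat) (h : C -> nat -> C -> C) : Prop :=
  forall e, e \in E -> exists i : 'I_I, h e i 0 != 0.

Definition nilsson_class (r : R) (f : C -> C) : Prop :=
  exists E I h, nilsson_rep r f E I h.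

(* f is identically zero near 0, or has order >= T at 0
   (order = min real part of the exponents of a normalized representation) *)
Definition vanishes_order_ge (r : R) (f : C -> C) (T : R) : Prop :=
  exists E I h, [/\ nilsson_rep r f E I h, normalized E I h
                  & forall e, e \in E -> T <= complex.Re e].

(* Y is a solution on D (holomorphic on the open set D, Y' = AY there);
   by convention Y vanishes outside D, so solutions form a vector space
   of functions C -> C^q *)
Definition is_sol q (A : 'M[{fraction {poly C}}]_q) (D : set C)
  (Y : C -> 'cV[C]_q) : Prop :=
  (forall z, ~ D z -> Y z = 0) /\
  forall z, D z -> forall i : 'I_q,
    derivable ((fun u => Y u i ord0) : C^o -> C^o) z 1 /\
    derive ((fun u => Y u i ord0) : C^o -> C^o) z 1
      = \sum_(j < q) feval (A i j) z * Y z j ord0.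

Definition sol_space q (A : 'M[{fraction {poly C}}]_q) (D : set C)
  : set (C -> 'cV[C]_q) := is_sol A D.

Definition lin_subspace q (V : set (C -> 'cV[C]_q)) : Prop :=
  [/\ V (fun _ => 0),
      forall Y Z, V Y -> V Z -> V (fun z => Y z + Z z)
    & forall (c : C) Y, V Y -> V (fun z => c *: Y z)].

Definition has_dim q (V : set (C -> 'cV[C]_q)) (k : nat) : Prop :=
  exists B : 'I_k -> C -> 'cV[C]_q,
    [/\ forall j, V (B j),
        forall c : 'I_k -> C, (forall z, \sum_(j < k) c j *: B j z = 0) ->
          forall j, c j = 0
      & forall Y, V Y -> exists c : 'I_k -> C,
          forall z, Y z = \sum_(j < k) c j *: B j z].

Definition remainder q (P : 'I_q -> {poly C}) (Y : C -> 'cV[C]_q) (z : C) : C :=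
  \sum_(i < q) (P i).[z] * Y z i ord0.

Definition Rspace q (A : 'M[{fraction {poly C}}]_q) (D : set C)
  (P : 'I_q -> {poly C}) : set (C -> 'cV[C]_q) :=
  [set Y | sol_space A D Y /\ forall z, D z -> remainder P Y z = 0].

Definition proper_space q (A : 'M[{fraction {poly C}}]_q) (D : set C)
  (V : set (C -> 'cV[C]_q)) : Prop :=
  V <> [set fun _ => 0] /\ V <> sol_space A D.

Definition nondegenerate_over q (K : {pred C}) (A : 'M[{fraction {poly C}}]_q)
  (D : set C) (F : set (C -> 'cV[C]_q)) : Prop :=
  forall P : 'I_q -> {poly C}, (forall i, P i \is a polyOver K) ->
    proper_space A D (Rspace A D P) ->
    forall dFR dR dF dS : nat,
      has_dim (F `&` Rspace A D P) dFR -> has_dim (Rspace A D P) dR ->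
      has_dim F dF -> has_dim (sol_space A D) dS ->
      (dFR%:R / dR%:R < dF%:R / dS%:R :> R).

End Defs.

(* Main.v *)
Require Import Defs.
From HB Require Import structures.
From mathcomp Require Import all_boot all_order all_algebra.
From mathcomp Require Import all_classical all_reals all_analysis.
From mathcomp Require Import perm complex.
From mathcomp Require Import ring lra zify.
Set Implicit Arguments. Unset Strict Implicit. Unset Printing Implicit Defensive.
Import Order.TTheory GRing.Theory Num.Theory numFieldNormedType.Exports.
Local Open Scope ring_scope.
Local Open Scope classical_set_scope.

(** Write [a] for a common denominator of [A] (times [z]) and let [t_0 = P], [t_(k+1)] be the
rows obtained by applying [a d/dz + A^T a], so that [(a d/dz)^k (P . Y) = t_k . Y]. Let [p] be
the rank of the [t_k] over [C(z)]; then [R[P]] has dimension [q - p]. All rows annihilating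
[R[P]] satisfy linear equations of degree bounded in terms of [A] only, hence are recovered, by
a matrix [Mt] of bounded degree, from their product with a constant matrix [E]. The [p * p]
determinant [Delta = det (t E)] is a nonzero polynomial of degree at most [p n + O(1)].

If [Y_1, ..., Y_m] is a basis of a complement of [F cap R[P]] in [F], then the first [m] columns
of [t E [Mt Y | G]] vanish to the order of the remainders, for any constant [G]. The minors of
[Mt Y] run through a finite-dimensional space depending only on [A]: a member vanishing to a
high order [tau0] at [0] along the positive reals vanishes to infinite order. This is impossible
for all minors at once: applying products of the operators [z d/dz - e] to the remainders
[P . Y_j] isolates linearly independent leading terms [z^e (log z)^i], and the derivatives of
the error terms are controlled by a Cauchy estimate. So [Delta] vanishes at [0] to an order at
least [m (T - 1) - tau0]. If [p < q], nondegeneracy makes this larger than the degree. If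
[p = q], the multiplicity of [Delta] at [alpha] is at most [n eps + (w + 1) q + O(1)], and
differentiating the determinant shows that so many [t_k(alpha)] already span. *)

(** Every constant must depend on [A] alone, while the slit disk, [F] and the polynomials are
    arbitrary. So one fundamental matrix [Phi] is fixed on a disk determined by [A]; solutions on
    the given disk are compared with it near [0], and identities are carried back by uniqueness for
    linear systems. The obstacle is that the factor [Mt Y] may itself be small at [0], at a rate
    depending on [P]. The bounded degree of [Mt] puts its minors in one finite-dimensional space,
    where the subspaces of functions of order at least k decrease and hence stabilise; this yields
    [tau0], with no explicit value. To see that some minor is not flat, a Wronskian-like matrix is
    made triangular up to smaller terms. Orders are measured along the positive reals, but
    differentiating a bound costs a complex neighbourhood, hence the estimates in sectors.
    Logarithms are absorbed by giving up one unit of order, hence [T - 1]. For [p < q] nondegeneracy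
    reads [p * dim F < m * q]. Between integers this is a gap of at least 1, so the order exceeds
    the degree by about [(1 - m * eps) * n / dim F], which is at least [n / ((q + 1) * dim F)]
    because [eps <= 1 / (q + 1)]. *)

(** * Complex modulus, complex derivative and mean value inequality *)

Section ComplexCalculus.
Variable R : realType.
Local Notation C := (R[i]).
Implicit Types (z w h l c : C) (f g : C -> C).

Lemma cabsE z : `|z| = (cabs z)%:C%C.
Proof. by rewrite normc_def. Qed.

Lemma cabs_ge0 z : 0 <= cabs z. Proof. exact: sqrtr_ge0. Qed.
Hint Resolve cabs_ge0 : core.

Lemma cabs0 : cabs (0 : C) = 0.
Proof. by apply: complexI; rewrite -cabsE normr0. Qed.

Lemma cabs1 : cabs (1 : C) = 1.
Proof. by apply: complexI; rewrite -cabsE normr1. Qed.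

Lemma cabsM z w : cabs (z * w) = cabs z * cabs w.
Proof. by apply: complexI; rewrite rmorphM /= -!cabsE normrM. Qed.

Lemma cabsN z : cabs (- z) = cabs z.
Proof. by apply: complexI; rewrite -!cabsE normrN. Qed.

Lemma cabsBC z w : cabs (z - w) = cabs (w - z).
Proof. by rewrite -cabsN opprB. Qed.

Lemma cabsV z : cabs z^-1 = (cabs z)^-1.
Proof. by apply: complexI; rewrite fmorphV /= -!cabsE normfV. Qed.

Lemma cabsX z n : cabs (z ^+ n) = cabs z ^+ n.
Proof. by elim: n => [|n IH]; rewrite ?expr0 ?cabs1 // !exprS cabsM IH. Qed.

Lemma cabsD z w : cabs (z + w) <= cabs z + cabs w.
Proof. by rewrite -lecR rmorphD /= -!cabsE ler_normD. Qed.

Lemma cabsB z w : cabs (z - w) <= cabs z + cabs w.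
Proof. by rewrite (le_trans (cabsD _ _)) // cabsN. Qed.

Lemma cabs_sum (I : Type) (s : seq I) (P : pred I) (F : I -> C) :
  cabs (\sum_(i <- s | P i) F i) <= \sum_(i <- s | P i) cabs (F i).
Proof.
elim/big_rec2: _ => [|i x y _ H]; first by rewrite cabs0.
by rewrite (le_trans (cabsD _ _)) // lerD2l.
Qed.

Lemma cabs_eq0 z : (cabs z == 0) = (z == 0).
Proof. by rewrite -(inj_eq (@complexI R)) -cabsE normr_eq0. Qed.

Lemma cabs_gt0 z : (0 < cabs z) = (z != 0).
Proof. by rewrite lt_def cabs_eq0 cabs_ge0 andbT. Qed.

Lemma cabsR (x : R) : cabs (x%:C%C) = `|x|.
Proof. by rewrite /cabs /= expr0n addr0 sqrtr_sqr. Qed.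

Lemma Re_cabs z : `|complex.Re z| <= cabs z.
Proof. by rewrite /cabs -sqrtr_sqr ler_sqrt ?addr_ge0 ?sqr_ge0 // lerDl sqr_ge0. Qed.

Lemma Im_cabs z : `|complex.Im z| <= cabs z.
Proof. by rewrite /cabs -sqrtr_sqr ler_sqrt ?addr_ge0 ?sqr_ge0 // lerDr sqr_ge0. Qed.

Lemma cabs_ReIm z : cabs z <= `|complex.Re z| + `|complex.Im z|.
Proof.
have -> : z = (complex.Re z)%:C%C + 'i%C * (complex.Im z)%:C%C by rewrite -complexE.
apply: (le_trans (cabsD _ _)); rewrite cabsM !cabsR /=.
by rewrite /cabs /= expr0n expr1n add0r sqrtr1; simpc.
Qed.

Lemma ReD z w : complex.Re (z + w) = complex.Re z + complex.Re w.
Proof. by case: z; case: w. Qed.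
Lemma ImD z w : complex.Im (z + w) = complex.Im z + complex.Im w.
Proof. by case: z; case: w. Qed.
Lemma ReB z w : complex.Re (z - w) = complex.Re z - complex.Re w.
Proof. by case: z; case: w. Qed.
Lemma ImB z w : complex.Im (z - w) = complex.Im z - complex.Im w.
Proof. by case: z; case: w. Qed.
Lemma ReM z w : complex.Re (z * w) =
  complex.Re z * complex.Re w - complex.Im z * complex.Im w.
Proof. by case: z; case: w. Qed.
Lemma ImM z w : complex.Im (z * w) =
  complex.Re z * complex.Im w + complex.Im z * complex.Re w.
Proof. by case: z; case: w. Qed.

(** The derivative as a real inequality: zero increments are allowed and no quotient occurs, so the
    sum, product and chain rules become estimates between moduli. *)
Definition cdiff f z l := forall e : R, 0 < e -> exists2 d : R, 0 < d &
  forall h, cabs h < d -> cabs (f (z + h) - f z - l * h) <= e * cabs h.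

Definition ccont f z := forall e : R, 0 < e -> exists2 d : R, 0 < d &
  forall h, cabs h < d -> cabs (f (z + h) - f z) <= e.

(** The norm of [C^o] takes values in [C], so radii of balls are complex numbers. A positive one has
    zero imaginary part, which gives a description with real radii and [cabs]. *)
Lemma dnbhs0_cabsP (P : C -> Prop) :
  (\forall h \near (0 : C^o)^', P h) <->
  exists2 d : R, 0 < d & forall h, cabs h < d -> h != 0 -> P h.
Proof.
rewrite /dnbhs; split.
  case/nbhs_ballP => e /= e0 H.
  have e0' : 0 < complex.Re e /\ e = (complex.Re e)%:C%C.
    move: e0; rewrite ltcE => /andP[/eqP /= ei er]; split=> //.
    by case: e ei {H er} => a b /= ->.
  exists (complex.Re e); first by case: e0'.
  move=> h hd h0; apply: (H h); last by rewrite /=.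
  by rewrite -ball_normE /= sub0r normrN cabsE; case: e0' => _ ->; rewrite ltcR.
case=> d d0 H; apply/nbhs_ballP; exists d%:C%C => /=; first by rewrite ltcR.
move=> h; rewrite -ball_normE /= sub0r normrN cabsE ltcR => hd h0.
exact: H.
Qed.

Lemma is_derive_cdiff f z l : cdiff f z l -> is_derive (z : C^o) 1 (f : C^o -> C^o) l.
Proof.
move=> H.
have cv : h^-1 *: (((f : C^o -> C^o) \o shift z) (h *: 1) - f z) @[h --> (0 : C^o)^'] --> (l : C^o).
  apply/cvgrPdist_le => e e0.
  have [er ei] : 0 < complex.Re e /\ e = (complex.Re e)%:C%C.
    move: e0; rewrite ltcE => /andP[/eqP /= ei er]; split=> //.
    by case: e ei {er} => a b /= ->.
  apply/dnbhs0_cabsP; have [d d0 Hd] := H _ er; exists d => // h hd h0.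
  rewrite ei cabsE lecR /= /shift.
  have -> : h *: (1 : C^o) + z = z + h by rewrite /GRing.scale /= mulr1 addrC.
  rewrite /GRing.scale /=.
  have -> : l - h^-1 * (f (z + h) - f z) = - (h^-1 * (f (z + h) - f z - l * h)) by field.
  rewrite cabsN cabsM cabsV ler_pdivrMl ?cabs_gt0 // [cabs h * _]mulrC; exact: Hd.
split; first by apply/cvg_ex; exists l.
by apply: cvg_lim cv; exact: norm_hausdorff.
Qed.

Lemma cdiff_is_derive f z l : is_derive (z : C^o) 1 (f : C^o -> C^o) l -> cdiff f z l.
Proof.
case=> df dl e e0; move: (df) => /cvg_ex[l' cv].
have ll : l' = l.
  rewrite -dl; apply/esym; apply: cvg_lim cv; exact: norm_hausdorff.
rewrite {}ll in cv.
move/cvgrPdist_le: cv => /(_ e%:C%C); rewrite ltcR => /(_ e0) /dnbhs0_cabsP[d d0 H].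
exists d => // h hd; have [->|h0] := eqVneq h 0.
  by rewrite addr0 subrr mulr0 subr0 cabs0 mulr0.
have := H h hd h0; rewrite cabsE lecR /= /shift.
have -> : h *: (1 : C^o) + z = z + h by rewrite /GRing.scale /= mulr1 addrC.
rewrite /GRing.scale /=.
have -> : l - h^-1 * (f (z + h) - f z) = - (h^-1 * (f (z + h) - f z - l * h)) by field.
by rewrite cabsN cabsM cabsV ler_pdivrMl ?cabs_gt0 // [cabs h * _]mulrC.
Qed.

Lemma cdiff_derivable f z : derivable (f : C^o -> C^o) z 1 ->
  cdiff f z (derive (f : C^o -> C^o) z 1).
Proof. by move=> df; apply: cdiff_is_derive; apply/derivableP. Qed.

Lemma cdiff_ccont f z l : cdiff f z l -> ccont f z.
Proof.
move=> H e e0; have [d d0 Hd] := H 1 ltr01.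
have L0 : 0 < 1 + cabs l by rewrite ltr_wpDr.
exists (Num.min d (e / (1 + cabs l))); first by rewrite lt_min d0 divr_gt0.
move=> h; rewrite lt_min => /andP[hd he].
have -> : f (z + h) - f z = (f (z + h) - f z - l * h) + l * h by ring.
apply: le_trans (cabsD _ _) _; rewrite cabsM.
have := Hd _ hd; rewrite ltr_pdivlMr // in he.
have := cabs_ge0 h; nra.
Qed.

Lemma cdiff_ext f g z l : (exists2 d : R, 0 < d & forall h, cabs h < d -> f (z + h) = g (z + h)) ->
  cdiff f z l -> cdiff g z l.
Proof.
move=> [d1 d10 E] H e e0; have [d d0 Hd] := H e e0.
exists (Num.min d d1); first by rewrite lt_min d0.
move=> h; rewrite lt_min => /andP[hd hd1]; rewrite -E //.
have := E 0; rewrite addr0 cabs0 => <- //; exact: Hd.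
Qed.

Lemma cdiff_eqf f g z l : f =1 g -> cdiff f z l -> cdiff g z l.
Proof. by move=> E; apply: cdiff_ext; exists 1. Qed.

Lemma cdiff_cst c z : cdiff (fun=> c) z 0.
Proof. by move=> e e0; exists 1 => // h _; rewrite subrr mul0r subr0 cabs0 mulr_ge0 ?(ltW e0). Qed.

Lemma cdiff_id z : cdiff id z 1.
Proof.
move=> e e0; exists 1 => // h _.
have -> : z + h - z - 1 * h = 0 by ring.
by rewrite cabs0 mulr_ge0 ?(ltW e0).
Qed.

Lemma cdiffD f g z l l' : cdiff f z l -> cdiff g z l' ->
  cdiff (fun u => f u + g u) z (l + l').
Proof.
move=> Hf Hg e e0; have e20 : 0 < e / 2 by lra.
have [d1 d10 H1] := Hf _ e20; have [d2 d20 H2] := Hg _ e20.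
exists (Num.min d1 d2); first by rewrite lt_min d10.
move=> h; rewrite lt_min => /andP[h1 h2].
have -> : f (z + h) + g (z + h) - (f z + g z) - (l + l') * h =
  (f (z + h) - f z - l * h) + (g (z + h) - g z - l' * h) by ring.
apply: le_trans (cabsD _ _) _; have := H1 _ h1; have := H2 _ h2; lra.
Qed.

Lemma cdiffM f g z l l' : cdiff f z l -> cdiff g z l' ->
  cdiff (fun u => f u * g u) z (l * g z + f z * l').
Proof.
move=> Hf Hg e e0.
(* The error splits into four products; [M] dominates all their fixed factors, so accuracy
   [e / (3 * M)] for each increment suffices. *)
pose M := 1 + cabs (f z) + cabs l + cabs (g z).
have M0 : 0 < M by have := cabs_ge0 (f z); have := cabs_ge0 l;
  have := cabs_ge0 (g z); rewrite /M; lra.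
have e30 : 0 < e / (3 * M) by rewrite divr_gt0 // mulr_gt0.
have [d1 d10 H1] := Hf _ e30; have [d2 d20 H2] := Hg _ e30.
have e31 : 0 < Num.min M (e / (3 * M)) by rewrite lt_min M0 e30.
have [d3 d30 H3] := cdiff_ccont Hg e31.
exists (Num.min d1 (Num.min d2 d3)); first by rewrite !lt_min d10 d20.
move=> h; rewrite !lt_min => /and3P[h1 h2 h3].
have -> : f (z + h) * g (z + h) - f z * g z - (l * g z + f z * l') * h =
  (f (z + h) - f z - l * h) * g z + (f z * (g (z + h) - g z - l' * h)
  + ((f (z + h) - f z - l * h) * (g (z + h) - g z) + l * h * (g (z + h) - g z))) by ring.
apply: le_trans (cabsD _ _) _; apply: le_trans (lerD (lexx _) (cabsD _ _)) _.
apply: le_trans (lerD (lexx _) (lerD (lexx _) (cabsD _ _))) _.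
rewrite !cabsM; have := H1 _ h1; have := H2 _ h2; have := H3 _ h3; rewrite le_min => /andP[].
set A := cabs (f _ - _ - _); set B := cabs (g _ - _ - _); set D := cabs (g _ - _) => HD1 HD2 HB HA.
have E : e = 3 * M * (e / (3 * M)) by field; rewrite gt_eqF.
rewrite {1}E; set k := e / (3 * M) in e30 HD2 HB HA *.
have A0 : 0 <= A := cabs_ge0 _; have B0 : 0 <= B := cabs_ge0 _; have D0 : 0 <= D := cabs_ge0 _.
have F0 := cabs_ge0 (f z); have G0 := cabs_ge0 (g z); have L0 := cabs_ge0 l; have H0 := cabs_ge0 h.
have X1 : A * cabs (g z) <= k * cabs h * cabs (g z) by apply: ler_wpM2r.
have X2 : cabs (f z) * B <= cabs (f z) * (k * cabs h) by apply: ler_wpM2l.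
have X3 : A * D <= k * cabs h * M by apply: ler_pM.
have X4 : cabs l * cabs h * D <= cabs l * cabs h * k by apply: ler_wpM2l => //; apply: mulr_ge0.
have X5 : 0 <= k * cabs h by apply: mulr_ge0 => //; apply: ltW.
have X6 : k * cabs h * (cabs (g z) + cabs (f z) + cabs l) <= k * cabs h * M.
  by apply: ler_wpM2l => //; rewrite /M; lra.
have X7 : 0 <= k * cabs h * M by apply: mulr_ge0 => //; exact: ltW.
nra.
Qed.

Lemma cdiffZ c f z l : cdiff f z l -> cdiff (fun u => c * f u) z (c * l).
Proof. by move=> H; have := cdiffM (cdiff_cst c z) H; rewrite mul0r add0r. Qed.

Lemma cdiffN f z l : cdiff f z l -> cdiff (fun u => - f u) z (- l).
Proof. by move=> /(cdiffZ (-1)); rewrite mulN1r; apply: cdiff_eqf => u; rewrite mulN1r. Qed.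

Lemma cdiffB f g z l l' : cdiff f z l -> cdiff g z l' ->
  cdiff (fun u => f u - g u) z (l - l').
Proof. by move=> Hf /cdiffN; exact: cdiffD. Qed.

Lemma cdiff_sum (I : Type) (s : seq I) (P : pred I) (F : I -> C -> C) (L : I -> C) z :
  (forall i, P i -> cdiff (F i) z (L i)) ->
  cdiff (fun u => \sum_(i <- s | P i) F i u) z (\sum_(i <- s | P i) L i).
Proof.
move=> H; elim: s => [|i s IH].
  rewrite big_nil; apply: cdiff_eqf (cdiff_cst 0 z) => u; by rewrite big_nil.
rewrite big_cons; case: ifP => Pi.
  by apply: cdiff_eqf (cdiffD (H i Pi) IH) => u; rewrite big_cons Pi.
by apply: cdiff_eqf IH => u; rewrite big_cons Pi.
Qed.

Lemma cdiff_comp f g z l l' : cdiff f (g z) l -> cdiff g z l' ->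
  cdiff (fun u => f (g u)) z (l * l').
Proof.
move=> Hf Hg e e0.
pose M := 1 + cabs l + cabs l'.
have M0 : 0 < M by have := cabs_ge0 l; have := cabs_ge0 l'; rewrite /M; lra.
have e20 : 0 < e / (2 * M) by rewrite divr_gt0 // mulr_gt0.
have [d1 d10 H1] := Hf _ e20.
have [d2 d20 H2] := Hg _ e20; have [d3 d30 H3] := Hg _ ltr01.
have d120 : 0 < d1 / 2 by lra.
have [d4 d40 H4] := cdiff_ccont Hg d120.
exists (Num.min d2 (Num.min d3 d4)); first by rewrite !lt_min d20 d30.
move=> h; rewrite !lt_min => /and3P[h2 h3 h4].
pose k := g (z + h) - g z.
have kE : g (z + h) = g z + k by rewrite /k; ring.
have kd : cabs k < d1 by have := H4 _ h4; rewrite -/k; lra.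
have kb : cabs k <= M * cabs h.
  have -> : k = (g (z + h) - g z - l' * h) + l' * h by rewrite /k; ring.
  apply: le_trans (cabsD _ _) _; have := H3 _ h3; rewrite cabsM /M.
  have := cabs_ge0 h; have := cabs_ge0 l; nra.
rewrite kE.
have -> : f (g z + k) - f (g z) - l * l' * h =
  (f (g z + k) - f (g z) - l * k) + l * (g (z + h) - g z - l' * h) by rewrite /k; ring.
apply: le_trans (cabsD _ _) _; rewrite cabsM.
have X1 := H1 _ kd; have X2 := H2 _ h2.
have E : e = 2 * M * (e / (2 * M)) by field; rewrite gt_eqF.
rewrite {1}E; set m := e / (2 * M) in e20 X1 X2 *.
have X3 : m * cabs k <= m * (M * cabs h) by apply: ler_wpM2l => //; exact: ltW.
have X4 : cabs l * cabs (g (z + h) - g z - l' * h) <= M * (m * cabs h).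
  apply: ler_pM => //; rewrite /M; have := cabs_ge0 l'; lra.
nra.
Qed.

Lemma cdiff_inv z : z != 0 -> cdiff (fun u => u^-1) z (- (z ^- 2)).
Proof.
move=> z0 e e0; have Z0 : 0 < cabs z by rewrite cabs_gt0.
exists (Num.min (cabs z / 2) (e * cabs z ^+ 3 / 2)).
  by rewrite lt_min !divr_gt0 // mulr_gt0 // exprn_gt0.
move=> h; rewrite lt_min => /andP[h1 h2].
have zh : cabs z / 2 <= cabs (z + h).
  have := cabsB (z + h) h; rewrite addrK; lra.
have zh0 : z + h != 0 by rewrite -cabs_gt0; lra.
have -> : (z + h)^-1 - z^-1 - - z ^- 2 * h = h ^+ 2 / (z ^+ 2 * (z + h)).
  by field; rewrite zh0.
rewrite cabsM cabsV cabsM !cabsX ler_pdivrMr; last by rewrite mulr_gt0 ?exprn_gt0 //; lra.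
have X : e * cabs h * (cabs z ^+ 2 * (cabs z / 2)) <= e * cabs h * (cabs z ^+ 2 * cabs (z + h)).
  apply: ler_wpM2l; first by rewrite mulr_ge0 // ltW.
  by apply: ler_wpM2l => //; rewrite exprn_ge0.
apply: le_trans X; have H0 := cabs_ge0 h.
have -> : e * cabs h * (cabs z ^+ 2 * (cabs z / 2)) = cabs h * (e * cabs z ^+ 3 / 2) by field.
by rewrite expr2; apply: ler_wpM2l => //; exact: ltW.
Qed.

Lemma cdiff_poly (p : {poly C}) z : cdiff (fun u => p.[u]) z (p^`()).[z].
Proof.
elim/poly_ind: p => [|p c IH].
  by rewrite deriv0 horner0; apply: cdiff_eqf (cdiff_cst 0 z) => u; rewrite horner0.
rewrite derivD derivC addr0 derivM derivX mulr1 hornerD hornerM hornerX.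
have := cdiffD (cdiffM IH (cdiff_id z)) (cdiff_cst c z).
rewrite mulr1 addr0; apply: cdiff_eqf => u.
by rewrite hornerD hornerM hornerX hornerC.
Qed.

Lemma cdiff_polyV (p : {poly C}) z : p.[z] != 0 ->
  cdiff (fun u => (p.[u])^-1) z (- (p.[z]) ^- 2 * (p^`()).[z]).
Proof. move=> p0; exact: cdiff_comp (cdiff_inv p0) (cdiff_poly p z). Qed.

Lemma cdiff_uniq f z l l' : cdiff f z l -> cdiff f z l' -> l = l'.
Proof.
move=> /is_derive_cdiff [_ H1] /is_derive_cdiff [_ H2].
by rewrite -H1 -H2.
Qed.

Lemma is_derive_line f (u v : C) (t : R) l : cdiff f (u + t%:C%C * v) l ->
  is_derive t 1 (fun s : R => complex.Re (f (u + s%:C%C * v))) (complex.Re (l * v)).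
Proof.
move=> H.
pose k : R^o -> R^o := fun s => complex.Re (f (u + s%:C%C * v)).
have cv : h^-1 *: ((k \o shift (t : R^o)) (h *: (1 : R^o)) - k t) @[h --> (0 : R^o)^'] -->
  (complex.Re (l * v) : R^o).
  apply/cvgrPdist_le => e e0.
  have V0 : 0 < 1 + cabs v by have := cabs_ge0 v; lra.
  have e1 : 0 < e / (1 + cabs v) by rewrite divr_gt0.
  have [d d0 Hd] := H _ e1.
  near=> h.
  have h0 : h != 0 by near: h; apply/nbhs_ballP; exists 1 => /=.
  have hd : `|h| < d / (1 + cabs v).
    near: h; apply: dnbhs0_lt; exact: divr_gt0.
  rewrite /= /shift /k /=.
  have -> : (h *: (1 : R^o) + t)%:C%C = t%:C%C + h%:C%C by rewrite /GRing.scale /= mulr1 addrC rmorphD.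
  have -> : u + (t%:C%C + h%:C%C) * v = (u + t%:C%C * v) + h%:C%C * v by ring.
  set p := u + t%:C%C * v.
  have hv : cabs (h%:C%C * v) < d.
    rewrite cabsM cabsR; move: hd; rewrite ltr_pdivlMr //.
    have := normr_ge0 h; have := cabs_ge0 v; nra.
  have := Hd _ hv; set w := f (p + _) - _ - _ => Hw.
  have -> : complex.Re (l * v) - h^-1 *: (complex.Re (f (p + h%:C%C * v)) - complex.Re (f p)) =
    - (h^-1 * complex.Re w).
    rewrite /w !ReB /GRing.scale /= mulrA [l * h%:C%C]mulrC -mulrA.
    have -> : complex.Re (h%:C%C * (l * v)) = h * complex.Re (l * v).
      by rewrite ReM /= mul0r subr0.
    by field.
  rewrite normrN normrM normfV ler_pdivrMl ?normr_gt0 //.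
  apply: le_trans (Re_cabs _) _; apply: le_trans Hw _.
  rewrite cabsM cabsR mulrCA -!mulrA ler_wpM2l //.
  rewrite [_^-1 * _]mulrC mulrA ler_pdivrMr ?ler_wpM2l // ?(ltW e0) //; lra.
split; first by apply/cvg_ex; eexists; exact: cv.
by apply: cvg_lim cv; exact: norm_hausdorff.
Unshelve. all: by end_near. Qed.

Lemma is_derive_lineI f (u v : C) (t : R) l : cdiff f (u + t%:C%C * v) l ->
  is_derive t 1 (fun s : R => complex.Im (f (u + s%:C%C * v))) (complex.Im (l * v)).
Proof.
move=> /(cdiffZ (- 'i%C)) /is_derive_line.
have E w : complex.Re (- 'i%C * w) = complex.Im w by case: w => a b; simpc.
rewrite -mulrA E; congr is_derive; apply/funext => s; exact: E.
Qed.

Lemma is_derive_within_continuous (k dk : R -> R) (a b : R) :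
  (forall t, a <= t <= b -> is_derive t 1 k (dk t)) -> {within `[a, b], continuous k}.
Proof.
move=> H; apply: continuous_in_subspaceT => t; rewrite inE /= in_itv /= => tab.
by apply/differentiable_continuous/derivable1_diffP; case: (H t tab).
Qed.

(** The mean value theorem applied to [k - g], whose derivative is nowhere positive. *)
Lemma comparison (k dk g dg : R -> R) (a b : R) : a <= b ->
  (forall t, a <= t <= b -> is_derive t 1 k (dk t)) ->
  (forall t, a <= t <= b -> is_derive t 1 g (dg t)) ->
  (forall t, a <= t <= b -> dk t <= dg t) -> k b - k a <= g b - g a.
Proof.
move=> ab Hk Hg le.
have H t : a <= t <= b -> is_derive t 1 (k - g) (dk t - dg t).
  by move=> tab; apply: is_deriveB; [exact: Hk|exact: Hg].
have [] := @MVT_segment R (k - g) (fun t => dk t - dg t) a b ab.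
- by move=> t; rewrite in_itv /= => /andP[t1 t2]; apply: H; rewrite !ltW.
- exact: is_derive_within_continuous H.
move=> c; rewrite in_itv /= => cab E.
have dle := le _ cab; have E' : (k b - g b) - (k a - g a) = (dk c - dg c) * (b - a) by exact: E.
have : (dk c - dg c) * (b - a) <= 0 by rewrite mulr_le0_ge0 // ?subr_le0 ?subr_ge0.
rewrite -E'; lra.
Qed.

(* The factor 2 comes from treating real and imaginary parts separately. *)
Lemma cmean_value f (D : R -> C) (u v : C) (g dg : R -> R) (a b : R) : a <= b ->
  (forall t, a <= t <= b -> cdiff f (u + t%:C%C * v) (D t)) ->
  (forall t, a <= t <= b -> is_derive t 1 g (dg t)) ->
  (forall t, a <= t <= b -> cabs (D t * v) <= dg t) ->
  cabs (f (u + b%:C%C * v) - f (u + a%:C%C * v)) <= 2 * (g b - g a).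
Proof.
move=> ab Hf Hg Hb.
apply: le_trans (cabs_ReIm _) _; rewrite ReB ImB.
have Hn t : a <= t <= b -> is_derive t 1 (- g) (- dg t).
  by move=> /Hg ?; apply: is_deriveN.
have X1 := comparison ab (fun t ht => is_derive_line (Hf t ht)) Hg
   (fun t ht => le_trans (ler_norm _) (le_trans (Re_cabs _) (Hb t ht))).
have X2 := comparison ab (fun t ht => is_derive_lineI (Hf t ht)) Hg
   (fun t ht => le_trans (ler_norm _) (le_trans (Im_cabs _) (Hb t ht))).
have X3 := comparison ab Hn (fun t ht => is_derive_line (Hf t ht))
   (fun t ht => proj1 (andP (eq_ind _ is_true (le_trans (Re_cabs _) (Hb t ht)) _ (ler_norml _ _)))).
have X4 := comparison ab Hn (fun t ht => is_derive_lineI (Hf t ht))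
   (fun t ht => proj1 (andP (eq_ind _ is_true (le_trans (Im_cabs _) (Hb t ht)) _ (ler_norml _ _)))).
move: X1 X2 X3 X4; rewrite !fctE /=.
set A := complex.Re _; set B := complex.Re _; set A' := complex.Im _; set B' := complex.Im _.
move=> X1 X2 X3 X4.
have : `|A - B| <= g b - g a by rewrite ler_norml; apply/andP; split; lra.
have : `|A' - B'| <= g b - g a by rewrite ler_norml; apply/andP; split; lra.
lra.
Qed.

Lemma cmean_value_cst f (D : R -> C) (u v : C) (M : R) :
  (forall t, 0 <= t <= 1 -> cdiff f (u + t%:C%C * v) (D t)) ->
  (forall t, 0 <= t <= 1 -> cabs (D t) <= M) ->
  cabs (f (u + v) - f u) <= 2 * M * cabs v.
Proof.
move=> Hf HM.
have := @cmean_value f D u v (fun t => M * cabs v * t) (fun=> M * cabs v) 0 1 ler01 Hf.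
rewrite mulr1 mulr0 subr0 mul0r addr0 mul1r -mulrA; apply => t ht.
  have := @is_deriveZ _ _ _ (fun x : R^o => x) (M * cabs v) (t : R^o) 1 1 (is_derive_id _ _).
  by rewrite /GRing.scale /= mulr1.
by rewrite cabsM; apply: ler_wpM2r => //; exact: HM.
Qed.

End ComplexCalculus.

(** * Integrals over the unit interval and compactness along curves *)

Section ComplexIntegral.
Variable R : realType.
Local Notation C := (R[i]).
Implicit Types (z w h l c : C) (f g k : C -> C).
Hint Resolve cabs_ge0 : core.

Lemma is_derive_eps (f : R -> R) (x l : R) : is_derive x 1 f l ->
  forall e : R, 0 < e -> exists2 d : R, 0 < d &
  forall h : R, `|h| < d -> `|f (x + h) - f x - l * h| <= e * `|h|.
Proof.
case=> df dl e e0; move: (df) => /cvg_ex[l' cv].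
have ll : l' = l.
  rewrite -dl; apply/esym; apply: cvg_lim cv; exact: norm_hausdorff.
rewrite {}ll in cv.
move/cvgrPdist_le: cv => /(_ e e0) /nbhs_ballP[d /= d0 H].
exists d => // h hd; have [->|h0] := eqVneq h 0.
  by rewrite addr0 subrr mulr0 subr0 normr0 mulr0.
have := H h; rewrite -ball_normE /= sub0r normrN => /(_ hd h0); rewrite /shift /=.
have -> : h *: (1 : R^o) + x = x + h by rewrite /GRing.scale /= mulr1 addrC.
rewrite /GRing.scale /=.
have -> : l - h^-1 * (f (x + h) - f x) = - (h^-1 * (f (x + h) - f x - l * h)) by field.
by rewrite normrN normrM normfV ler_pdivrMl ?normr_gt0 // [`|h| * _]mulrC.
Qed.

Lemma ccont_within k : (forall t : R, 0 <= t <= 1 -> ccont k t%:C%C) ->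
  {within `[0, 1], continuous (fun t : R => complex.Re (k t%:C%C))} /\
  {within `[0, 1], continuous (fun t : R => complex.Im (k t%:C%C))}.
Proof.
move=> H; split; apply: continuous_in_subspaceT => t; rewrite inE /= in_itv /= => ht;
  apply/cvgrPdist_le => e e0; have [d d0 Hd] := H t ht e e0;
  near=> s; (have sd : `|s - t| < d by near: s; apply: cvgr_distC_lt => //; exact: cvg_id);
  rewrite -?ReB -?ImB; apply: le_trans (Re_cabs _) _ || apply: le_trans (Im_cabs _) _;
  rewrite cabsBC; have := Hd (s - t)%:C%C; rewrite cabsR => /(_ sd);
  by rewrite rmorphB /= [t%:C%C + _]addrC subrK.
Unshelve. all: by end_near. Qed.

Lemma ccontD f g z : ccont f z -> ccont g z -> ccont (fun u => f u + g u) z.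
Proof.
move=> Hf Hg e e0; have e20 : 0 < e / 2 by lra.
have [d1 d10 H1] := Hf _ e20; have [d2 d20 H2] := Hg _ e20.
exists (Num.min d1 d2); first by rewrite lt_min d10.
move=> h; rewrite lt_min => /andP[h1 h2].
have -> : f (z + h) + g (z + h) - (f z + g z) = (f (z + h) - f z) + (g (z + h) - g z) by ring.
apply: le_trans (cabsD _ _) _; have := H1 _ h1; have := H2 _ h2; lra.
Qed.

Lemma ccontM f g z : ccont f z -> ccont g z -> ccont (fun u => f u * g u) z.
Proof.
move=> Hf Hg e e0.
pose M := 1 + cabs (f z) + cabs (g z).
have M0 : 0 < M by have := cabs_ge0 (f z); have := cabs_ge0 (g z); rewrite /M; lra.
have e30 : 0 < e / (3 * M) by rewrite divr_gt0 // mulr_gt0.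
have e31 : 0 < Num.min M (e / (3 * M)) by rewrite lt_min M0 e30.
have [d1 d10 H1] := Hf _ e30; have [d2 d20 H2] := Hg _ e31.
exists (Num.min d1 d2); first by rewrite lt_min d10.
move=> h; rewrite lt_min => /andP[h1 h2].
have -> : f (z + h) * g (z + h) - f z * g z =
  (f (z + h) - f z) * g z + (f z * (g (z + h) - g z) + (f (z + h) - f z) * (g (z + h) - g z)) by ring.
apply: le_trans (cabsD _ _) _; apply: le_trans (lerD (lexx _) (cabsD _ _)) _.
rewrite !cabsM; have := H1 _ h1; have := H2 _ h2; rewrite le_min => /andP[].
set A := cabs (f _ - _); set D := cabs (g _ - _) => HD1 HD2 HA.
have E : e = 3 * M * (e / (3 * M)) by field; rewrite gt_eqF.
rewrite {1}E; set m := e / (3 * M) in e30 HD2 HA *.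
have A0 : 0 <= A := cabs_ge0 _; have D0 : 0 <= D := cabs_ge0 _.
have F0 := cabs_ge0 (f z); have G0 := cabs_ge0 (g z).
have X1 : A * cabs (g z) <= m * M by apply: ler_pM => //; rewrite /M; lra.
have X2 : cabs (f z) * D <= M * m by apply: ler_pM => //; rewrite /M; lra.
have X3 : A * D <= m * M by apply: ler_pM.
lra.
Qed.

Lemma ccont_comp f g z : ccont f (g z) -> ccont g z -> ccont (fun u => f (g u)) z.
Proof.
move=> Hf Hg e e0; have [d1 d10 H1] := Hf _ e0.
have d120 : 0 < d1 / 2 by lra.
have [d2 d20 H2] := Hg _ d120; exists d2 => // h hd.
have -> : g (z + h) = g z + (g (z + h) - g z) by ring.
by apply: H1; have := H2 _ hd; lra.
Qed.

Lemma ccont_cst c z : ccont (fun=> c) z.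
Proof. exact: cdiff_ccont (cdiff_cst c z). Qed.

Lemma ccont_id z : ccont id z.
Proof. exact: cdiff_ccont (cdiff_id z). Qed.

Lemma ccontZ c f z : ccont f z -> ccont (fun u => c * f u) z.
Proof. by move=> H; apply: ccontM => //; exact: ccont_cst. Qed.

Lemma ccont_sum (I : Type) (s : seq I) (P : pred I) (F : I -> C -> C) z :
  (forall i, P i -> ccont (F i) z) -> ccont (fun u => \sum_(i <- s | P i) F i u) z.
Proof.
move=> H; have E f g : f =1 g -> ccont f z -> ccont g z by move=> /funext ->.
elim: s => [|i s IH]; first by apply: E (ccont_cst 0 z) => u; rewrite big_nil.
case Pi: (P i); last by apply: E IH => u; rewrite big_cons Pi.
by apply: E (ccontD (H i Pi) IH) => u; rewrite big_cons Pi.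
Qed.

(** The integrand is a function of a complex variable, evaluated at real points, so that
    antiderivatives and integrands stay within the calculus of [cdiff] and [ccont]. *)
Definition cint k : C :=
  Complex (\int[lebesgue_measure]_(t in `[0, 1]) complex.Re (k t%:C%C))
          (\int[lebesgue_measure]_(t in `[0, 1]) complex.Im (k t%:C%C)).

Definition cont01 k := forall t : R, 0 <= t <= 1 -> ccont k t%:C%C.

Lemma cont01_integrable k : cont01 k ->
  lebesgue_measure.-integrable `[0, 1] (EFin \o (fun t : R => complex.Re (k t%:C%C))) /\
  lebesgue_measure.-integrable `[0, 1] (EFin \o (fun t : R => complex.Im (k t%:C%C))).
Proof.
move=> /ccont_within[H1 H2]; split; apply: continuous_compact_integrable => //;
  exact: segment_compact.
Qed.

Lemma cintD k k' : cont01 k -> cont01 k' -> cint (fun u => k u + k' u) = cint k + cint k'.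
Proof.
move=> /cont01_integrable[i1 i2] /cont01_integrable[i3 i4].
rewrite /cint [RHS]/GRing.add /=; congr Complex.
  rewrite -RintegralD //; apply: eq_Rintegral => t _; exact: ReD.
rewrite -RintegralD //; apply: eq_Rintegral => t _; exact: ImD.
Qed.

Lemma cintZ c k : cont01 k -> cint (fun u => c * k u) = c * cint k.
Proof.
move=> ck; have [i1 i2] := cont01_integrable ck.
have j1 (a : R) : lebesgue_measure.-integrable `[0, 1] (EFin \o (fun t : R => a * complex.Re (k t%:C%C))).
  have [+ _] := cont01_integrable (fun t ht => ccontZ a%:C%C (ck t ht)).
  by congr integrable; apply/funext => t /=; rewrite ReM /= mul0r subr0.
have j2 (a : R) : lebesgue_measure.-integrable `[0, 1] (EFin \o (fun t : R => a * complex.Im (k t%:C%C))).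
  have [_ +] := cont01_integrable (fun t ht => ccontZ a%:C%C (ck t ht)).
  by congr integrable; apply/funext => t /=; rewrite ImM /= mul0r addr0.
case: c => a b; rewrite /cint [RHS]/GRing.mul /=; congr Complex.
  rewrite -!RintegralZl // -RintegralB //.
  by apply: eq_Rintegral => t _; rewrite ReM.
rewrite -!RintegralZl // -RintegralD //.
by apply: eq_Rintegral => t _; rewrite ImM.
Qed.

Lemma Rint_bound (k : R -> R) (M : R) :
  lebesgue_measure.-integrable `[0, 1] (EFin \o k) ->
  (forall t : R, 0 <= t <= 1 -> `|k t| <= M) ->
  `|\int[lebesgue_measure]_(t in `[0, 1]) k t| <= M.
Proof.
move=> ik H; apply: le_trans (le_normr_Rintegral _ ik) _; first exact: measurable_itv.
have cM : \int[lebesgue_measure]_(t in `[0, 1]) (cst M t : R) = M.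
  rewrite Rintegral_cst ?measurable_itv //= lebesgue_measure_itv /= lte_fin ltr01.
  by rewrite oppr0 adde0 mulr1.
rewrite -[leRHS]cM; apply: le_Rintegral.
- exact: measurable_itv.
- exact: (integrable_norm ik).
- apply: continuous_compact_integrable; first exact: segment_compact.
  by apply: continuous_subspaceT => x; exact: cst_continuous.
- by move=> t /=; rewrite in_itv /=; exact: H.
Qed.

Lemma cint_bound k (M : R) : cont01 k ->
  (forall t : R, 0 <= t <= 1 -> cabs (k t%:C%C) <= M) -> cabs (cint k) <= 2 * M.
Proof.
move=> /cont01_integrable[i1 i2] H; apply: le_trans (cabs_ReIm _) _ => /=.
have := Rint_bound i1 (fun t ht => le_trans (Re_cabs _) (H t ht)).
have := Rint_bound i2 (fun t ht => le_trans (Im_cabs _) (H t ht)).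
lra.
Qed.

Lemma Rint_FTC (F k : R -> R) : {within `[0, 1], continuous k} ->
  (forall t : R, 0 <= t <= 1 -> is_derive t 1 F (k t)) ->
  \int[lebesgue_measure]_(t in `[0, 1]) k t = F 1 - F 0.
Proof.
move=> ck dF.
have cF t : 0 <= t <= 1 -> {for t, continuous F}.
  by move=> ht; apply/differentiable_continuous/derivable1_diffP; case: (dF t ht).
rewrite /Rintegral (@continuous_FTC2 _ k F) //.
- split.
  + by move=> t; rewrite in_itv /= => /andP[t0 t1]; case: (dF t _) => //; rewrite !ltW.
  + by apply: cvg_at_right_filter; apply: cF; rewrite lexx ler01.
  + by apply: cvg_at_left_filter; apply: cF; rewrite lexx ler01.
- move=> t; rewrite in_itv /= => /andP[t0 t1]; rewrite derive1E.
  by case: (dF t _) => //; rewrite !ltW.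
Qed.

Lemma cint_FTC K k : cont01 k ->
  (forall t : R, 0 <= t <= 1 -> cdiff K t%:C%C (k t%:C%C)) -> cint k = K 1 - K 0.
Proof.
move=> ck dK; have [c1 c2] := ccont_within ck.
have dK' t : 0 <= t <= 1 -> cdiff K (0 + t%:C%C * 1) (k t%:C%C).
  by rewrite add0r mulr1; exact: dK.
have d1 (t : R) : 0 <= t <= 1 -> is_derive t 1 (fun s : R => complex.Re (K (0 + s%:C%C * 1)))
    (complex.Re (k t%:C%C)).
  by move=> ht; have := is_derive_line (dK' t ht); rewrite mulr1.
have d2 (t : R) : 0 <= t <= 1 -> is_derive t 1 (fun s : R => complex.Im (K (0 + s%:C%C * 1)))
    (complex.Im (k t%:C%C)).
  by move=> ht; have := is_derive_lineI (dK' t ht); rewrite mulr1.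
rewrite /cint (Rint_FTC c1 d1) (Rint_FTC c2 d2).
by rewrite !mulr1 !add0r /= rmorph0 rmorph1; case: (K 1) => ? ?; case: (K 0) => ? ?.
Qed.

(** The supremum of the endpoints reachable from [0] is reachable, and it cannot lie below [1]
    because the local hypothesis steps past it. This is compactness of the unit interval, stated for
    properties that pass to unions of adjacent intervals. *)
Lemma creeping (Q : R -> R -> Prop) :
  (forall a b d : R, a <= b -> b <= d -> Q a b -> Q b d -> Q a d) ->
  (forall t, 0 <= t <= 1 -> exists2 d, 0 < d & forall a b, t - d < a -> a <= b ->
     b < t + d -> 0 <= a -> b <= 1 -> Q a b) -> Q 0 1.
Proof.
move=> tr loc.
pose S := [set s : R | 0 <= s <= 1 /\ Q 0 s].
have [d0 d00 H0] := loc 0 ltac:(by rewrite lexx ler01).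
have S0 : S 0 by split; [rewrite lexx ler01|apply: H0; lra].
have ubS : ubound S 1 by move=> s [/andP[]].
have hS : has_sup S by split; [exists 0|exists 1].
pose s := sup S.
have s0 : 0 <= s by apply: ub_le_sup => //; exists 1.
have s1 : s <= 1 by apply: ge_sup => //; exists 0.
have [d d00' Hd] := loc s ltac:(by rewrite s0 s1).
have [u [/andP[u0 u1] Qu] us] := sup_adherent d00' hS.
have us' : u <= s by apply: ub_le_sup; [exists 1|split=> //; rewrite u0 u1].
pose b := Num.min 1 (s + d / 2).
have sb : s <= b by rewrite le_min s1; lra.
have Qb : Q 0 b.
  apply: (tr _ u) => //; first lra.
  apply: Hd => //; first lra.
    by rewrite gt_min; apply/orP; right; lra.
  by rewrite ge_min lexx.
have b1 : b <= 1 by rewrite ge_min lexx.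
have bs : b <= s.
  by apply: ub_le_sup; [exists 1|split=> //; rewrite b1 andbT; lra].
have -> : 1 = b :> R; last by [].
have : b = s by lra.
by rewrite /b /Num.min; case: ifP => // _; lra.
Qed.

(** Turns local constants into one radius and one constant along a whole curve. Two free points are
    carried because the property may be a Taylor remainder between two points near the curve. *)
Lemma compact_curve (c : C -> C) (P : C -> C -> R -> Prop) :
  cont01 c ->
  (forall v v' M M', M <= M' -> P v v' M -> P v v' M') ->
  (forall t : R, 0 <= t <= 1 -> exists2 rho : R, 0 < rho & exists M, forall v v',
     cabs (v - c t%:C%C) < rho -> cabs (v' - c t%:C%C) < rho -> P v v' M) ->
  exists2 rho : R, 0 < rho & exists M, forall t : R, 0 <= t <= 1 -> forall v v',
     cabs (v - c t%:C%C) < rho -> cabs (v' - c t%:C%C) < rho -> P v v' M.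
Proof.
move=> cc mono loc.
pose Q (a b : R) := exists2 rho : R, 0 < rho & exists M, forall t : R, a <= t <= b -> forall v v',
     cabs (v - c t%:C%C) < rho -> cabs (v' - c t%:C%C) < rho -> P v v' M.
apply: (@creeping Q).
  move=> a b d ab bd [r1 r10 [M1 H1]] [r2 r20 [M2 H2]].
  exists (Num.min r1 r2); first by rewrite lt_min r10.
  exists (Num.max M1 M2) => t /andP[ta td] v v'; rewrite !lt_min => /andP[v1 v2] /andP[w1 w2].
  have [tb|tb] := leP t b.
    by apply: mono (H1 t _ _ _ v1 w1); rewrite ?ta // le_max lexx.
  by apply: mono (H2 t _ _ _ v2 w2); rewrite ?td ?(ltW tb) // le_max lexx orbT.
move=> t ht; have [rho rho0 [M HM]] := loc t ht.
(* On a short interval the curve moves by at most [rho / 4], so the ball of radius [rho / 2] about a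
   nearby curve point lies in the ball of radius [rho] about [c t]. *)
have r20 : 0 < rho / 2 by lra.
have r40 : 0 < rho / 4 by lra.
have [d d0 Hd] := cc t ht _ r40.
exists d => // a b ta ab bt a0 b1; exists (rho / 2) => //; exists M => s /andP[sa sb] v v' v1 w1.
have cs : cabs (c s%:C%C - c t%:C%C) <= rho / 4.
  have -> : s%:C%C = t%:C%C + (s - t)%:C%C by rewrite rmorphB /= [t%:C%C + _]addrC subrK.
  by apply: Hd; rewrite cabsR ltr_norml; apply/andP; split; lra.
have X u : u - c t%:C%C = (u - c s%:C%C) + (c s%:C%C - c t%:C%C) by ring.
by apply: HM; rewrite X; apply: le_lt_trans (cabsD _ _) _; lra.
Qed.

End ComplexIntegral.

(** * Exponential, logarithm and complex powers on the right half-plane *)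

Section ExpLog.
Variable R : realType.
Local Notation C := (R[i]).
Implicit Types (z w h l c : C) (f g k : C -> C).
Hint Resolve cabs_ge0 : core.

Lemma cexpD z w : cexp (z + w) = cexp z * cexp w.
Proof.
case: z => a b; case: w => c d; rewrite /cexp /= [RHS]/GRing.mul /=.
by rewrite expRD cosD sinD; congr Complex; ring.
Qed.

Lemma cexp0 : cexp (0 : C) = 1.
Proof. by rewrite /cexp /= expR0 cos0 sin0 mulr1 mulr0. Qed.

Lemma cabs_cexp z : cabs (cexp z) = expR (complex.Re z).
Proof.
rewrite /cabs /cexp /= !exprMn -mulrDr cos2Dsin2 mulr1 sqrtr_sqr ger0_norm //.
Qed.

Lemma cdiff_cexp0 : cdiff (@cexp R) 0 1.
Proof.
move=> e e0.
pose m := Num.min 1 (e / 10); have m0 : 0 < m by rewrite lt_min ltr01 divr_gt0.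
have m1 : m <= 1 by rewrite ge_min lexx.
have me : m <= e / 10 by rewrite ge_min lexx orbT.
have [d1 d10 H1] := is_derive_eps (is_derive_expR (0 : R)) m0.
have [d2 d20 H2] := is_derive_eps (is_derive_cos (0 : R)) m0.
have [d3 d30 H3] := is_derive_eps (is_derive_sin (0 : R)) m0.
exists (Num.min (m / 2) (Num.min d1 (Num.min d2 d3))).
  by rewrite !lt_min divr_gt0 // d10 d20 d30.
case=> x y; rewrite !lt_min => /and4P[h0 h1 h2 h3].
set n := cabs _ in h0 h1 h2 h3 *.
have xn : `|x| <= n by apply: (Re_cabs (Complex x y)).
have yn : `|y| <= n by apply: (Im_cabs (Complex x y)).
have := H1 x (le_lt_trans xn h1); have := H2 y (le_lt_trans yn h2).
have := H3 y (le_lt_trans yn h3).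
rewrite !add0r expR0 cos0 sin0 oppr0 mul0r !subr0 !mul1r ?addr0 => B3 B2 B1.
have X0 : `|expR x - 1| <= 2 * n.
  have -> : expR x - 1 = (expR x - 1 - x) + x by ring.
  apply: le_trans (ler_normD _ _) _; have := normr_ge0 x; nra.
have X1 : `|expR x| <= 2.
  have -> : expR x = (expR x - 1) + 1 by ring.
  apply: le_trans (ler_normD _ _) _; rewrite normr1; lra.
apply: le_trans (cabs_ReIm _) _; rewrite !ReB !ImB cexp0 /= ?add0r ?subr0.
have -> : expR x * cos y - 1 - x = (expR x - 1 - x) + expR x * (cos y - 1) by ring.
have -> : expR x * sin y - y = expR x * (sin y - y) + (expR x - 1) * y by ring.
have Y1 : `|expR x * (cos y - 1)| <= 2 * (m * n).
  rewrite normrM; apply: ler_pM => //; apply: le_trans B2 _; apply: ler_wpM2l => //; exact: ltW.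
have Y2 : `|expR x * (sin y - y)| <= 2 * (m * n).
  rewrite normrM; apply: ler_pM => //; apply: le_trans B3 _; apply: ler_wpM2l => //; exact: ltW.
have n0 : 0 <= n := cabs_ge0 _.
have Y3 : `|(expR x - 1) * y| <= m * n.
  rewrite normrM; apply: ler_pM => //; lra.
have Y4 : m * `|x| <= m * n by apply: ler_wpM2l => //; exact: ltW.
have Y5 : m * n <= e / 10 * n by apply: ler_wpM2r.
have Y6 : 0 <= e * n by rewrite mulr_ge0 // ltW.
have := ler_normD (expR x - 1 - x) (expR x * (cos y - 1)).
have := ler_normD (expR x * (sin y - y)) ((expR x - 1) * y).
lra.
Qed.

Lemma cdiff_cexp z : cdiff (@cexp R) z (cexp z).
Proof.
have H : cdiff (@cexp R) (z - z) 1 by rewrite subrr; exact: cdiff_cexp0.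
have H2 : cdiff (fun u => u - z) z 1.
  by have := cdiffB (cdiff_id z) (cdiff_cst z z); rewrite subr0.
have := cdiffZ (cexp z) (@cdiff_comp R (@cexp R) (fun u => u - z) z 1 1 H H2).
rewrite !mulr1; apply: cdiff_eqf => u.
by rewrite -cexpD [z + _]addrC subrK.
Qed.

Lemma continuous_eps (f : R -> R) (x : R) : {for x, continuous f} ->
  forall e : R, 0 < e -> exists2 d : R, 0 < d & forall y, `|y - x| < d -> `|f y - f x| <= e.
Proof.
move=> /cvgrPdist_le H e e0; have /nbhs_ballP[d /= d0 Hd] := H e e0.
exists d => // y yd; rewrite distrC; apply: Hd; by rewrite -ball_normE /= distrC.
Qed.

(** The definition of [carg] switches formula at the real axis. The arctangent is one smooth formula
    on the right half-plane, where all later estimates of logarithms and powers take place. *)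
Lemma cargE z : 0 < complex.Re z -> carg z = atan (complex.Im z / complex.Re z).
Proof.
case: z => x y /= x0.
have key (s : R) : 0 <= s -> acos (Num.sqrt (1 + s ^+ 2))^-1 = atan s.
  move=> s0; rewrite -cos_atan cosK // in_itv /=; apply/andP; split.
    have [->|sn0] := eqVneq s 0; first by rewrite atan0.
    by rewrite -(atan0 R) ltW // lt_atan // lt_def sn0.
  by apply: le_trans (ltW (atan_ltpi2 _)) _; have := pi_gt0 R; lra.
have E : x / cabs (Complex x y) = (Num.sqrt (1 + (`|y| / x) ^+ 2))^-1.
  have -> : cabs (Complex x y) = x * Num.sqrt (1 + (`|y| / x) ^+ 2).
    rewrite /cabs /= -{2}(gtr0_norm x0) -sqrtr_sqr -sqrtrM ?sqr_ge0 //.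
    congr Num.sqrt; rewrite expr_div_n real_normK ?num_real //; field; exact: lt0r_neq0.
  by rewrite invfM mulrA divff ?mul1r // gt_eqF.
rewrite /carg /= E key; last by rewrite divr_ge0 // ltW.
case: ifP => y0; first by rewrite ger0_norm.
by rewrite ltr0_norm; [rewrite mulNr atanN opprK|move/negbT: y0; rewrite -ltNge].
Qed.

Lemma carg_bound z : 0 < complex.Re z -> `|carg z| <= pi.
Proof.
move=> /cargE ->; rewrite ler_norml.
have := atan_ltpi2 (complex.Im z / complex.Re z).
have := atan_gtNpi2 (complex.Im z / complex.Re z).
have := pi_gt0 R => *; apply/andP; split; lra.
Qed.

Lemma clogK z : 0 < complex.Re z -> cexp (clog z) = z.
Proof.
move=> x0; have z0 : 0 < cabs z.
  by rewrite cabs_gt0; apply: contraTneq x0 => ->; rewrite /= ltxx.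
rewrite /cexp /clog /= cargE // lnK ?posrE //.
set s := _ / _.
have c0 : 0 < cos (atan s).
  by rewrite cos_gt0_pihalf // atan_ltpi2 atan_gtNpi2.
have sE : sin (atan s) = s * cos (atan s).
  by rewrite -{2}(atanK s) /tan mulfVK // gt_eqF.
have E : cabs z * cos (atan s) = complex.Re z.
  have s2 : 0 < 1 + s ^+ 2 by rewrite ltr_pwDl // sqr_ge0.
  have -> : cabs z = complex.Re z * Num.sqrt (1 + s ^+ 2).
    rewrite /cabs -{2}(gtr0_norm x0) -sqrtr_sqr -sqrtrM ?sqr_ge0 //.
    congr Num.sqrt; rewrite /s expr_div_n; field; exact: lt0r_neq0.
  by rewrite cos_atan mulfK // gt_eqF // sqrtr_gt0.
rewrite sE mulrCA E /s mulfVK ?gt_eqF //.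
by case: z {x0 z0 s c0 sE E}.
Qed.

Lemma ccont_clog z : 0 < complex.Re z -> ccont (@clog R) z.
Proof.
move=> x0 e e0; have z0 : 0 < cabs z.
  by rewrite cabs_gt0; apply: contraTneq x0 => ->; rewrite /= ltxx.
have e20 : 0 < e / 2 by lra.
have [d1 d10 H1] := continuous_eps (continuous_ln z0) e20.
have [d2 d20 H2] := continuous_eps (@continuous_atan _ (complex.Im z / complex.Re z)) e20.
set x := complex.Re z in x0 d20 H2 *; set y := complex.Im z in d20 H2 *.
pose m := 2 * (x + `|y|) / x ^+ 2.
have m0 : 0 < m by rewrite divr_gt0 ?exprn_gt0 // mulr_gt0 // ltr_pwDl.
exists (Num.min d1 (Num.min (x / 2) (d2 / m))).
  by rewrite !lt_min d10 /= divr_gt0 //= divr_gt0.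
move=> h; rewrite !lt_min => /and3P[h1 h2 h3].
have hx := Re_cabs h; have hy := Im_cabs h.
have x'0 : x / 2 < complex.Re (z + h).
  by rewrite ReD; move: hx; rewrite ler_norml => /andP[]; rewrite -/x; lra.
have x'0' : 0 < complex.Re (z + h) by lra.
apply: le_trans (cabs_ReIm _) _; rewrite ReB ImB /clog /= !cargE //.
have A : `|ln (cabs (z + h)) - ln (cabs z)| <= e / 2.
  apply: H1; apply: le_lt_trans h1; rewrite ler_norml.
  have := cabsD z h; have := cabsB (z + h) h; rewrite addrK => *.
  by apply/andP; split; lra.
have B : `|atan (complex.Im (z + h) / complex.Re (z + h)) - atan (y / x)| <= e / 2.
  apply: H2.
  have -> : complex.Im (z + h) / complex.Re (z + h) - y / x =
    (complex.Im h * x - y * complex.Re h) / (complex.Re (z + h) * x).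
    rewrite ImD ReD -/x -/y; field; rewrite (gt_eqF x0) /=.
    by move: x'0'; rewrite ReD => /gt_eqF ->.
  rewrite normrM normfV [`|complex.Re (z + h) * x|]gtr0_norm ?mulr_gt0 //.
  rewrite ltr_pdivrMr ?mulr_gt0 //.
  move: h3; rewrite ltr_pdivlMr // => h3.
  have X1 : `|complex.Im h * x - y * complex.Re h| <= cabs h * (x + `|y|).
    apply: le_trans (ler_normB _ _) _; rewrite !normrM (gtr0_norm x0).
    have := normr_ge0 y; have := cabs_ge0 h; nra.
  apply: le_lt_trans X1 _.
  have X2 : d2 * (x ^+ 2 / 2) <= d2 * (complex.Re (z + h) * x).
    apply: ler_wpM2l; first exact: ltW.
    rewrite expr2; nra.
  apply: lt_le_trans X2.
  have -> : cabs h * (x + `|y|) = cabs h * m * (x ^+ 2 / 2).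
    by rewrite /m; field; exact: lt0r_neq0.
  by rewrite ltr_pM2r // divr_gt0 // exprn_gt0.
lra.
Qed.

(** Derivative of an inverse function: if [q] is the increment of the logarithm, then
    [cexp q - 1 = h / z]. Continuity makes [q] small, and the derivative of the exponential at [0]
    then compares [q] with [h / z]. *)
Lemma cdiff_clog z : 0 < complex.Re z -> cdiff (@clog R) z z^-1.
Proof.
move=> x0 e e0.
have z0 : z != 0 by apply: contraTneq x0 => ->; rewrite /= ltxx.
have Z0 : 0 < cabs z by rewrite cabs_gt0.
pose m := Num.min (1 / 2) (e * cabs z / 2).
have m0 : 0 < m by rewrite lt_min !divr_gt0 //= mulr_gt0.
have m1 : m <= 1 / 2 by rewrite ge_min lexx.
have m2 : m <= e * cabs z / 2 by rewrite ge_min lexx orbT.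
have [d d0 Hd] := cdiff_cexp0 m0.
have d20 : 0 < d / 2 by lra.
have [d1 d10 H1] := ccont_clog x0 d20.
exists (Num.min d1 (complex.Re z / 2)); first by rewrite lt_min d10 divr_gt0.
move=> h; rewrite lt_min => /andP[h1 h2].
have x'0 : 0 < complex.Re (z + h).
  by rewrite ReD; have := Re_cabs h; rewrite ler_norml => /andP[]; lra.
set q := clog (z + h) - clog z.
have qd : cabs q < d by have := H1 _ h1; rewrite -/q; lra.
have E : cexp q - 1 = h / z.
  apply: (mulfI z0); rewrite mulrBr mulr1 -{1}(clogK x0) -cexpD /q [clog z + _]addrC subrK clogK //.
  by rewrite mulrC mulfVK // addrAC subrr add0r.
have := Hd _ qd; rewrite add0r cexp0 mul1r E => B.
(* The error is at most [m * cabs q] with [m <= 1 / 2], so half of [cabs q] is absorbed on the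
   left. *)
have qb : cabs q <= 2 * (cabs h / cabs z).
  have : cabs q <= cabs (h / z) + cabs (h / z - q).
    have {1}-> : q = h / z - (h / z - q) by ring.
    exact: cabsB.
  rewrite cabsM cabsV; have := cabs_ge0 q; nra.
have -> : q - z^-1 * h = - (h / z - q) by rewrite opprB [h / z]mulrC.
rewrite cabsN; apply: le_trans B _.
apply: le_trans (ler_wpM2l (ltW m0) qb) _.
have h0 : 0 <= cabs h / cabs z by apply: divr_ge0; exact: cabs_ge0.
have -> : e * cabs h = (e * cabs z / 2) * (2 * (cabs h / cabs z)) by field; exact: lt0r_neq0.
by apply: ler_wpM2r => //; apply: mulr_ge0.
Qed.

Lemma cdiff_cpow (e z : C) : 0 < complex.Re z ->
  cdiff (fun u => cpow u e) z (e * z^-1 * cpow z e).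
Proof.
move=> x0; rewrite /cpow [e * _ * _]mulrC.
apply: (@cdiff_comp _ (@cexp R) (fun u => e * clog u)); first exact: cdiff_cexp.
by apply: cdiffZ; exact: cdiff_clog.
Qed.

Lemma cabs_cpow (z e : C) : 0 < complex.Re z ->
  cabs (cpow z e) = expR (complex.Re e * ln (cabs z) - complex.Im e * carg z).
Proof. by move=> _; rewrite cabs_cexp ReM. Qed.

Lemma clogR (x : R) : 0 < x -> clog x%:C%C = (ln x)%:C%C.
Proof.
move=> x0; rewrite /clog cargE //= mul0r atan0 cabsR gtr0_norm //.
Qed.

End ExpLog.

(** * Cauchy estimate and primitives on star-shaped open sets *)

Section CauchyEstimate.
Variable R : realType.
Local Notation C := (R[i]).
Implicit Types (z w h l c : C) (f g k : C -> C) (D : set C).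
Hint Resolve cabs_ge0 : core.

Definition cop D := forall z, D z -> exists2 rho : R, 0 < rho &
  forall h, cabs h < rho -> D (z + h).

(** A continuous second derivative provides the second-order Taylor bounds on which differentiation
    under the integral sign rests. Solutions and logarithmic sums have it because their derivatives
    are expressed through functions of the same kind. *)
Definition C2 D g g1 g2 := forall z, D z ->
  [/\ cdiff g z (g1 z), cdiff g1 z (g2 z) & ccont g2 z].

Lemma ball_segment u v v' (rho : R) (t : R) : cabs (v - u) < rho -> cabs (v' - u) < rho ->
  0 <= t <= 1 -> cabs (v + t%:C%C * (v' - v) - u) < rho.
Proof.
move=> hv hv' /andP[t0 t1].
have -> : v + t%:C%C * (v' - v) - u = (1 - t)%:C%C * (v - u) + t%:C%C * (v' - u).
  by rewrite rmorphB rmorph1 /=; ring.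
apply: le_lt_trans (cabsD _ _) _; rewrite !cabsM !cabsR !ger0_norm ?subr_ge0 //.
have := cabs_ge0 (v - u); have := cabs_ge0 (v' - u) => h1 h2.
have [->|tn0] := eqVneq t 0; first by rewrite subr0 mul1r mul0r addr0.
have tp : 0 < t by rewrite lt_def tn0.
have : t * cabs (v' - u) < t * rho by rewrite ltr_pM2l.
have : (1 - t) * cabs (v - u) <= (1 - t) * rho by apply: ler_wpM2l; [lra|exact: ltW].
lra.
Qed.

(** Two uses of the mean value inequality, on [g1] and then on the function sending [w] to
    [g w - g1 v * w]; each contributes a factor 2. One constant serves all pairs near [u], as
    [compact_curve] requires. *)
Lemma C2_quad D g g1 g2 u : cop D -> C2 D g g1 g2 -> D u ->
  exists2 rho : R, 0 < rho & exists M : R, forall v v' : C, cabs (v - u) < rho -> cabs (v' - u) < rho ->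
    D v /\ cabs (g v' - g v - g1 v * (v' - v)) <= M * cabs (v' - v) ^+ 2.
Proof.
move=> oD H Du; have [rho rho0 Hr] := oD _ Du.
have [_ _ c2] := H _ Du; have [d d0 Hd] := c2 1 ltr01.
pose r := Num.min rho d.
have r0 : 0 < r by rewrite lt_min rho0.
pose M := cabs (g2 u) + 1.
have M0 : 0 <= M by rewrite addr_ge0 ?cabs_ge0.
have Dr (v : C) : cabs (v - u) < r -> D v.
  rewrite lt_min => /andP[v1 _]; have -> : v = u + (v - u) by ring.
  exact: Hr.
have B (v : C) : cabs (v - u) < r -> cabs (g2 v) <= M.
  rewrite lt_min => /andP[_ v1]; have := Hd _ v1; rewrite [u + _]addrC subrK => X.
  have -> : g2 v = g2 u + (g2 v - g2 u) by ring.
  apply: le_trans (cabsD _ _) _; rewrite /M; lra.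
exists r => //; exists (4 * M) => v v' hv hv'; split; first exact: Dr.
have L (w : C) : cabs (w - u) < r -> cabs (g1 w - g1 v) <= 2 * M * cabs (w - v).
  move=> hw; have := @cmean_value_cst R g1 (fun t => g2 (v + t%:C%C * (w - v))) v (w - v) M.
  rewrite [v + (w - v)]addrC subrK; apply => t ht.
    by have [] := H (v + t%:C%C * (w - v)); first by apply: Dr; exact: ball_segment.
  by apply: B; exact: ball_segment.
pose K := fun w => g w - g1 v * w.
have := @cmean_value_cst R K (fun t => g1 (v + t%:C%C * (v' - v)) - g1 v) v (v' - v)
  (2 * M * cabs (v' - v)).
rewrite [v + (v' - v)]addrC subrK /K.
have -> : g v' - g1 v * v' - (g v - g1 v * v) = g v' - g v - g1 v * (v' - v) by ring.
have -> : 2 * (2 * M * cabs (v' - v)) * cabs (v' - v) = 4 * M * cabs (v' - v) ^+ 2 by ring.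
apply => t ht.
  have [] := H (v + t%:C%C * (v' - v)); first by apply: Dr; exact: ball_segment.
  move=> dg _ _; apply: cdiffB => //.
  by have := cdiffZ (g1 v) (cdiff_id (v + t%:C%C * (v' - v))); rewrite mulr1.
apply: le_trans (L _ _) _; first exact: ball_segment.
rewrite [v + _ - v]addrAC subrr add0r cabsM cabsR.
case/andP: ht => t0 t1; rewrite ger0_norm // ler_wpM2l ?mulr_ge0 //.
by rewrite ler_piMl // cabs_ge0.
Qed.

(** A quadratic error that is uniform in [t] integrates to a quadratic error, which is stronger than
    differentiability. *)
Lemma cint_param (k : C -> C -> C) (k1 : C -> C) z (d M : R) : 0 < d ->
  (forall h, cabs h < d -> cont01 (k (z + h))) -> cont01 k1 ->
  (forall h, cabs h < d -> forall t : R, 0 <= t <= 1 ->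
     cabs (k (z + h) t%:C%C - k z t%:C%C - h * k1 t%:C%C) <= M * cabs h ^+ 2) ->
  cdiff (fun u => cint (k u)) z (cint k1).
Proof.
move=> d0 ck ck1 HM e e0.
pose N : R := 1 + `|M|; have N0 : 0 < N by rewrite ltr_pwDl.
exists (Num.min d (e / (2 * N))); first by rewrite lt_min d0 divr_gt0 // mulr_gt0.
move=> h; rewrite lt_min => /andP[hd he].
have ckz : cont01 (k z) by have := ck 0; rewrite cabs0 addr0; exact.
have c1 : cont01 (fun t => k (z + h) t + (-1) * k z t).
  by move=> t ht; apply: ccontD; [exact: ck|apply: ccontZ; exact: ckz].
have c2 : cont01 (fun t => (- h) * k1 t) by move=> t ht; apply: ccontZ; exact: ck1.
have -> : cint (k (z + h)) - cint (k z) - cint k1 * h =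
  cint (fun t => (k (z + h) t + (-1) * k z t) + (- h) * k1 t).
  rewrite cintD // cintD; [|exact: ck|by move=> t ht; apply: ccontZ; exact: ckz].
  rewrite cintZ // cintZ //; ring.
have cc : cont01 (fun t => (k (z + h) t + (-1) * k z t) + (- h) * k1 t).
  by move=> t ht; apply: ccontD; [exact: c1|exact: c2].
apply: le_trans (cint_bound cc (M := N * cabs h ^+ 2) _) _.
  move=> t ht; have := HM h hd t ht.
  have -> : k (z + h) t%:C%C + -1 * k z t%:C%C + - h * k1 t%:C%C =
     k (z + h) t%:C%C - k z t%:C%C - h * k1 t%:C%C by ring.
  move=> X; apply: le_trans X _; apply: ler_wpM2r; first by rewrite exprn_ge0 ?cabs_ge0.
  by rewrite /N; have := ler_norm M; lra.
move: he; rewrite ltr_pdivlMr ?mulr_gt0 // => he.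
have : cabs h * (2 * N) * cabs h <= e * cabs h by apply: ler_wpM2r; [exact: cabs_ge0|exact: ltW].
by rewrite expr2; lra.
Qed.

(** Let [psi lam] be the first Fourier coefficient of [g] on the circle of radius [lam] about [w].
    The quotient [psi lam / lam] does not depend on the radius and tends to [g1 w] at [0], so [g1 w]
    is the average over the circle of radius [rho]. The factor 2 comes from [cint_bound]. *)
Lemma cauchy_estimate D g g1 g2 w (rho M : R) : cop D -> C2 D g g1 g2 -> 0 < rho ->
  (forall z, cabs (z - w) <= rho -> D z) ->
  (forall z, cabs (z - w) <= rho -> cabs (g z) <= M) ->
  cabs (g1 w) <= 2 * M / rho.
Proof.
move=> oD H rho0 HD HM.
pose tpi : C := Complex 0 (pi *+ 2).
pose e (s : C) := cexp (tpi * s); pose ei (s : C) := cexp (- tpi * s).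
have e_ei s : e s * ei s = 1 by rewrite /e /ei -cexpD mulNr subrr cexp0.
have eR (t : R) : cabs (e t%:C%C) = 1 by rewrite cabs_cexp ReM /= mul0r mulr0 subrr expR0.
have eiR (t : R) : cabs (ei t%:C%C) = 1.
  by rewrite cabs_cexp ReM /= oppr0 mul0r mulr0 subrr expR0.
have de s : cdiff e s (e s * tpi).
  apply: (@cdiff_comp R (@cexp R) (fun u => tpi * u)); first exact: cdiff_cexp.
  by have := cdiffZ tpi (cdiff_id s); rewrite mulr1.
have dei s : cdiff ei s (ei s * - tpi).
  apply: (@cdiff_comp R (@cexp R) (fun u => - tpi * u)); first exact: cdiff_cexp.
  by have := cdiffZ (- tpi) (cdiff_id s); rewrite mulr1.
have tpi1 : cexp tpi = 1 by rewrite /cexp /= expR0 cos2pi sin2pi mulr1 mulr0.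
have e1 : e 1 = 1 by rewrite /e mulr1.
have e0 : e 0 = 1 by rewrite /e mulr0 cexp0.
have ei1 : ei 1 = 1 by have := e_ei 1; rewrite e1 mul1r.
have ei0 : ei 0 = 1 by have := e_ei 0; rewrite e0 mul1r.
have tpi0 : tpi != 0.
  apply/eqP => [[]] /eqP; rewrite mulrn_eq0 /= => /eqP pi0.
  by have := pi_gt0 R; rewrite pi0 ltxx.
have disc (tau : R) (t : R) : 0 <= tau <= rho -> cabs (w + tau%:C%C * e t%:C%C - w) <= rho.
  move=> /andP[t0 t1].
  by rewrite [w + _ - w]addrAC subrr add0r cabsM cabsR eR mulr1 ger0_norm.
pose psi (lam : C) := cint (fun s => g (w + lam * e s) * ei s).
pose psi1 (lam : C) := cint (fun s => g1 (w + lam * e s)).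
have dcurve lam s : cdiff (fun s => w + lam * e s) s (lam * (e s * tpi)).
  have := cdiffD (cdiff_cst w s) (cdiffZ lam (de s)).
  by rewrite add0r.
have dg lam s : D (w + lam * e s) -> cdiff (fun s => g (w + lam * e s) * ei s) s
    (g1 (w + lam * e s) * (lam * (e s * tpi)) * ei s + g (w + lam * e s) * (ei s * - tpi)).
  move=> Dp; apply: cdiffM (dei s).
  apply: (@cdiff_comp R g (fun s => w + lam * e s)); last exact: dcurve.
  by case: (H _ Dp).
have cg1 lam s : D (w + lam * e s) -> ccont (fun s => g1 (w + lam * e s)) s.
  move=> Dp; apply: (@ccont_comp R g1 (fun s => w + lam * e s)).
    by case: (H _ Dp) => _ d2 _; exact: cdiff_ccont d2.
  exact: cdiff_ccont (dcurve lam s).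
have dpsi (tau : R) : 0 <= tau <= rho -> cdiff psi tau%:C%C (psi1 tau%:C%C).
  move=> ht.
  have [d d0 [N HN]] := @compact_curve R (fun s => w + tau%:C%C * e s)
    (fun v v' M => D v /\ cabs (g v' - g v - g1 v * (v' - v)) <= M * cabs (v' - v) ^+ 2)
    (fun t _ => cdiff_ccont (dcurve tau%:C%C t%:C%C))
    ltac:(by move=> v v' N N' NN [Dv X]; split=> //; apply: le_trans X _;
       apply: ler_wpM2r => //; rewrite exprn_ge0 ?cabs_ge0)
    (fun t _ => C2_quad oD H (HD _ (disc _ t ht))).
  apply: (@cint_param (fun lam s => g (w + lam * e s) * ei s) _ _ d N) => //.
  - move=> h hd t t01; apply: (@cdiff_ccont R _ _ _ (dg _ _ _)).
    have [] // := HN t t01 (w + (tau%:C%C + h) * e t%:C%C) (w + (tau%:C%C + h) * e t%:C%C).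
    + have -> : w + (tau%:C%C + h) * e t%:C%C - (w + tau%:C%C * e t%:C%C) = h * e t%:C%C by ring.
      by rewrite cabsM eR mulr1.
    + have -> : w + (tau%:C%C + h) * e t%:C%C - (w + tau%:C%C * e t%:C%C) = h * e t%:C%C by ring.
      by rewrite cabsM eR mulr1.
  - move=> t t01; apply: cg1; apply: HD; exact: disc.
  - move=> h hd t t01.
    have [] := HN t t01 (w + tau%:C%C * e t%:C%C) (w + (tau%:C%C + h) * e t%:C%C).
    + by rewrite subrr cabs0.
    + have -> : w + (tau%:C%C + h) * e t%:C%C - (w + tau%:C%C * e t%:C%C) = h * e t%:C%C by ring.
      by rewrite cabsM eR mulr1.
    move=> _.
    have -> : w + (tau%:C%C + h) * e t%:C%C - (w + tau%:C%C * e t%:C%C) = h * e t%:C%C by ring.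
    rewrite [cabs (h * e _)]cabsM eR mulr1; apply: le_trans.
    set A := g (w + (_ + h) * _); set B := g _; set G := g1 _.
    have -> : A * ei t%:C%C - B * ei t%:C%C - h * G =
       (A - B - G * (h * e t%:C%C)) * ei t%:C%C.
      have -> : h * G = h * G * (e t%:C%C * ei t%:C%C) by rewrite e_ei mulr1.
      by ring.
    by rewrite cabsM eiR mulr1.
(* Up to the factor [tpi], the difference of the two sides is the integral of the [s]-derivative of
   [g (w + tau * e s) * ei s], which takes equal values at [0] and [1]. *)
have rel (tau : R) : 0 <= tau <= rho -> tau%:C%C * psi1 tau%:C%C = psi tau%:C%C.
  move=> ht; have Dt t : D (w + tau%:C%C * e (t%:C%C : C)) by apply: HD; exact: disc.
  have c1 : cont01 (fun s => g1 (w + tau%:C%C * e s)) by move=> t _; exact: cg1.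
  have c2 : cont01 (fun s => g (w + tau%:C%C * e s) * ei s).
    by move=> t _; exact: cdiff_ccont (dg _ _ (Dt t)).
  have E : cint (fun s => (tpi * tau%:C%C) * g1 (w + tau%:C%C * e s) +
             (- tpi) * (g (w + tau%:C%C * e s) * ei s)) = 0.
    rewrite (@cint_FTC R (fun s => g (w + tau%:C%C * e s) * ei s)).
    - by rewrite e1 e0 ei1 ei0 subrr.
    - by move=> t t01; apply: ccontD; apply: ccontZ; [exact: c1|exact: c2].
    - move=> t t01; have := dg tau%:C%C t%:C%C (Dt t); congr cdiff.
      transitivity (g1 (w + tau%:C%C * e t%:C%C) * (tau%:C%C * tpi) * (e t%:C%C * ei t%:C%C)
          + (- tpi) * (g (w + tau%:C%C * e t%:C%C) * ei t%:C%C)); first by ring.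
      by rewrite e_ei mulr1; ring.
  move: E; rewrite cintD; [|by move=> t t01; apply: ccontZ; exact: c1
     |by move=> t t01; apply: ccontZ; exact: c2].
  rewrite !cintZ // -/(psi _) -/(psi1 _) mulNr => /eqP; rewrite subr_eq0 => /eqP E.
  by apply: (mulfI tpi0); rewrite -E mulrA.
have psi00 : psi 0 = 0.
  by have := rel 0; rewrite lexx (ltW rho0) -[(0 : R)%:C%C]/(0 : C) mul0r => /(_ isT) <-.
have psi10 : psi1 0 = g1 w.
  rewrite /psi1 (@cint_FTC R (fun s => g1 w * s)); first by rewrite mulr1 mulr0 subr0.
    by move=> t _; have := @ccont_cst R (g1 w) t%:C%C; congr ccont; apply/funext => s; rewrite mul0r addr0.
  by move=> t _; rewrite mul0r addr0; have := cdiffZ (g1 w) (cdiff_id (t%:C%C : C)); rewrite mulr1.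
(* By [rel] and [dpsi] the derivative of [psi u / u] vanishes on the real interval, so the mean
   value inequality applies with bound [0]. *)
have cphi (tau : R) : 0 < tau <= rho -> psi tau%:C%C / tau%:C%C = psi rho%:C%C / rho%:C%C.
  move=> /andP[t0 t1].
  have := @cmean_value R (fun u => psi u * u^-1) (fun=> 0) 0 1 (fun=> 0) (fun=> 0) tau rho t1.
  rewrite subrr mulr0 !mulr1 !add0r => X.
  apply/eqP; rewrite eq_sym -subr_eq0 -cabs_eq0 eq_le cabs_ge0 andbT; apply: X.
  - move=> t /andP[tt1 tt2]; rewrite mulr1 add0r.
    have tp : 0 < t by lra.
    have tn : t%:C%C != 0 :> C by rewrite (inj_eq (@complexI R)) gt_eqF.
    have tr : 0 <= t <= rho by rewrite tt2 ltW.
    have := cdiffM (dpsi t tr) (cdiff_inv tn); congr cdiff.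
    by rewrite -(rel t tr) ; field.
  - by move=> t _; rewrite cabs0.
(* Letting [tau] tend to [0] in the constant quotient gives the derivative [psi1 0 = g1 w] of [psi]
   at [0]. *)
have G1 : g1 w = psi rho%:C%C / rho%:C%C.
  apply/eqP; rewrite -subr_eq0 -cabs_eq0 eq_le cabs_ge0 andbT.
  apply/ler_addgt0Pr => eps eps0; rewrite add0r.
  have := dpsi 0; rewrite lexx (ltW rho0) => /(_ isT) /(_ eps eps0) [d d0 Hd].
  pose tau := Num.min (d / 2) rho.
  have tau0 : 0 < tau by rewrite lt_min rho0 divr_gt0.
  have taur : tau <= rho by rewrite ge_min lexx orbT.
  have taud : tau <= d / 2 by rewrite ge_min lexx.
  have taun : tau%:C%C != 0 :> C by rewrite (inj_eq (@complexI R)) gt_eqF.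
  have := Hd tau%:C%C; rewrite cabsR gtr0_norm // -[(0 : R)%:C%C]/(0 : C) add0r psi00 subr0 psi10 => X.
  rewrite -(cphi tau) ?tau0 //.
  have -> : g1 w - psi tau%:C%C / tau%:C%C = - (psi tau%:C%C - g1 w * tau%:C%C) / tau%:C%C by field.
  rewrite cabsM cabsN cabsV cabsR gtr0_norm // ler_pdivrMr //; apply: X; lra.
rewrite G1 cabsM cabsV cabsR gtr0_norm //; apply: ler_wpM2r; first by rewrite invr_ge0 ltW.
have rr : 0 <= rho <= rho by rewrite lexx ltW.
apply: cint_bound.
  by move=> t t01; apply: (@cdiff_ccont R _ _ _ (dg _ _ _)); apply: HD; exact: disc.
by move=> t t01; rewrite cabsM eiR mulr1; apply: HM; exact: disc.
Qed.

Definition cprim (x0 : C) g z := (z - x0) * cint (fun s => g (x0 + s * (z - x0))).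

Definition cstar (x0 : C) D := forall z (t : R), D z -> 0 <= t <= 1 -> D (x0 + t%:C%C * (z - x0)).

(** Differentiating under the integral gives the integral of [g + s * g1 * (z - x0)] along the
    segment, and this integrand is the [s]-derivative of [s * g (x0 + s * (z - x0))]. *)
Lemma cprim_diff x0 D g g1 g2 z : cop D -> cstar x0 D -> C2 D g g1 g2 -> D z ->
  cdiff (cprim x0 g) z (g z).
Proof.
move=> oD sD H Dz.
pose J z := cint (fun s => g (x0 + s * (z - x0))).
pose J1 := cint (fun s => s * g1 (x0 + s * (z - x0))).
have dl u s : cdiff (fun s => x0 + s * (u - x0)) s (u - x0).
  have := cdiffD (cdiff_cst x0 s) (cdiffM (cdiff_id s) (cdiff_cst (u - x0) s)).
  by rewrite add0r mul1r mulr0 addr0.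
have cg u s : D (x0 + s * (u - x0)) -> cdiff (fun s => g (x0 + s * (u - x0))) s
   (g1 (x0 + s * (u - x0)) * (u - x0)).
  move=> Dp; apply: (@cdiff_comp R g (fun s => x0 + s * (u - x0))); last exact: dl.
  by case: (H _ Dp).
have cg1 s : D (x0 + s * (z - x0)) -> ccont (fun s => s * g1 (x0 + s * (z - x0))) s.
  move=> Dp; apply: ccontM; first exact: ccont_id.
  apply: (@ccont_comp R g1 (fun s => x0 + s * (z - x0))).
    by case: (H _ Dp) => _ d2 _; exact: cdiff_ccont d2.
  exact: cdiff_ccont (dl _ _).
have dJ : cdiff J z J1.
  have [d d0 [N HN]] := @compact_curve R (fun s => x0 + s * (z - x0))
    (fun v v' M => D v /\ cabs (g v' - g v - g1 v * (v' - v)) <= M * cabs (v' - v) ^+ 2)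
    (fun t _ => cdiff_ccont (dl z t%:C%C))
    ltac:(by move=> v v' N N' NN [Dv X]; split=> //; apply: le_trans X _;
       apply: ler_wpM2r => //; rewrite exprn_ge0 ?cabs_ge0)
    (fun t t01 => C2_quad oD H (sD _ t Dz t01)).
  have E h (t : R) : x0 + t%:C%C * (z + h - x0) - (x0 + t%:C%C * (z - x0)) = t%:C%C * h by ring.
  have Eb h (t : R) : 0 <= t <= 1 -> cabs (t%:C%C * h) <= cabs h.
    by move=> /andP[t0 t1]; rewrite cabsM cabsR ger0_norm // ler_piMl ?cabs_ge0.
  apply: (@cint_param (fun u s => g (x0 + s * (u - x0))) _ _ d `|N|) => //.
  - move=> h hd t t01; apply: (@cdiff_ccont R _ _ _ (cg _ _ _)).
    have X := le_lt_trans (Eb h t t01) hd.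
    by have [] // := HN t t01 (x0 + t%:C%C * (z + h - x0)) (x0 + t%:C%C * (z + h - x0)); rewrite E.
  - by move=> t t01; apply: cg1; exact: sD.
  - move=> h hd t t01.
    have X := le_lt_trans (Eb h t t01) hd.
    have [] := HN t t01 (x0 + t%:C%C * (z - x0)) (x0 + t%:C%C * (z + h - x0)).
    + by rewrite subrr cabs0.
    + by rewrite E.
    move=> _; rewrite E; set G := g1 _.
    have -> : h * (t%:C%C * G) = G * (t%:C%C * h) by ring.
    move=> Y.
    apply: le_trans Y _.
    apply: le_trans (ler_wpM2r (exprn_ge0 2 (cabs_ge0 _)) (ler_norm N)) _.
    by apply: ler_wpM2l => //; rewrite lerXn2r ?nnegrE ?cabs_ge0 //; exact: Eb.
have dz : cdiff (fun u => u - x0) z 1.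
  by have := cdiffB (cdiff_id z) (cdiff_cst x0 z); rewrite subr0.
have := cdiffM dz dJ; rewrite mul1r; congr cdiff.
have c1 : cont01 (fun s => g (x0 + s * (z - x0))).
  by move=> t t01; apply: cdiff_ccont (cg _ _ _); exact: sD.
have c2 : cont01 (fun s => s * g1 (x0 + s * (z - x0))).
  by move=> t t01; apply: cg1; exact: sD.
rewrite /J /J1 -cintZ // -cintD //; last by move=> t t01; apply: ccontZ; exact: c2.
rewrite (@cint_FTC R (fun s => s * g (x0 + s * (z - x0)))).
- by rewrite mul0r mul1r subr0 mul1r [x0 + _]addrC subrK.
- by move=> t t01; apply: ccontD; [exact: c1|apply: ccontZ; exact: c2].
- move=> t t01; have := cdiffM (cdiff_id t%:C%C) (cg z t%:C%C (sD _ _ Dz t01)).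
  by rewrite mul1r; congr cdiff; ring.
Qed.

Lemma cprim0 x0 g : cprim x0 g x0 = 0.
Proof. by rewrite /cprim subrr mul0r. Qed.

End CauchyEstimate.

(** * Linear differential systems: uniqueness on segments, existence by Picard iteration *)

Section LinearSystems.
Variable R : realType.
Local Notation C := (R[i]).
Implicit Types (z w h c : C) (f g : C -> C) (D : set C).
Hint Extern 0 (is_true (@Order.le _ _ _ (cabs _))) => exact: cabs_ge0 : core.

Lemma ccont_bound f u : ccont f u -> exists2 rho : R, 0 < rho &
  exists M : R, forall v, cabs (v - u) < rho -> cabs (f v) <= M.
Proof.
move=> H; have [d d0 Hd] := H 1 ltr01; exists d => //; exists (cabs (f u) + 1) => v hv.
have := Hd _ hv; rewrite [u + _]addrC subrK => X.
have -> : f v = f u + (f v - f u) by ring.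
by apply: le_trans (cabsD _ _) _; lra.
Qed.

Lemma ccont_bound_fam (I : finType) (F : I -> C -> C) u : (forall i, ccont (F i) u) ->
  exists2 rho : R, 0 < rho &
  exists M : R, forall v, cabs (v - u) < rho -> forall i, cabs (F i v) <= M.
Proof.
move=> H.
suff [rho rho0 [M HM]] : exists2 rho : R, 0 < rho & exists M : R,
    forall v, cabs (v - u) < rho -> forall i, i \in enum I -> cabs (F i v) <= M.
  by exists rho => //; exists M => v hv i; apply: HM; rewrite // mem_enum.
elim: (enum I) => [|i s [r1 r10 [M1 H1]]]; first by exists 1 => //; exists 0.
have [r2 r20 [M2 H2]] := ccont_bound (H i).
exists (Num.min r1 r2); first by rewrite lt_min r10.
exists (Num.max M1 M2) => v; rewrite lt_min => /andP[v1 v2] j; rewrite inE le_max.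
by case/orP => [/eqP ->|js]; [rewrite H2 ?orbT|rewrite H1].
Qed.

Lemma is_derive_powc (c t : R) n :
  is_derive t 1 (fun s : R => c * s ^+ n.+1 / n.+1`!%:R) (c * t ^+ n / n`!%:R).
Proof.
have F0 : n.+1`!%:R != 0 :> R by rewrite pnatr_eq0 -lt0n fact_gt0.
have H := @is_deriveX _ _ (fun x : R^o => x) n.+1 (t : R^o) 1 1 (is_derive_id _ _).
have := @is_deriveZ _ _ _ _ (c / n.+1`!%:R) _ _ _ H.
rewrite /GRing.scale /= mulr1.
have -> : c / n.+1`!%:R * (n.+1%:R * t ^+ n) = c * t ^+ n / n`!%:R.
  have G0 : n`!%:R != 0 :> R by rewrite pnatr_eq0 -lt0n fact_gt0.
  rewrite factS natrM; field; rewrite G0 /=.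
  by rewrite addrC natr1 pnatr_eq0.
by congr is_derive; apply/funext => s; rewrite exprfctE /= /GRing.scale /= mulrAC.
Qed.

(** One integration raises the power of [t] and the factorial by one. With [f = g] it gives
    uniqueness; with [f] and [g] consecutive differences of Picard iterates it gives convergence. *)
Lemma ode_step N (f g : 'I_N -> C -> C) (B : 'I_N -> 'I_N -> R -> C) (u w : C) (M K kap : R) n :
  0 <= M -> 0 <= K -> 0 <= kap ->
  (forall t : R, 0 <= t <= 1 -> forall k, cdiff (f k) (u + t%:C%C * w)
     (\sum_l B k l t * g l (u + t%:C%C * w))) ->
  (forall t : R, 0 <= t <= 1 -> forall k l, cabs (B k l t) <= M) ->
  (forall k, f k u = 0) -> 2 * (N%:R * M * cabs w) <= kap ->
  (forall t : R, 0 <= t <= 1 -> forall k, cabs (g k (u + t%:C%C * w)) <= K * (kap ^+ n * t ^+ n / n`!%:R)) ->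
  forall t : R, 0 <= t <= 1 -> forall k,
    cabs (f k (u + t%:C%C * w)) <= K * (kap ^+ n.+1 * t ^+ n.+1 / n.+1`!%:R).
Proof.
move=> M0 K0 kap0 df HB f0 Hk Hg t /andP[t0 t1] k.
pose c := K * kap ^+ n * (N%:R * M * cabs w).
have sub s : 0 <= s <= t -> 0 <= s <= 1 by move=> /andP[-> st] /=; apply: le_trans st t1.
have := @cmean_value R (f k) (fun s => \sum_l B k l s * g l (u + s%:C%C * w)) u w
  (fun s => c * s ^+ n.+1 / n.+1`!%:R) (fun s => c * s ^+ n / n`!%:R) 0 t t0
  (fun s hs => df s (sub s hs) k) (fun s hs => is_derive_powc c s n).
rewrite mul0r addr0 f0 subr0 expr0n /= mulr0 mul0r subr0 => X.
apply: le_trans (X _) _.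
  move=> s hs; rewrite cabsM.
  have Y : cabs (\sum_l B k l s * g l (u + s%:C%C * w)) <=
     \sum_(l < N) M * (K * (kap ^+ n * s ^+ n / n`!%:R)).
    apply: le_trans (cabs_sum _ _ _) _; apply: ler_sum => l _.
    by rewrite cabsM; apply: ler_pM => //; [apply: HB|apply: Hg]; exact: sub.
  apply: le_trans (ler_wpM2r (cabs_ge0 w) Y) _.
  rewrite sumr_const card_ord -[_ *+ N]mulr_natl le_eqVlt; apply/orP; left; apply/eqP.
  by rewrite /c; ring.
have -> : 2 * (c * t ^+ n.+1 / n.+1`!%:R) =
  K * ((2 * (N%:R * M * cabs w)) * kap ^+ n * t ^+ n.+1 / n.+1`!%:R) by rewrite /c; ring.
apply: ler_wpM2l => //; apply: ler_wpM2r; first by rewrite invr_ge0.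
apply: ler_wpM2r; first by rewrite exprn_ge0.
by rewrite exprS; apply: ler_wpM2r => //; rewrite exprn_ge0.
Qed.

Lemma exp_coeff_small (kap K e : R) : 0 < e -> exists n, forall m, (n <= m)%N ->
  `|K * (kap ^+ m / m`!%:R)| <= e.
Proof.
move=> e0; have := cvg_series_cvg_0 (is_cvg_series_exp_coeff kap) => cv.
have K1 : 0 < 1 + `|K| by rewrite ltr_pwDl.
move/cvgrPdist_le: cv => /(_ _ (divr_gt0 e0 K1)) [n _ Hn]; exists n => m nm.
have := Hn m nm; rewrite sub0r normrN ler_pdivlMr // [`|K * _|]normrM /exp_coeff /=.
by have := normr_ge0 K; have := normr_ge0 (kap ^+ m / m`!%:R); nra.
Qed.

(** Feeding the bound of [ode_step] back into itself multiplies a crude bound by [kap ^+ n / n!],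
    which tends to [0]. *)
Lemma ode_unique N (f : 'I_N -> C -> C) (B : 'I_N -> 'I_N -> R -> C) (u w : C) (M : R) :
  (forall t : R, 0 <= t <= 1 -> forall k, cdiff (f k) (u + t%:C%C * w)
     (\sum_l B k l t * f l (u + t%:C%C * w))) ->
  (forall t : R, 0 <= t <= 1 -> forall k l, cabs (B k l t) <= M) ->
  (forall k, f k u = 0) -> forall k, f k (u + w) = 0.
Proof.
move=> df HB' f0 k0.
have N0 : (0 < N)%N by case: N k0 {f B df HB' f0} => // [[]].
have M0 : 0 <= M by apply: le_trans (cabs_ge0 _) (HB' 0 _ k0 k0); rewrite lexx ler01.
have cl t : cdiff (fun s => u + s * w) t w.
  have := cdiffD (cdiff_cst u t) (cdiffM (cdiff_id t) (cdiff_cst w t)).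
  by rewrite add0r mul1r mulr0 addr0.
have [rho rho0 [K' HK']] := @compact_curve R (fun s => u + s * w)
    (fun v v' K => forall k, cabs (f k v) <= K)
    (fun t _ => cdiff_ccont (cl t%:C%C))
    ltac:(by move=> v v' K1 K2 KK H k; apply: le_trans (H k) KK)
    ltac:(by move=> t ht; have [r r0 [K HK]] := ccont_bound_fam (fun k => cdiff_ccont (df t ht k));
       exists r => //; exists K => v v' hv _; exact: HK).
pose K : R := Num.max 0 K'; have K0 : 0 <= K by rewrite le_max lexx.
pose kap := 2 * (N%:R * M * cabs w).
have kap0 : 0 <= kap by rewrite !mulr_ge0.
have bnd n : forall t : R, 0 <= t <= 1 -> forall k,
    cabs (f k (u + t%:C%C * w)) <= K * (kap ^+ n * t ^+ n / n`!%:R).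
  elim: n => [|n IH].
    move=> t ht k; rewrite !expr0 fact0 invr1 !mulr1 le_max; apply/orP; right.
    by apply: (HK' t ht _ (u + t%:C%C * w)); rewrite subrr cabs0.
  exact: (ode_step M0 K0 kap0 df HB' f0 (lexx _) IH).
apply/eqP; rewrite -cabs_eq0 eq_le cabs_ge0 andbT; apply/ler_addgt0Pr => e e0; rewrite add0r.
have [n Hn] := exp_coeff_small kap K e0.
have := bnd n 1; rewrite ler01 lexx mul1r expr1n mulr1 => /(_ isT k0) X.
by apply: le_trans X _; apply: le_trans (ler_norm _) (Hn n _).
Qed.

Definition clim (s : nat -> C) (l : C) := forall e : R, 0 < e ->
  exists n, forall m, (n <= m)%N -> cabs (s m - l) <= e.

Lemma climD s s' l l' : clim s l -> clim s' l' -> clim (fun n => s n + s' n) (l + l').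
Proof.
move=> H H' e e0; have e20 : 0 < e / 2 by lra.
have [n Hn] := H _ e20; have [n' Hn'] := H' _ e20.
exists (maxn n n') => m; rewrite geq_max => /andP[m1 m2].
have -> : s m + s' m - (l + l') = (s m - l) + (s' m - l') by ring.
by apply: le_trans (cabsD _ _) _; have := Hn _ m1; have := Hn' _ m2; lra.
Qed.

Lemma climZ c s l : clim s l -> clim (fun n => c * s n) (c * l).
Proof.
move=> H e e0; have c0 : 0 < 1 + cabs c by have := cabs_ge0 c; lra.
have e1 : 0 < e / (1 + cabs c) by rewrite divr_gt0.
have [n Hn] := H _ e1; exists n => m nm; rewrite -mulrBr cabsM.
have := Hn m nm; rewrite ler_pdivlMr //; have := cabs_ge0 (s m - l); have := cabs_ge0 c; nra.
Qed.

Lemma clim_cst c : clim (fun=> c) c.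
Proof. by move=> e e0; exists 0%N => m _; rewrite subrr cabs0 ltW. Qed.

Lemma clim_sum (I : Type) (r : seq I) (s : I -> nat -> C) (l : I -> C) :
  (forall i, clim (s i) (l i)) -> clim (fun n => \sum_(i <- r) s i n) (\sum_(i <- r) l i).
Proof.
move=> H; elim: r => [|i r IH].
  rewrite big_nil; have -> : (fun n => \sum_(i <- [::]) s i n) = fun=> 0; last exact: clim_cst.
  by apply/funext => n; rewrite big_nil.
rewrite big_cons; have -> : (fun n => \sum_(i <- i :: r) s i n) =
   fun n => s i n + \sum_(i <- r) s i n; last exact: climD.
by apply/funext => n; rewrite big_cons.
Qed.

Lemma clim_shift s l k : clim s l -> clim (fun n => s (n + k)%N) l.
Proof.
by move=> H e e0; have [n Hn] := H e e0; exists n => m nm; apply: Hn; apply: leq_trans nm (leq_addr _ _).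
Qed.

Lemma clim_le s l (K : R) : clim s l -> (forall n, cabs (s n) <= K) -> cabs l <= K.
Proof.
move=> H HK; apply/ler_addgt0Pr => e e0; have [n Hn] := H e e0.
have -> : l = s n - (s n - l) by ring.
by apply: le_trans (cabsB _ _) _; have := Hn n (leqnn n); have := HK n; lra.
Qed.

(** Comparison with the exponential series. The second conclusion bounds all terms at once; it makes
    the Picard iterates locally bounded uniformly in their index. *)
Lemma clim_exp (s : nat -> C) (K kap : R) : 0 <= K -> 0 <= kap ->
  (forall n, cabs (s n.+1 - s n) <= K * (kap ^+ n / n`!%:R)) ->
  (exists l, clim s l) /\ forall n, cabs (s n) <= cabs (s 0%N) + K * expR kap.
Proof.
move=> K0 kap0 H.
have ec0 n : 0 <= kap ^+ n / n`!%:R :> R by rewrite divr_ge0 // exprn_ge0.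
have cvK : cvgn (series (fun n => K * exp_coeff kap n)).
  exact: (@is_cvg_seriesZ R (exp_coeff kap) K (is_cvg_series_exp_coeff kap)).
have part (p : C -> R) : (forall u, `|p u| <= cabs u) -> (forall u v, p (u - v) = p u - p v) ->
    cvgn (fun n => p (s n)).
  move=> pl pB; pose u n := p (s n.+1) - p (s n).
  have cu : cvgn (series u).
    apply: normed_cvg; apply: series_le_cvg cvK => n //=.
      by rewrite mulr_ge0 //; exact: ec0.
    by rewrite /u -pB; apply: le_trans (pl _) _; exact: H.
  have E : (fun n => p (s n)) = (fun n => series u n + p (s 0%N)).
    apply/funext => n; rewrite seriesEnat /= /u.
    by rewrite (telescope_sumr (fun n => p (s n))) // subrK.
  by rewrite E; apply: is_cvgD => //; exact: is_cvg_cst.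
have cvRe := part (@complex.Re R) (@Re_cabs R) (@ReB R).
have cvIm := part (@complex.Im R) (@Im_cabs R) (@ImB R).
split.
  exists (Complex (limn (fun n => complex.Re (s n))) (limn (fun n => complex.Im (s n)))).
  move=> e e0; have e20 : 0 < e / 2 by lra.
  move/cvgrPdist_le: cvRe => /(_ _ e20) [n1 _ H1].
  move/cvgrPdist_le: cvIm => /(_ _ e20) [n2 _ H2].
  exists (maxn n1 n2) => m; rewrite geq_max => /andP[m1 m2].
  apply: le_trans (cabs_ReIm _) _; rewrite ReB ImB /=.
  by have := H1 m m1; have := H2 m m2; rewrite /= distrC => X; rewrite distrC => Y; lra.
move=> n.
have Hs : cabs (s n) <= cabs (s 0%N) + K * series (exp_coeff kap) n.
  elim: n => [|n IH]; first by rewrite seriesEnat /= big_geq // mulr0 addr0.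
  have -> : s n.+1 = s n + (s n.+1 - s n) by ring.
  apply: le_trans (cabsD _ _) _.
  have : series (exp_coeff kap) n.+1 = series (exp_coeff kap) n + kap ^+ n / n`!%:R.
    by rewrite !seriesEnat /= big_nat_recr.
  by move=> ->; rewrite mulrDr; have := H n; lra.
apply: le_trans Hs _; rewrite lerD2l; apply: ler_wpM2l => //.
apply: nondecreasing_cvgn_le (is_cvg_series_exp_coeff kap) _.
by apply: nondecreasing_series => m _ _; exact: ec0.
Qed.

Definition C2ex D g := exists g1 g2, C2 D g g1 g2.

Lemma C2exD D f g : C2ex D f -> C2ex D g -> C2ex D (fun u => f u + g u).
Proof.
move=> [f1 [f2 Hf]] [g1 [g2 Hg]].
exists (fun u => f1 u + g1 u), (fun u => f2 u + g2 u) => z Dz.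
have [a1 a2 a3] := Hf z Dz; have [b1 b2 b3] := Hg z Dz.
by split; [exact: cdiffD|exact: cdiffD|exact: ccontD].
Qed.

Lemma C2exM D f g : C2ex D f -> C2ex D g -> C2ex D (fun u => f u * g u).
Proof.
move=> [f1 [f2 Hf]] [g1 [g2 Hg]].
exists (fun u => f1 u * g u + f u * g1 u),
  (fun u => (f2 u * g u + f1 u * g1 u) + (f1 u * g1 u + f u * g2 u)) => z Dz.
have [a1 a2 a3] := Hf z Dz; have [b1 b2 b3] := Hg z Dz.
split; [exact: cdiffM|by apply: cdiffD; exact: cdiffM|].
have cf := cdiff_ccont a1; have cf1 := cdiff_ccont a2.
have cg := cdiff_ccont b1; have cg1 := cdiff_ccont b2.
by apply: ccontD; apply: ccontD; apply: ccontM.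
Qed.

Lemma C2ex_cst D c : C2ex D (fun=> c).
Proof.
exists (fun=> 0), (fun=> 0) => z _.
by split; [exact: cdiff_cst|exact: cdiff_cst|exact: ccont_cst].
Qed.

Lemma C2ex_sum D (I : Type) (r : seq I) (F : I -> C -> C) :
  (forall i, C2ex D (F i)) -> C2ex D (fun u => \sum_(i <- r) F i u).
Proof.
move=> H; elim: r => [|i r IH].
  have -> : (fun u => \sum_(i <- [::]) F i u) = fun=> 0; last exact: C2ex_cst.
  by apply/funext => u; rewrite big_nil.
have -> : (fun u => \sum_(i <- i :: r) F i u) = fun u => F i u + \sum_(i <- r) F i u.
  by apply/funext => u; rewrite big_cons.
exact: C2exD.
Qed.

Lemma C2ex_poly D (p : {poly C}) : C2ex D (fun u => p.[u]).
Proof.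
exists (fun u => p^`().[u]), (fun u => p^`()^`().[u]) => z _.
by split; [exact: cdiff_poly|exact: cdiff_poly|exact: cdiff_ccont (cdiff_poly _ _)].
Qed.

Lemma C2ex_polyV D (p : {poly C}) : (forall z, D z -> p.[z] != 0) -> C2ex D (fun u => (p.[u])^-1).
Proof.
move=> H.
pose V u := (p.[u])^-1; pose V1 u := - (V u * (V u * p^`().[u])).
have dV z : D z -> cdiff V z (V1 z).
  move=> Dz; have := cdiff_polyV (H z Dz); congr cdiff.
  by rewrite /V1 /V; field; exact: H.
have dP z : cdiff (fun u => p^`().[u]) z p^`()^`().[z] by exact: cdiff_poly.
exists V1, (fun z => - (V1 z * (V z * p^`().[z]) + V z * (V1 z * p^`().[z] + V z * p^`()^`().[z]))).
move=> z Dz; have v := dV z Dz; have cv := cdiff_ccont v; have cp := cdiff_ccont (dP z).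
split=> //.
  by apply: cdiffN; apply: cdiffM => //; apply: cdiffM.
have cN f : ccont f z -> ccont (fun u => - f u) z.
  by move=> /(ccontZ (-1)); congr ccont; apply/funext => u; rewrite mulN1r.
have cv1 : ccont V1 z by apply: cN; apply: ccontM => //; exact: ccontM.
apply: cN; apply: ccontD; first by apply: ccontM => //; exact: ccontM.
apply: ccontM => //; apply: ccontD; apply: ccontM => //.
exact: cdiff_ccont (cdiff_poly _ _).
Qed.

Lemma C2ex_prim x0 D g : cop D -> cstar x0 D -> C2ex D g -> C2ex D (cprim x0 g).
Proof.
move=> oD sD [g1 [g2 H]]; exists g, g1 => z Dz; have [d1 d2 c2] := H z Dz.
split=> //; first exact: cprim_diff H Dz.
exact: cdiff_ccont d2.
Qed.

(** Every Picard iterate is a constant plus a primitive along segments from [x0]. The limit is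
    differentiable because the iterates satisfy second-order Taylor inequalities with a constant
    independent of the index, and these pass to the limit. *)
Theorem ode_exists N (B : 'I_N -> 'I_N -> C -> C) x0 D (v : 'I_N -> C) :
  cop D -> cstar x0 D -> D x0 -> (forall i j, C2ex D (B i j)) ->
  exists Y : 'I_N -> C -> C, (forall i, Y i x0 = v i) /\
    forall z, D z -> forall i, cdiff (Y i) z (\sum_j B i j z * Y j z).
Proof.
move=> oD sD Dx0 HB.
pose F (Y : 'I_N -> C -> C) i z := v i + cprim x0 (fun u => \sum_j B i j u * Y j u) z.
pose Yn n := iter n F (fun i _ => v i).
have C2Y n i : C2ex D (Yn n i).
  elim: n i => [|n IH] i; first exact: C2ex_cst.
  apply: C2exD; first exact: C2ex_cst.
  by apply: C2ex_prim => //; apply: C2ex_sum => j; exact: C2exM.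
have dY n i z : D z -> cdiff (Yn n.+1 i) z (\sum_j B i j z * Yn n j z).
  move=> Dz; have [g1 [g2 Hg]] : C2ex D (fun u => \sum_j B i j u * Yn n j u).
    by apply: C2ex_sum => j; exact: C2exM.
  by have := cdiffD (cdiff_cst (v i) z) (cprim_diff oD sD Hg Dz); rewrite add0r.
have Yx0 n i : Yn n i x0 = v i by case: n => [|n] //=; rewrite /F cprim0 addr0.
have /choice[B1 HB1] : forall ij : 'I_N * 'I_N, exists g1 : C -> C,
    forall z, D z -> cdiff (B ij.1 ij.2) z (g1 z) /\ ccont g1 z.
  move=> [i j]; have [g1 [g2 H]] := HB i j; exists g1 => z Dz /=.
  by have [d1 d2 _] := H z Dz; split=> //; exact: cdiff_ccont d2.
(* The segments from [x0] to points near [z] stay close to one compact segment, so a single [M]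
   bounds the coefficients and their derivatives on all of them. *)
have key z : D z -> exists2 d : R, 0 < d & exists M K kap : R, [/\ 0 <= M, 0 <= K, 0 <= kap,
   forall w, cabs (w - z) < d -> [/\ D w, forall i j, cabs (B i j w) <= M & forall i j, cabs (B1 (i, j) w) <= M] &
   forall w, cabs (w - z) < d -> forall n i, cabs (Yn n.+1 i w - Yn n i w) <= K * (kap ^+ n / n`!%:R)].
  move=> Dz.
  have cl t : cdiff (fun s => x0 + s * (z - x0)) t (z - x0).
    have := cdiffD (cdiff_cst x0 t) (cdiffM (cdiff_id t) (cdiff_cst (z - x0) t)).
    by rewrite add0r mul1r mulr0 addr0.
  have [d d0 [M' HM']] := @compact_curve R (fun s => x0 + s * (z - x0))
    (fun w _ M => [/\ D w, forall i j, cabs (B i j w) <= M & forall i j, cabs (B1 (i, j) w) <= M])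
    (fun t _ => cdiff_ccont (cl t%:C%C))
    ltac:(by move=> w _ K1 K2 KK [Dw H1 H2]; split=> // i j; apply: le_trans KK)
    ltac:(move=> t ht; have Dt := sD _ t Dz ht; have [r0 r00 Hr0] := oD _ Dt;
      have [r1 r10 [M1 H1]] := ccont_bound_fam (fun ij : 'I_N * 'I_N => cdiff_ccont (proj1 (HB1 ij _ Dt)));
      have [r2 r20 [M2 H2]] := ccont_bound_fam (fun ij : 'I_N * 'I_N => (proj2 (HB1 ij _ Dt)));
      exists (Num.min r0 (Num.min r1 r2)); [by rewrite !lt_min r00 r10 r20|];
      exists (Num.max M1 M2) => w w'; rewrite !lt_min => /and3P[w0 w1 w2] _; split;
       [by apply: (eq_ind _ D (Hr0 _ w0)); rewrite addrC subrK
       |move=> i j; rewrite le_max (H1 w w1 (i, j)) //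
       |move=> i j; rewrite le_max (H2 w w2 (i, j)) ?orbT //]).
  (* For [N = 0] the bounds on the entries are vacuous and [M'] may be negative. *)
  pose M : R := Num.max 0 M'.
  have M0 : 0 <= M by rewrite le_max lexx.
  have HM t w : 0 <= t <= 1 -> cabs (w - (x0 + t%:C%C * (z - x0))) < d ->
     [/\ D w, forall i j, cabs (B i j w) <= M & forall i j, cabs (B1 (i, j) w) <= M].
    move=> ht hw; have [Dw H1 H2] := HM' t ht w w hw hw.
    by split=> // i j; rewrite le_max (H1, H2) orbT.
  pose L := cabs (z - x0) + d; have L0 : 0 <= L by rewrite addr_ge0 // ltW.
  pose kap := 2 * (N%:R * M * L).
  have kap0 : 0 <= kap by rewrite !mulr_ge0.
  pose K := kap * \sum_i cabs (v i).
  have S0 : 0 <= \sum_i cabs (v i) by rewrite sumr_ge0.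
  have K0 : 0 <= K by rewrite mulr_ge0.
  exists d => //; exists M, K, kap; split=> //.
    move=> w hw; apply: (HM 1); first by rewrite ler01 lexx.
    by rewrite mul1r [x0 + _]addrC subrK.
  move=> w hw.
  have seg (t : R) : 0 <= t <= 1 -> cabs (x0 + t%:C%C * (w - x0) - (x0 + t%:C%C * (z - x0))) < d.
    move=> /andP[t0 t1].
    have -> : x0 + t%:C%C * (w - x0) - (x0 + t%:C%C * (z - x0)) = t%:C%C * (w - z) by ring.
    rewrite cabsM cabsR ger0_norm //; apply: le_lt_trans hw; exact: ler_piMl.
  have wL : cabs (w - x0) <= L.
    have -> : w - x0 = (z - x0) + (w - z) by ring.
    by apply: le_trans (cabsD _ _) _; rewrite /L; lra.
  have kapL : 2 * (N%:R * M * cabs (w - x0)) <= kap.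
    by rewrite ler_pM2l // ler_wpM2l // mulr_ge0.
  have bB (t : R) : 0 <= t <= 1 -> forall i j, cabs (B i j (x0 + t%:C%C * (w - x0))) <= M.
    by move=> ht; have [] := HM t _ ht (seg t ht).
  have bnd n : forall t : R, 0 <= t <= 1 -> forall i,
     cabs (Yn n.+1 i (x0 + t%:C%C * (w - x0)) - Yn n i (x0 + t%:C%C * (w - x0)))
      <= K * (kap ^+ n * t ^+ n / n`!%:R).
    elim: n => [|n IH].
      move=> t ht i; rewrite !expr0 fact0 invr1 !mulr1.
      have X := @ode_step N (fun i u => Yn 1%N i u - v i) (fun i _ => v i)
         (fun i j t => B i j (x0 + t%:C%C * (w - x0))) x0 (w - x0) M (\sum_i cabs (v i)) kap 0%N
         M0 S0 kap0 _ bB _ kapL _ t ht i.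
      apply: le_trans (X _ _ _) _.
      - move=> s hs k; have [Ds _ _] := HM s _ hs (seg s hs).
        by have := cdiffB (dY 0%N k _ Ds) (cdiff_cst (v k) _); rewrite subr0.
      - by move=> k; rewrite Yx0 subrr.
      - move=> s hs k; rewrite !expr0 fact0 invr1 !mulr1 (bigD1 k) //= lerDl sumr_ge0 //.
      - case/andP: ht => t0 t1; rewrite !expr1 -[1`!]/1%N invr1 mulr1 /K [kap * \sum_i _]mulrC.
        by apply: ler_wpM2l => //; exact: ler_piMr.
    apply: (@ode_step N (fun i u => Yn n.+2 i u - Yn n.+1 i u) (fun i u => Yn n.+1 i u - Yn n i u)
         (fun i j t => B i j (x0 + t%:C%C * (w - x0))) x0 (w - x0) M K kap n) => //.
    - move=> s hs k; have [Ds _ _] := HM s _ hs (seg s hs).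
      have := cdiffB (dY n.+1 k _ Ds) (dY n k _ Ds); congr cdiff.
      rewrite -sumrB; apply: eq_bigr => j _; exact: (esym (mulrBr _ _ _)).
    - by move=> k; rewrite !Yx0 subrr.
  move=> n i; have := bnd n 1; rewrite ler01 lexx mul1r [x0 + _]addrC subrK expr1n mulr1.
  by move=> /(_ isT i).
have /choice[Y HY] : forall iz : 'I_N * C, exists y, D iz.2 -> clim (fun n => Yn n iz.1 iz.2) y.
  move=> [i z] /=; have [Dz|nD] := pselect (D z); last by exists 0.
  have [d d0 [M [K [kap [_ K0 kap0 _ H]]]]] := key z Dz.
  have [//|[l Hl] _] := @clim_exp (fun n => Yn n i z) K kap K0 kap0.
    by move=> n; apply: H; rewrite subrr cabs0.
  by exists l.
exists (fun i z => Y (i, z)); split.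
  move=> i; have := HY (i, x0) Dx0 => /= H.
  apply/eqP; rewrite -subr_eq0 -cabs_eq0 eq_le cabs_ge0 andbT.
  have H' := climD (climZ (-1) H) (clim_cst (v i)).
  rewrite -cabsN opprB addrC -mulN1r; apply: clim_le H' _ => n.
  by rewrite Yx0 mulN1r addNr cabs0.
move=> z Dz i.
have [d d0 [M [K [kap [M0 K0 kap0 HM HK]]]]] := key z Dz.
pose W := \sum_j cabs (v j) + K * expR kap.
have W0 : 0 <= W by rewrite addr_ge0 ?sumr_ge0 // mulr_ge0 // expR_ge0.
have bW w n j : cabs (w - z) < d -> cabs (Yn n j w) <= W.
  move=> hw; have [_ ] := @clim_exp (fun n => Yn n j w) K kap K0 kap0 (fun n => HK w hw n j).
  move=> /(_ n) X; apply: le_trans X _; rewrite /W lerD2r.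
  by rewrite (bigD1 j) //= lerDl sumr_ge0.
pose K1 := N%:R * (M * W + M * (N%:R * (M * W))).
have MW0 : 0 <= M * W by rewrite mulr_ge0.
have K10 : 0 <= K1 by rewrite /K1 mulr_ge0 // addr_ge0 // mulr_ge0 // mulr_ge0.
pose G n w := \sum_j B i j w * Yn n j w.
have dG n w : D w -> cdiff (G n.+1) w
    (\sum_j (B1 (i, j) w * Yn n.+1 j w + B i j w * \sum_m B j m w * Yn n m w)).
  move=> Dw; apply: cdiff_sum => j _; apply: cdiffM; last exact: dY.
  by have [] := HB1 (i, j) w Dw.
have bG n w : cabs (w - z) < d -> cabs (\sum_j (B1 (i, j) w * Yn n.+1 j w +
     B i j w * \sum_m B j m w * Yn n m w)) <= K1.
  move=> hw; have [Dw b1 b2] := HM w hw.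
  have X : cabs (\sum_j (B1 (i, j) w * Yn n.+1 j w + B i j w * \sum_m B j m w * Yn n m w)) <=
     \sum_(j < N) (M * W + M * (N%:R * (M * W))).
    apply: le_trans (cabs_sum _ _ _) _; apply: ler_sum => j _.
    apply: le_trans (cabsD _ _) _; rewrite !cabsM; apply: lerD.
      by apply: ler_pM => //; exact: bW.
    apply: ler_pM => //; apply: le_trans (cabs_sum _ _ _) _.
    have -> : N%:R * (M * W) = \sum_(m < N) (M * W) by rewrite sumr_const card_ord mulr_natl.
    by apply: ler_sum => m _; rewrite cabsM; apply: ler_pM => //; exact: bW.
  by apply: le_trans X _; rewrite sumr_const card_ord -[_ *+ N]mulr_natl.
(* The shift by two is what a second derivative costs: [Yn n.+2] has derivative [G n.+1], whose
   derivative is expressed by [Yn n.+1] and [Yn n] and bounded by [K1]. *)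
have Q n h : cabs h < d -> cabs (Yn n.+2 i (z + h) - Yn n.+2 i z - h * G n.+1 z) <= 4 * K1 * cabs h ^+ 2.
  move=> hd.
  have inb (t : R) : 0 <= t <= 1 -> cabs (z + t%:C%C * h - z) < d.
    move=> /andP[t0 t1]; rewrite [z + _ - z]addrAC subrr add0r cabsM cabsR ger0_norm //.
    by apply: le_lt_trans hd; apply: ler_piMl.
  have L (t : R) : 0 <= t <= 1 -> cabs (G n.+1 (z + t%:C%C * h) - G n.+1 z) <= 2 * K1 * cabs h.
    move=> ht.
    have := @cmean_value_cst R (G n.+1) (fun s : R => \sum_j (B1 (i, j) (z + s%:C%C * (t%:C%C * h)) *
       Yn n.+1 j (z + s%:C%C * (t%:C%C * h)) + B i j (z + s%:C%C * (t%:C%C * h)) *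
       \sum_m B j m (z + s%:C%C * (t%:C%C * h)) * Yn n m (z + s%:C%C * (t%:C%C * h)))) z (t%:C%C * h) K1.
    have inb2 (s : R) : 0 <= s <= 1 -> cabs (z + s%:C%C * (t%:C%C * h) - z) < d.
      move=> /andP[s0 s1]; rewrite mulrA -rmorphM; apply: inb.
      case/andP: ht => t0 t1; by rewrite mulr_ge0 //= mulr_ile1.
    move=> X; apply: le_trans (X _ _) _.
    - by move=> s hs; apply: dG; have [] := HM _ (inb2 s hs).
    - by move=> s hs; apply: bG; exact: inb2.
    apply: ler_wpM2l; first by rewrite mulr_ge0.
    by case/andP: ht => t0 t1; rewrite cabsM cabsR ger0_norm // ler_piMl.
  have := @cmean_value_cst R (fun w => Yn n.+2 i w - G n.+1 z * w)
    (fun t => G n.+1 (z + t%:C%C * h) - G n.+1 z) z h (2 * K1 * cabs h).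
  have gen (x y u s t : C) : x - u * (s + t) - (y - u * s) = x - y - t * u by ring.
  have gen2 (x y : R) : 2 * (2 * x * y) * y = 4 * x * y ^+ 2 by ring.
  rewrite gen gen2.
  apply; last by [].
  move=> t ht; apply: cdiffB; first by apply: dY; have [] := HM _ (inb t ht).
  by have := cdiffZ (G n.+1 z) (cdiff_id (z + t%:C%C * h)); rewrite mulr1.
have QL h : cabs h < d -> cabs (Y (i, z + h) - Y (i, z) - (\sum_j B i j z * Y (j, z)) * h) <=
    4 * K1 * cabs h ^+ 2.
  move=> hd.
  have Dh : D (z + h) by have [] := HM (z + h); rewrite // [z + h - z]addrAC subrr add0r.
  have l1 := clim_shift 2 (HY (i, z + h) Dh).
  have l2 := clim_shift 2 (HY (i, z) Dz).
  have l3 : clim (fun n => G (n + 1)%N z) (\sum_j B i j z * Y (j, z)).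
    apply: (clim_shift 1 (s := fun n => G n z)); apply: clim_sum => j; apply: climZ.
    exact: (HY (j, z) Dz).
  have l4 := climD (climD l1 (climZ (-1) l2)) (climZ (- h) l3).
  have gen (x y u s : C) : x - y - u * s = x + -1 * y + - s * u by ring.
  rewrite gen.
  apply: clim_le l4 _ => n; have := Q n h hd; rewrite addn2 addn1 /=.
  by rewrite mulN1r mulNr.
move=> e e0; exists (Num.min d (e / (4 * K1 + 1))).
  by rewrite lt_min d0 divr_gt0 // ltr_wpDl // mulr_ge0.
move=> h; rewrite lt_min => /andP[h1 h2]; apply: le_trans (QL h h1) _.
move: h2; rewrite ltr_pdivlMr; last by rewrite ltr_wpDl // mulr_ge0.
move=> h2; rewrite expr2 mulrA; apply: ler_wpM2r => //.
by apply: le_trans (ltW h2); rewrite mulrDr mulr1 [4 * K1 * _]mulrC lerDl.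
Qed.

End LinearSystems.

(** * Subspaces as row spaces, degree bounds, and kernels by Cramer's rule *)

Section LinearAlgebra.

(** Take a matrix of maximal rank with rows in [V]: adjoining another element of [V] cannot raise
    the rank, so the element already lies in the row space. *)
Lemma subspace_mx (F : fieldType) N (V : 'rV[F]_N -> Prop) :
  V 0 -> (forall a u v, V u -> V v -> V (a *: u + v)) ->
  exists M : 'M[F]_N, forall v, V v <-> (v <= M)%MS.
Proof.
move=> V0 VL.
have Vmul m (B : 'M[F]_(m, N)) (u : 'rV_m) : (forall i, V (row i B)) -> V (u *m B).
  move=> HB; rewrite mulmx_sum_row; elim/big_ind: _ => // [x y Vx Vy|i _].
    by rewrite -[x]scale1r; exact: VL.
  by rewrite -[_ *: _]addr0; apply: VL.
pose P k := `[< exists2 M : 'M[F]_N, (forall i, V (row i M)) & \rank M = k >].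
have exP : exists k, P k.
  by exists 0%N; apply/asboolP; exists 0; [move=> i; rewrite row0|rewrite mxrank0].
have ubP k : P k -> (k <= N)%N by move=> /asboolP[M _ <-]; exact: rank_leq_row.
case: (ex_maxnP exP ubP) => k /asboolP[M VM rM] kmax.
exists M => v; split=> [Vv|/submxP[u ->]]; last exact: Vmul.
have le : (M <= M + v)%MS by exact: addsmxSl.
have Vadd i : V (row i (M + v)%MS).
  have : (row i (M + v)%MS <= col_mx M v)%MS.
    by apply: submx_trans (row_sub _ _) _; rewrite addsmxE.
  case/submxP => u ->; apply: Vmul => j; case: (split_ordP j) => j' ->.
    by rewrite rowKu.
  by rewrite rowKd (ord1 j') row_id.
have : (\rank (M + v)%MS <= k)%N by apply: kmax; apply/asboolP; exists (M + v)%MS.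
rewrite -rM => rk; have := mxrank_leqif_sup le => /leqifP.
case: ifP => [H _|_]; last by rewrite ltnNge rk.
by apply: submx_trans H; exact: addsmxSr.
Qed.

(** Choose [k0] where the rank is least; a later member of the chain is included in it and has no
    smaller rank, hence equals it. *)
Lemma chain_stable (F : fieldType) N (V : nat -> 'rV[F]_N -> Prop) :
  (forall k, V k 0) -> (forall k a u v, V k u -> V k v -> V k (a *: u + v)) ->
  (forall k v, V k.+1 v -> V k v) ->
  exists k0, forall k v, V k0 v -> V k v.
Proof.
move=> V0 VL Vd.
have /choice[M HM] : forall k, exists M : 'M[F]_N, forall v, V k v <-> (v <= M)%MS.
  by move=> k; exact: (subspace_mx (V0 k) (VL k)).
have Vle k l v : (k <= l)%N -> V l v -> V k v.
  move=> /subnK <-; elim: (l - k)%N => // m IH; rewrite addSn => /Vd; exact: IH.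
pose P r := `[< exists k, \rank (M k) = r >].
have exP : exists r, P r by exists (\rank (M 0%N)); apply/asboolP; exists 0%N.
case: (ex_minnP exP) => r /asboolP[k0 rk0] rmin; exists k0 => k v Vv.
have [kk0|k0k] := leqP k k0; first exact: Vle Vv.
have sub : (M k <= M k0)%MS.
  by apply/row_subP => i; apply/HM; apply: (Vle _ k); [exact: ltnW|apply/HM; exact: row_sub].
have : (\rank (M k0) <= \rank (M k))%N by rewrite rk0; apply: rmin; apply/asboolP; exists k.
move=> rle; have := mxrank_leqif_sup sub => /leqifP.
case: ifP => [H _|_]; last by rewrite ltnNge rle.
by apply/HM; apply: submx_trans H; apply/HM.
Qed.

Lemma unit_completion (F : fieldType) m k (E : 'M[F]_(m, m + k)) : row_free E ->
  exists2 N : 'M[F]_(m + k), N \in unitmx & usubmx N = E.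
Proof.
move=> Ef; have rE : \rank E = m by apply/eqP.
have rC : \rank (E^C)%MS = k by rewrite mxrank_compl rE addnC addnK.
have gen k' : \rank (E^C)%MS = k' -> exists G : 'M[F]_(k', m + k), (G :=: E^C)%MS.
  by move=> <-; exists (row_base (E^C)%MS); exact: eq_row_base.
have [G HG] := gen k rC.
exists (col_mx E G); last by rewrite col_mxKu.
rewrite -row_full_unit -sub1mx -addsmxE (adds_eqmx (eqmx_refl _) HG).
by rewrite sub1mx addsmx_compl_full.
Qed.

Lemma size_sum_bound (F : fieldType) (I : Type) (r : seq I) (P : pred I) (f : I -> {poly F}) d :
  (forall i, P i -> (size (f i) <= d)%N) -> (size (\sum_(i <- r | P i) f i)%R <= d)%N.
Proof.
move=> H; elim/big_ind: _ => // [|x y Hx Hy]; first by rewrite size_poly0.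
by apply: leq_trans (size_polyD _ _) _; rewrite geq_max Hx.
Qed.

Lemma size_mul_bound (F : fieldType) (f g : {poly F}) d e :
  (size f <= d.+1)%N -> (size g <= e.+1)%N -> (size (f * g)%R <= (d + e).+1)%N.
Proof.
move=> Hf Hg; apply: leq_trans (size_polyMleq _ _) _.
move: (leq_add Hf Hg); rewrite addSn addnS; by case: (size f + size g)%N.
Qed.

Lemma size_prod_bound (F : fieldType) n (f : 'I_n -> {poly F}) d :
  (forall i, (size (f i) <= d.+1)%N) -> (size (\prod_i f i)%R <= (n * d).+1)%N.
Proof.
elim: n f => [|n IH] f H; first by rewrite big_ord0 size_poly1.
by rewrite big_ord_recl mulSn; apply: size_mul_bound => //; apply: IH.
Qed.

Lemma size_det_bound (F : fieldType) n (M : 'M[{poly F}]_n) d :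
  (forall i j, (size (M i j) <= d.+1)%N) -> (size (\det M) <= (n * d).+1)%N.
Proof.
move=> H; apply: size_sum_bound => s _.
have E (x : {poly F}) k : (-1) ^+ k * x = ((-1) ^+ k) *: x.
  by rewrite -mul_polyC polyC_exp polyCN.
rewrite E; apply: leq_trans (size_scale_leq _ _) _.
exact: size_prod_bound.
Qed.

Lemma size_adj_bound (F : fieldType) n (M : 'M[{poly F}]_n) d i j :
  (forall i j, (size (M i j) <= d.+1)%N) -> (size ((\adj M) i j) <= (n * d).+1)%N.
Proof.
move=> H; rewrite mxE /cofactor.
have E (x : {poly F}) k : (-1) ^+ k * x = ((-1) ^+ k) *: x.
  by rewrite -mul_polyC polyC_exp polyCN.
rewrite E; apply: leq_trans (size_scale_leq _ _) _.
case: n M H i j => [|n] M H i j; first by case: i.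
apply: leq_trans (@size_det_bound _ _ _ d _) _; first by move=> i' j'; rewrite !mxE.
by rewrite ltnS leq_mul2r leqnSn orbT.
Qed.

Local Notation fr := (map_mx (@tofrac {poly _})).

(** Cramer's rule with the degree of [t] kept out: if [R'] consists of [s] independent columns of
    [Rm], then [X = row_mx E R'] is invertible and a row [V] in the kernel satisfies
    [V *m X = row_mx (V *m E) 0]. Multiplying by [\adj X] recovers [V] from [V *m E], and the degree
    of the adjugate involves only [Rm] and [E]. *)
Lemma kernel_bounded (F : fieldType) p s N (Rm : 'M[{poly F}]_(p + s, N))
    (E : 'M[{poly F}]_(p + s, p)) (t : 'M[{poly F}]_(p, p + s)) d :
  t *m Rm = 0 -> \det (t *m E) != 0 -> (s <= \rank (fr Rm))%N ->
  (forall i j, (size (Rm i j) <= d.+1)%N) -> (forall i j, (size (E i j) <= d.+1)%N) ->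
  exists dd : {poly F}, exists Mt : 'M[{poly F}]_(p, p + s),
    [/\ dd != 0, (forall i j, (size (Mt i j) <= ((p + s) * d).+1)%N) &
     forall V : 'rV[{poly F}]_(p + s), V *m Rm = 0 -> dd *: V = V *m E *m Mt].
Proof.
move=> tR tE rR sR sE.
have frM m n k (A : 'M[{poly F}]_(m, n)) (B : 'M[{poly F}]_(n, k)) : fr (A *m B) = fr A *m fr B.
  exact: map_mxM.
have frdet n (A : 'M[{poly F}]_n) : \det (fr A) = tofrac (\det A) by rewrite det_map_mx.
have tEu : fr (t *m E) \in unitmx by rewrite unitmxE frdet unitfE tofrac_eq0.
have rt : \rank (fr t) = p.
  apply/eqP; rewrite eqn_leq rank_leq_row /=.
  by rewrite -{1}(mxrank_unit tEu) frM mxrankM_maxl.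
have Es : \rank (fr Rm) = s.
  apply/eqP; rewrite eqn_leq rR andbT.
  have := mulmx0_rank_max (A := fr t) (B := fr Rm).
  by rewrite -frM tR map_mx0 => /(_ erefl); rewrite rt leq_add2l.
have gen s' : \rank (fr Rm)^T = s' -> exists f : 'I_s' -> 'I_N, row_free (rowsub f (fr Rm)^T).
  by move=> <-; exists (maxrankfun (fr Rm)^T); exact: maxrowsub_free.
have [f Hf] := gen s (etrans (mxrank_tr _) Es).
pose R' := colsub f Rm.
have rR' : \rank (fr R') = s.
  rewrite -mxrank_tr; have -> : (fr R')^T = rowsub f (fr Rm)^T; last exact/eqP.
  by apply/matrixP => i j; rewrite !mxE.
have tR' : t *m R' = 0.
  apply/matrixP => i j; have /matrixP/(_ i (f j)) := tR.
  by rewrite !mxE => H; rewrite -[RHS]H; apply: eq_bigr => k _; rewrite !mxE.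
pose X := row_mx E R'.
(* A row killed by [R'] lies in the row space of [t], both spaces having dimension [p]; if it is
   killed by [E] too, invertibility of [t *m E] makes it zero. *)
have Xu : fr X \in unitmx.
  rewrite -row_free_unit -kermx_eq0; apply/eqP/row_matrixP => i; rewrite row0.
  set u := row i _.
  have : u *m fr X = 0 by apply/sub_kermxP; exact: row_sub.
  rewrite /X map_row_mx mul_mx_row -row_mx0 => /eq_row_mx[uE uR].
  have : (fr t <= kermx (fr R'))%MS.
    by apply/sub_kermxP; rewrite -frM tR' map_mx0.
  move=> le; have := mxrank_leqif_sup le => /leqifP; rewrite mxrank_ker rR' rt addnK ltnn.
  case: ifP => // H _.
  have : (u <= fr t)%MS by apply: submx_trans H; apply/sub_kermxP.
  case/submxP => c uc; move: uE; rewrite uc -mulmxA -frM => cE.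
  have c0 : c = 0 by rewrite -[c](mulmxK tEu) cE mul0mx.
  by rewrite c0 mul0mx row_mx0.
exists (\det X), (usubmx (\adj X)); split.
- by move: Xu; rewrite unitmxE frdet unitfE tofrac_eq0.
- move=> i j; rewrite mxE; apply: size_adj_bound => a b; rewrite !mxE.
  by case: splitP => k _; rewrite ?mxE.
- move=> V VR; have VR' : V *m R' = 0.
    apply/matrixP => i j; have /matrixP/(_ i (f j)) := VR.
    by rewrite !mxE => H; rewrite -[RHS]H; apply: eq_bigr => k _; rewrite !mxE.
  rewrite -[LHS]mul_mx_scalar -mul_mx_adj mulmxA /X mul_mx_row VR'.
  by rewrite -{1}[\adj _]vsubmxK mul_row_col mul0mx addr0.
Qed.

End LinearAlgebra.

(** * Derivatives of determinants and the multiplicity argument at a point *)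

Section DerivDet.
Variable F : numFieldType.
Implicit Types (g : {poly F}).

Lemma deriv_prod (I : finType) (f : I -> {poly F}) :
  deriv (\prod_i f i) = \sum_j \prod_i (if i == j then deriv (f i) else f i).
Proof.
have key (s : seq I) : uniq s -> deriv (\prod_(i <- s) f i) =
   \sum_(j <- s) \prod_(i <- s) (if i == j then deriv (f i) else f i).
  elim: s => [|x s IH] /=; first by rewrite !big_nil derivC.
  move=> /andP[xs us]; rewrite !big_cons derivM IH // eqxx; congr (_ + _).
    congr (_ * _); rewrite !big_seq; apply: eq_bigr => i is_.
    by rewrite ifN //; apply: contraNneq xs => <-.
  rewrite mulr_sumr !big_seq; apply: eq_bigr => j js; rewrite big_cons ifN //.
  by apply: contraNneq xs => ->.
exact: key (index_enum_uniq _).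
Qed.

Definition set_row n (M : 'M[{poly F}]_n) (j : 'I_n) (v : 'rV[{poly F}]_n) : 'M[{poly F}]_n :=
  \matrix_(i, k) if i == j then v 0 k else M i k.

Lemma deriv_det n (M : 'M[{poly F}]_n) :
  deriv (\det M) = \sum_j \det (set_row M j (map_mx (@deriv F) (row j M))).
Proof.
rewrite /determinant raddf_sum /= exchange_big /=; apply: eq_bigr => s _.
have E (x : {poly F}) k : (-1) ^+ k * x = ((-1) ^+ k) *: x.
  by rewrite -mul_polyC polyC_exp polyCN.
rewrite E derivZ -E deriv_prod mulr_sumr; apply: eq_bigr => j _; congr (_ * _).
by apply: eq_bigr => i _; rewrite !mxE; case: eqP => // ->.
Qed.

Lemma det_set_rowD n (M : 'M[{poly F}]_n) j (a : {poly F}) u v :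
  \det (set_row M j (a *: u + v)) = a * \det (set_row M j u) + \det (set_row M j v).
Proof.
rewrite -[\det (set_row M j v)]mul1r; apply: (determinant_multilinear (i0 := j)).
- by apply/rowP => k; rewrite !mxE eqxx ?mxE mul1r.
- by apply/matrixP => i k; rewrite !mxE eq_sym (negPf (neq_lift _ _)).
- by apply/matrixP => i k; rewrite !mxE eq_sym (negPf (neq_lift _ _)).
Qed.

(** Expanding each determinant along its new row gives the diagonal of [M *m B *m \adj M], whose
    trace is invariant under cyclic permutation. *)
Lemma det_set_row_mul n (M B : 'M[{poly F}]_n) :
  \sum_j \det (set_row M j (row j (M *m B))) = \tr B * \det M.
Proof.
have -> : \tr B * \det M = \tr (M *m B *m \adj M).
  rewrite -mulmxA mxtrace_mulC -mulmxA mul_adj_mx mul_mx_scalar mxtraceZ mulrC //.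
rewrite /mxtrace; apply: eq_bigr => j _; rewrite (expand_det_row _ j) mxE.
apply: eq_bigr => k _; rewrite !mxE eqxx ?mxE; congr (_ * _).
rewrite /cofactor; congr (_ * \det _).
by apply/matrixP => i' k'; rewrite !mxE eq_sym (negPf (neq_lift _ _)).
Qed.

(** The operator [a * d/dz] written on linear forms: if [Y' = (At / a) Y], then
    [a * (v Y)' = (Trow a At v) Y]. *)
Definition Trow q (a : {poly F}) (At : 'M[{poly F}]_q) (v : 'rV[{poly F}]_q) : 'rV[{poly F}]_q :=
  a *: map_mx (@deriv F) v + v *m At.

Lemma deriv_det_Trow q a (At M : 'M[{poly F}]_q) :
  a * deriv (\det M) + \tr At * \det M = \sum_j \det (set_row M j (Trow a At (row j M))).
Proof.
rewrite deriv_det mulr_sumr -det_set_row_mul -big_split /=; apply: eq_bigr => j _.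
by rewrite -det_set_rowD /Trow -row_mul.
Qed.

Lemma dvdp_deriv_XsubC g (al : F) j : g.[al] = 0 -> ('X - al%:P) ^+ j %| deriv g ->
  ('X - al%:P) ^+ j.+1 %| g.
Proof.
move=> ga; have [->|g0] := eqVneq g 0; first by rewrite dvdp0.
have [m [h [ha gE]]] : exists m h, h.[al] != 0 /\ g = h * ('X - al%:P) ^+ m.
  have [m [h Hh gE]] := multiplicity_XsubC g al; exists m, h; split=> //.
  by move: Hh; rewrite g0 /= /root.
have m0 : (0 < m)%N.
  rewrite lt0n; apply: contraNneq ha => m0.
  by move: ga; rewrite gE m0 expr0 mulr1 => ->.
move=> dv; rewrite {1}gE; apply: dvdp_mull; apply: dvdp_exp2l.
rewrite ltnNge; apply/negP => mj.
case: m m0 gE mj => // m _ gE mj.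
have : ('X - al%:P) ^+ m.+1 %| deriv g by apply: dvdp_trans dv; apply: dvdp_exp2l.
rewrite gE derivM deriv_exp derivXsubC mul1r dvdp_addr; last first.
  by apply: dvdp_mull.
rewrite -[_ *+ m.+1]mulr_natr mulrA -['X - _ in X in X %| _]/('X - al%:P).
rewrite exprS mulrAC dvdp_mul2r ?expf_neq0 ?polyXsubC_eq0 // dvdp_XsubCl rootE.
by rewrite hornerM -polyC_natr hornerC mulf_eq0 (negPf ha) pnatr_eq0.
Qed.

(** If [lam] is a non-zero vector killed by the rows [t k] at [al] for all [k < q + mu], every
    determinant formed from such rows vanishes at [al]. Up to a multiple of the determinant itself,
    [a] times its derivative is the sum of the determinants with one index raised, so [mu]
    successive derivatives are controlled and the multiplicity exceeds [mu]. *)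
Lemma Trow_rank q a (At : 'M[{poly F}]_q) (t : nat -> 'rV[{poly F}]_q) (al : F) mu (lam : 'cV[F]_q) :
  a.[al] != 0 -> (forall k, t k.+1 = Trow a At (t k)) ->
  ~~ (('X - al%:P) ^+ mu.+1 %| \det (\matrix_(i < q) t i)) ->
  (forall k, (k < q + mu)%N -> \sum_i (t k 0 i).[al] * lam i 0 = 0) -> lam = 0.
Proof.
move=> aal tS ndv Hl; apply/eqP; apply: contraNT ndv => lam0.
pose Md (ks : 'I_q -> nat) := \det (\matrix_(i < q) t (ks i)).
have van ks : (forall i, (ks i < q + mu)%N) -> (Md ks).[al] = 0.
  move=> Hk; have -> : (Md ks).[al] = \det (map_mx (horner_eval al) (\matrix_(i < q) t (ks i))).
    by rewrite det_map_mx.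
  apply/eqP; rewrite -det_tr; apply/det0P; exists lam^T.
    by rewrite -(inj_eq (@trmx_inj _ _ _)) trmx0 trmxK.
  rewrite -trmx_mul -[RHS]trmx0; congr trmx; apply/colP => i; rewrite !mxE.
  have := Hl _ (Hk i); move=> {2}<-.
  by apply: eq_bigr => j _; rewrite !mxE.
(* Each unit of multiplicity uses up one unit of the room [mu] left above the indices; [a] can be
   cancelled because it does not vanish at [al]. *)
have key j : (j <= mu)%N -> forall ks, (forall i, (ks i + j < q + mu)%N) ->
    ('X - al%:P) ^+ j.+1 %| Md ks.
  elim: j => [|j IH] jm ks Hk.
    by rewrite expr1 dvdp_XsubCl rootE van // => i; have := Hk i; rewrite addn0.
  apply: dvdp_deriv_XsubC.
    by apply: van => i; apply: leq_ltn_trans (Hk i); rewrite leq_addr.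
  have cop : coprimep (('X - al%:P) ^+ j.+1) a.
    by rewrite coprimep_expl // coprimep_sym coprimep_XsubC // /root.
  rewrite -(Gauss_dvdpr _ cop).
  have E : a * deriv (Md ks) = \sum_j \det (set_row (\matrix_(i < q) t (ks i)) j
     (Trow a At (row j (\matrix_(i < q) t (ks i))))) - \tr At * Md ks.
    by rewrite -deriv_det_Trow addrK.
  rewrite E dvdp_sub //; last first.
    apply: dvdp_mull; apply: IH; first exact: ltnW.
    by move=> i; apply: leq_ltn_trans (Hk i); rewrite leq_add2l.
  apply: (big_ind (fun x => ('X - al%:P) ^+ j.+1 %| x)); first exact: dvdp0.
    by move=> x y; exact: dvdp_add.
  move=> i0 _; pose ks' i := if i == i0 then (ks i0).+1 else ks i.
  have -> : \det (set_row (\matrix_(i < q) t (ks i)) i0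
     (Trow a At (row i0 (\matrix_(i < q) t (ks i))))) = Md ks'.
    congr (\det _); apply/matrixP => i k; rewrite [LHS]mxE [RHS]mxE /ks' rowK -tS.
    by case: eqP => // _; rewrite mxE.
  apply: IH; first exact: ltnW.
  move=> i; rewrite /ks'; have := Hk i0; have := Hk i.
  by case: eqP => _; lia.
apply: (key mu (leqnn _) (fun i => i)) => i.
by rewrite ltn_add2r.
Qed.

End DerivDet.

(** * Geometry of the slit disk and points avoiding finite sets *)

Section SlitDisk.
Variable R : realType.
Local Notation C := (R[i]).
Hint Extern 0 (is_true (@Order.le _ _ _ (cabs _))) => exact: cabs_ge0 : core.

Lemma slitdisk_open (r : R) : cop (slitdisk r).
Proof.
move=> z [/andP[z0 zr] nz].
have [e e0 He] : exists2 e : R, 0 < e & forall h, cabs h < e ->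
    ~ (complex.Im (z + h) = 0 /\ complex.Re (z + h) < 0).
  have [Iz|Iz] := eqVneq (complex.Im z) 0.
    have Rz : 0 < complex.Re z.
      rewrite lt_def; apply/andP; split; last by rewrite leNgt; apply/negP => ?; apply: nz.
      apply: contraTneq z0 => Rz; rewrite cabs_gt0 negbK; apply/eqP.
      by case: z Iz Rz {zr nz} => a b /= -> ->.
    exists (complex.Re z) => // h hz [_]; rewrite ReD.
    by have := Re_cabs h; rewrite ler_norml => /andP[]; lra.
  exists `|complex.Im z|; first by rewrite normr_gt0.
  move=> h hz [+ _]; rewrite ImD => E; have := Im_cabs h.
  have -> : complex.Im h = - complex.Im z by lra.
  by rewrite normrN; lra.
exists (Num.min e (Num.min (cabs z) (r - cabs z))); first by rewrite !lt_min e0 z0 subr_gt0.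
move=> h; rewrite !lt_min => /and3P[h1 h2 h3]; split; last exact: He.
have := cabsD z h; have := cabsB (z + h) h; rewrite addrK => *; apply/andP; split; lra.
Qed.

Lemma slitdisk_pos (r x : R) : 0 < x < r -> slitdisk r x%:C%C.
Proof.
move=> /andP[x0 xr]; split; first by rewrite cabsR gtr0_norm // x0.
by move=> [_ /=]; rewrite ltNge ltW.
Qed.

Lemma slitdisk_le (r r' : R) z : r <= r' -> slitdisk r z -> slitdisk r' z.
Proof. by move=> rr [/andP[z0 zr] H]; split=> //; rewrite z0 (lt_le_trans zr). Qed.

(** A segment starting at a positive real returns to the real axis only if its other end is real,
    and then that end is positive too. *)
Lemma slitdisk_star (r x : R) : 0 < x < r -> cstar x%:C%C (slitdisk r).
Proof.
move=> xr z t [/andP[z0 zr] nz] /andP[t0 t1].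
have /andP[x0 xr'] := xr.
set u := _ + _.
have Ru : complex.Re u = x + t * (complex.Re z - x).
  by rewrite /u ReD ReM ReB /= mul0r subr0.
have Iu : complex.Im u = t * complex.Im z.
  by rewrite /u ImD ImM ImB /= !mul0r addr0 add0r subr0.
have nu : ~ (complex.Im u = 0 /\ complex.Re u <= 0).
  rewrite Ru Iu => [[/eqP]]; rewrite mulf_eq0 => /orP[/eqP ->|/eqP Iz]; first by lra.
  have [Rz|Rz] := ltP 0 (complex.Re z).
    have [->|tn] := eqVneq t 0; first by lra.
    have tp : 0 < t by rewrite lt_def tn.
    nra.
  exfalso; apply: nz; split=> //; rewrite lt_neqAle Rz andbT.
  apply: contraTneq z0 => Rz0; rewrite cabs_gt0 negbK; apply/eqP.
  by case: z Iz Rz0 {zr Rz u Ru Iu} => a b /= -> ->.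
split; last by move=> [? ?]; apply: nu; split=> //; exact: ltW.
apply/andP; split.
  rewrite cabs_gt0; apply/eqP => u0; apply: nu; rewrite u0; split=> //.
have := @ball_segment R 0 x%:C%C z r t; rewrite !subr0; apply; rewrite ?t0 //.
by rewrite cabsR gtr0_norm.
Qed.

Lemma avoid_seq (s : seq R) (a b : R) : a < b -> exists2 y, a < y < b & y \notin s.
Proof.
move=> ab.
pose f (k : nat) : R := a + (b - a) / k.+2%:R.
have fab k : a < f k < b.
  have k0 : (0 : R) < k.+2%:R by [].
  have k1 : (1 : R) < k.+2%:R by rewrite ltr1n.
  rewrite /f ltrDl divr_gt0 ?subr_gt0 //= -ltrBDl ltr_pdivrMr //.
  have : 0 < b - a by lra.
  by move=> d0; nra.
have finj : injective f.
  move=> k l /addrI /(mulfI (lt0r_neq0 _)) H; have : 0 < b - a by lra.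
  by move=> /H /invr_inj /eqP; rewrite eqr_nat => /eqP[].
have [|] := boolP (all (mem s) (map f (iota 0 (size s).+1))).
  move=> /allP sub; have := uniq_leq_size _ sub.
  by rewrite map_inj_uniq // iota_uniq size_map size_iota ltnn => /(_ isT).
by move=> /allPn[y /mapP[k _ ->] ys]; exists (f k).
Qed.

Lemma poly_roots (p : {poly C}) : p != 0 -> exists s : seq C, forall z, root p z = (z \in s).
Proof.
move=> p0; have [s Hs] := closed_field_poly_normal p; exists s => z.
by rewrite Hs rootZ ?lead_coef_eq0 // root_prod_XsubC.
Qed.

Lemma poly_nonroot (p : {poly C}) (a b : R) : p != 0 -> a < b ->
  exists2 y, a < y < b & p.[y%:C%C] != 0.
Proof.
move=> /poly_roots[s Hs] ab; have [y yab ys] := avoid_seq (map (@complex.Re R) s) ab.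
exists y => //; apply: contra ys => py; apply/mapP; exists y%:C%C => //.
by rewrite -Hs.
Qed.

Lemma ode_unique_seg N (f : 'I_N -> C -> C) (B : 'I_N -> 'I_N -> C -> C) (u w : C) :
  (forall t : R, 0 <= t <= 1 -> forall k, cdiff (f k) (u + t%:C%C * w)
     (\sum_l B k l (u + t%:C%C * w) * f l (u + t%:C%C * w))) ->
  (forall t : R, 0 <= t <= 1 -> forall k l, ccont (B k l) (u + t%:C%C * w)) ->
  (forall k, f k u = 0) -> forall k, f k (u + w) = 0.
Proof.
move=> df cB f0.
have cl t : cdiff (fun s => u + s * w) t w.
  have := cdiffD (cdiff_cst u t) (cdiffM (cdiff_id t) (cdiff_cst w t)).
  by rewrite add0r mul1r mulr0 addr0.
have [rho rho0 [K HK]] := @compact_curve R (fun s => u + s * w)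
    (fun v v' K => forall kl : 'I_N * 'I_N, cabs (B kl.1 kl.2 v) <= K)
    (fun t _ => cdiff_ccont (cl t%:C%C))
    ltac:(by move=> v v' K1 K2 KK H k; apply: le_trans (H k) KK)
    ltac:(by move=> t ht; have [r r0 [K HK]] := ccont_bound_fam (fun kl : 'I_N * 'I_N => cB t ht kl.1 kl.2);
       exists r => //; exists K => v v' hv _; exact: HK).
apply: (@ode_unique R N f (fun k l t => B k l (u + t%:C%C * w)) u w K df) => // t ht k l.
by apply: (HK t ht _ (u + t%:C%C * w) _ _ (k, l)); rewrite subrr cabs0.
Qed.

End SlitDisk.

(** * Fundamental matrix and linear forms in solutions *)

Section System.
Variables (R : realType) (q : nat).
Local Notation C := (R[i]).
Variables (a : {poly C}) (At : 'M[{poly C}]_q) (r : R).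
Hypothesis r0 : 0 < r.
Hypothesis a0 : forall z, slitdisk r z -> a.[z] != 0.
Local Notation D := (slitdisk r).
Implicit Types (Y : C -> 'cV[C]_q) (v : 'rV[{poly C}]_q).

(** The equation alone, without the convention on values outside the slit disk, so that it restricts
    to smaller disks. *)
Definition psol Y := forall z, D z -> forall i,
  cdiff (fun u => Y u i ord0) z (\sum_j (At i j).[z] / a.[z] * Y z j ord0).

Definition rdot v Y z := \sum_i (v 0 i).[z] * Y z i ord0.

Lemma rdot_diff v Y z : psol Y -> D z -> cdiff (rdot v Y) z (rdot (Trow a At v) Y z / a.[z]).
Proof.
move=> sY Dz; have az := a0 Dz.
have := @cdiff_sum R _ (index_enum _) predT (fun i u => (v 0 i).[u] * Y u i ord0)
  (fun i => (deriv (v 0 i)).[z] * Y z i ord0 +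
     (v 0 i).[z] * \sum_j (At i j).[z] / a.[z] * Y z j ord0) z
  (fun i _ => cdiffM (cdiff_poly _ z) (sY z Dz i)).
congr cdiff; rewrite big_split /= /rdot mulr_suml.
have -> : \sum_i (v 0 i).[z] * (\sum_j (At i j).[z] / a.[z] * Y z j ord0) =
  \sum_i ((v *m At) 0 i).[z] / a.[z] * Y z i ord0.
  under eq_bigr do rewrite mulr_sumr.
  rewrite exchange_big /=; apply: eq_bigr => j _.
  rewrite mxE horner_sum !mulr_suml; apply: eq_bigr => i _.
  by rewrite hornerM; ring.
rewrite -big_split; apply: eq_bigr => i _ /=; set w := v *m At; rewrite /Trow -/w !mxE hornerD hornerM.
by field.
Qed.

Lemma rdot_ccont v Y z : psol Y -> D z -> ccont (rdot v Y) z.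
Proof. move=> sY Dz; exact: cdiff_ccont (rdot_diff v sY Dz). Qed.

Lemma ccont_coef (p : {poly C}) z : D z -> ccont (fun u => p.[u] / a.[u]) z.
Proof.
move=> Dz; apply: ccontM; first exact: cdiff_ccont (cdiff_poly p z).
exact: cdiff_ccont (cdiff_polyV (a0 Dz)).
Qed.

Lemma psol_seg Y (u w : C) : psol Y -> (forall t : R, 0 <= t <= 1 -> D (u + t%:C%C * w)) ->
  Y u = 0 -> Y (u + w) = 0.
Proof.
move=> sY Dt Yu; apply/colP => i; rewrite mxE.
apply: (@ode_unique_seg R q (fun i z => Y z i ord0) (fun i j z => (At i j).[z] / a.[z])) => //.
- by move=> t ht k; apply: sY; exact: Dt.
- by move=> t ht k l; apply: ccont_coef; exact: Dt.
- by move=> k; rewrite Yu mxE.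
Qed.

Lemma psol_unique Y (x : R) : 0 < x < r -> psol Y -> Y x%:C%C = 0 -> forall z, D z -> Y z = 0.
Proof.
move=> xr sY Yx z Dz; have -> : z = x%:C%C + (z - x%:C%C) by ring.
by apply: psol_seg => // t ht; exact: slitdisk_star.
Qed.

Lemma psol_unique_back Y (x : R) z : 0 < x < r -> psol Y -> D z -> Y z = 0 -> Y x%:C%C = 0.
Proof.
move=> xr sY Dz Yz; have -> : x%:C%C = z + (x%:C%C - z) by ring.
apply: psol_seg => // t /andP[t0 t1].
have -> : z + t%:C%C * (x%:C%C - z) = x%:C%C + (1 - t)%:C%C * (z - x%:C%C).
  by rewrite rmorphB rmorph1 /=; ring.
by apply: slitdisk_star => //; apply/andP; split; lra.
Qed.

Lemma psol_lin Y Y' (c : C) : psol Y -> psol Y' -> psol (fun z => c *: Y z + Y' z).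
Proof.
move=> sY sY' z Dz i.
have := cdiffD (cdiffZ c (sY z Dz i)) (sY' z Dz i).
rewrite mulr_sumr -big_split /=.
have -> : (fun u => c * Y u i ord0 + Y' u i ord0) = fun u => (c *: Y u + Y' u) i ord0.
  by apply/funext => u; rewrite !mxE.
by congr cdiff; apply: eq_bigr => j _; rewrite !mxE; ring.
Qed.

Lemma fund_exists (x : R) : 0 < x < r -> exists Phi : C -> 'M[C]_q,
  [/\ Phi x%:C%C = 1%:M, forall c, psol (fun z => Phi z *m c) & forall z, D z -> Phi z \in unitmx].
Proof.
move=> xr.
have /choice[Y HY] : forall k : 'I_q, exists Y : 'I_q -> C -> C,
    (forall i, Y i x%:C%C = (i == k)%:R) /\
    forall z, D z -> forall i, cdiff (Y i) z (\sum_j (At i j).[z] / a.[z] * Y j z).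
  move=> k; apply: (@ode_exists R q (fun i j z => (At i j).[z] / a.[z]) x%:C%C D
    (fun i => (i == k)%:R)).
  - exact: slitdisk_open.
  - exact: slitdisk_star.
  - exact: slitdisk_pos.
  - by move=> i j; apply: C2exM; [exact: C2ex_poly|exact: C2ex_polyV].
pose Phi (z : C) : 'M[C]_q := \matrix_(i, k) Y k i z.
have sol c : psol (fun z => Phi z *m c).
  move=> z Dz i.
  have := @cdiff_sum R _ (index_enum 'I_q) predT (fun k u => c k 0 * Y k i u)
    (fun k => c k 0 * \sum_j (At i j).[z] / a.[z] * Y k j z) z
    (fun k _ => cdiffZ _ ((HY k).2 z Dz i)).
  have -> : (fun u => \sum_k c k 0 * Y k i u) = fun u => (Phi u *m c) i ord0.
    by apply/funext => u; rewrite mxE; apply: eq_bigr => k _; rewrite mxE mulrC.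
  congr cdiff; under eq_bigr do rewrite mulr_sumr.
  rewrite exchange_big /=; apply: eq_bigr => j _; rewrite mxE mulr_sumr.
  by apply: eq_bigr => k _; rewrite mxE; ring.
exists Phi; split=> //.
  by apply/matrixP => i k; rewrite !mxE (HY k).1.
(* A kernel vector of [Phi z] would give a solution vanishing at [z], hence at the base point, where
   [Phi] is the identity. *)
move=> z Dz; rewrite -unitmx_tr -row_free_unit -kermx_eq0; apply/eqP/row_matrixP => i; rewrite row0.
set u := row i _.
have : u *m (Phi z)^T = 0 by apply/sub_kermxP; exact: row_sub.
move=> /(congr1 trmx); rewrite trmx_mul trmxK trmx0 => Pu.
have := psol_unique_back xr (sol u^T) Dz Pu.
have -> : Phi x%:C%C = 1%:M by apply/matrixP => i' k; rewrite !mxE (HY k).1.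
by rewrite mul1mx => /(congr1 trmx); rewrite trmxK trmx0.
Qed.

(** The functions [t k . Y] with [k < p] satisfy a companion system, but its coefficients have poles
    at the roots of [de]. Uniqueness is applied along segments avoiding these roots, and continuity
    gives the remaining points. *)
Lemma rdot_kernel (t : nat -> 'rV[{poly C}]_q) p (de : {poly C}) (c : 'I_p -> {poly C}) Y (x : R) :
  (forall k, t k.+1 = Trow a At (t k)) -> de *: t p = \sum_k c k *: t k ->
  0 < x < r -> de.[x%:C%C] != 0 -> psol Y ->
  (forall k : 'I_p, rdot (t k) Y x%:C%C = 0) -> (0 < p)%N ->
  forall z, D z -> rdot (t 0%N) Y z = 0.
Proof.
move=> tS tp xr dex sY Hx p0.
have de0 : de != 0 by apply: contraNneq dex => ->; rewrite horner0.
pose f (k : 'I_p) := rdot (t k) Y.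
pose B (k l : 'I_p) (z : C) := if (k.+1 == p)%N then (c l).[z] / de.[z] / a.[z]
   else if (k.+1 == l)%N then (a.[z])^-1 else 0.
have df z : D z -> de.[z] != 0 -> forall k, cdiff (f k) z (\sum_l B k l z * f l z).
  move=> Dz dz k; have := rdot_diff (t k) sY Dz; congr cdiff.
  have E1 : de.[z] * rdot (t p) Y z = \sum_l (c l).[z] * f l z.
    have -> : de.[z] * rdot (t p) Y z = rdot (de *: t p) Y z.
      by rewrite /rdot mulr_sumr; apply: eq_bigr => i _; rewrite mxE hornerM mulrA.
    rewrite tp /rdot; under eq_bigr do rewrite summxE horner_sum mulr_suml.
    rewrite exchange_big /=; apply: eq_bigr => l _; rewrite /f /rdot mulr_sumr.
    by apply: eq_bigr => i _; rewrite mxE hornerM mulrA.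
  rewrite -tS /B; case: eqP => [kp|kp].
    have -> : rdot (t k.+1) Y z = \sum_l (c l).[z] / de.[z] * f l z.
      apply: (mulfI dz); rewrite kp E1 mulr_sumr; apply: eq_bigr => l _.
      by field.
    by rewrite mulr_suml; apply: eq_bigr => l _; ring.
  have kp' : (k.+1 < p)%N by rewrite ltn_neqAle ltn_ord andbT; apply/eqP.
  rewrite (bigD1 (Ordinal kp')) //= eqxx big1 ?addr0 1?mulrC //.
  move=> l lk; rewrite ifN ?mul0r //; apply: contraNneq lk => E; apply/eqP/val_inj.
  by rewrite /= E.
have cB z : D z -> de.[z] != 0 -> forall k l, ccont (B k l) z.
  move=> Dz dz k l; rewrite /B; case: eqP => _.
    apply: ccontM; last exact: cdiff_ccont (cdiff_polyV (a0 Dz)).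
    by apply: ccontM; [exact: cdiff_ccont (cdiff_poly _ _)|exact: cdiff_ccont (cdiff_polyV dz)].
  by case: eqP => _; [exact: cdiff_ccont (cdiff_polyV (a0 Dz))|exact: ccont_cst].
have seg u w : (forall s : R, 0 <= s <= 1 -> D (u + s%:C%C * w) /\ de.[u + s%:C%C * w] != 0) ->
   (forall k, f k u = 0) -> forall k, f k (u + w) = 0.
  move=> H; apply: (@ode_unique_seg R p f B) => s hs; have [Ds ds] := H s hs.
    exact: df.
  exact: cB.
have /andP[x0 x1] := xr.
(* A whole real interval of starting points is prepared, so that one of them sees the target without
   a root of [de] in between. *)
have [eta eta0 Heta] : exists2 eta : R, 0 < eta & forall y : R, x <= y <= x + eta ->
    y < r /\ de.[y%:C%C] != 0.
  have e0 : 0 < cabs de.[x%:C%C] / 2 by rewrite divr_gt0 // cabs_gt0.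
  have [d d0 Hd] := cdiff_ccont (cdiff_poly de x%:C%C) e0.
  exists (Num.min (d / 2) ((r - x) / 2)).
    by rewrite lt_min !divr_gt0 ?subr_gt0.
  move=> y /andP[xy yx].
  have : y <= x + d / 2 by apply: le_trans yx _; rewrite lerD2l ge_min lexx.
  have : y <= x + (r - x) / 2 by apply: le_trans yx _; rewrite lerD2l ge_min lexx orbT.
  move=> y1 y2; split; first lra.
  have := Hd (y - x)%:C%C; rewrite cabsR rmorphB /= [x%:C%C + _]addrC subrK => H.
  apply/eqP => dy; have : `|y - x| < d by rewrite ger0_norm; lra.
  by move=> /H; rewrite dy sub0r cabsN; lra.
have fy (y : R) : x <= y <= x + eta -> forall k, f k y%:C%C = 0.
  move=> /andP[xy yx] k; have -> : y%:C%C = x%:C%C + (y - x)%:C%C by rewrite rmorphB /= addrC subrK.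
  apply: seg => // s /andP[s0 s1].
  have -> : x%:C%C + s%:C%C * (y - x)%:C%C = (x + s * (y - x))%:C%C.
    by apply/eqP; rewrite eq_complex /=; apply/andP; split; apply/eqP; ring.
  have h : x <= x + s * (y - x) <= x + eta.
    by apply/andP; split; [rewrite lerDl mulr_ge0 // subr_ge0|nra].
  have [h1 h2] := Heta _ h; split=> //; apply: slitdisk_pos; rewrite h1 andbT.
  by case/andP: h; lra.
have [s Hs] := poly_roots de0.
have good z : D z -> complex.Im z != 0 -> de.[z] != 0 -> f (Ordinal p0) z = 0.
  move=> Dz Iz dz.
  (* The point where the line through [z] and the root [rho] meets the real axis; a starting point
     avoiding these finitely many values is joined to [z] by a segment free of roots. *)
  pose g (rho : C) := (complex.Re rho - complex.Im rho / complex.Im z * complex.Re z)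
     / (1 - complex.Im rho / complex.Im z).
  have [y /andP[y1 y2] ys] := @avoid_seq R (map g s) x (x + eta) ltac:(lra).
  have yr : y < r by have [] := Heta y; rewrite // !ltW.
  have yr' : 0 < y < r by rewrite yr andbT; lra.
  have -> : z = y%:C%C + (z - y%:C%C) by ring.
  apply: seg; last by apply: fy; rewrite !ltW.
  move=> l hl; split; first exact: slitdisk_star.
  apply: contra ys => ry; apply/mapP.
  exists (y%:C%C + l%:C%C * (z - y%:C%C)); first by rewrite -Hs.
  rewrite /g ReD ImD ReM ImM ReB ImB /= !mul0r !subr0 !addr0 !add0r.
  have ln1 : l != 1.
    apply: contraNneq dz => l1; move: ry.
    by rewrite l1 mul1r [y%:C%C + _]addrC subrK.
  rewrite mulfK //.
  have : 1 - l != 0 by rewrite subr_eq0 eq_sym.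
  by move=> h; field.
move=> z Dz; apply/eqP; apply: contraT => fz.
(* A small vertical shift moves [z] off the real axis and off the roots of [de]; by continuity the
   value there would still be non-zero. *)
have fz0 : 0 < cabs (rdot (t 0%N) Y z) / 2 by rewrite divr_gt0 // cabs_gt0.
have [d d0 Hd] := rdot_ccont (t 0%N) sY Dz fz0.
have [d' d'0 Hd'] := slitdisk_open Dz.
have [y /andP[y1 y2] ys] := @avoid_seq R (- complex.Im z :: map (fun rho => complex.Im rho - complex.Im z) s)
   0 (Num.min d d') ltac:(by rewrite lt_min d0).
move: y2; rewrite lt_min => /andP[yd yd'].
move: ys; rewrite inE negb_or => /andP[yz ys].
pose h : C := Complex 0 y.
have ch : cabs h = y by rewrite /cabs /= expr0n add0r sqrtr_sqr gtr0_norm.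
have Dzh : D (z + h) by apply: Hd'; rewrite ch.
have Ih : complex.Im (z + h) != 0.
  by rewrite ImD /=; apply: contraNneq yz => E; apply/eqP; lra.
have dh : de.[z + h] != 0.
  apply: contra ys => rh; apply/mapP; exists (z + h); first by rewrite -Hs.
  by rewrite ImD /=; lra.
have := Hd h; rewrite ch => /(_ yd); have := good _ Dzh Ih dh; rewrite /f /= => ->.
by rewrite sub0r cabsN; lra.
Qed.

End System.

(** * Fractions of polynomials, clearing denominators, rank over the rational functions *)

Section Fractions.

Lemma fracE (D : idomainType) (x : {fraction D}) :
  x = tofrac (generic_quotient.repr x).1 / tofrac (generic_quotient.repr x).2.
Proof.
have d0 := denom_ratioP (generic_quotient.repr x).
have d0' : tofrac (generic_quotient.repr x).2 != 0 by rewrite tofrac_eq0.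
apply: (mulIf d0'); rewrite mulfVK //.
rewrite -{1}[x]generic_quotient.reprK; set y := generic_quotient.repr x in d0 *.
rewrite /tofrac; unlock FracField.tofrac.
rewrite -[_ * _]/(FracField.mul _ _) -FracField.pi_mul /FracField.mulf.
apply/eqP; rewrite FracField.equivf_def /equivf /= !numden_Ratio ?oner_neq0 ?mulr1 //.
by rewrite mulrC.
Qed.

Lemma frac_exists (D : idomainType) (x : {fraction D}) :
  exists n d : D, d != 0 /\ x = tofrac n / tofrac d.
Proof.
exists (generic_quotient.repr x).1, (generic_quotient.repr x).2.
by split; [exact: denom_ratioP|exact: fracE].
Qed.

Lemma clear_denom (D : idomainType) m n (M : 'M[{fraction D}]_(m, n)) :
  exists2 e : D, e != 0 & exists B : 'M[D]_(m, n), tofrac e *: M = map_mx (@tofrac D) B.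
Proof.
have /choice[d Hd] : forall ij : 'I_m * 'I_n, exists d : D, d != 0 /\
    exists n0, M ij.1 ij.2 = tofrac n0 / tofrac d.
  by move=> [i j]; have [n0 [d [d0 E]]] := frac_exists (M i j); exists d; split=> //; exists n0.
exists (\prod_ij d ij); first by apply/prodf_neq0 => ij _; have [] := Hd ij.
have /choice[B HB] : forall ij : 'I_m * 'I_n, exists b,
    tofrac (\prod_ij d ij) * M ij.1 ij.2 = tofrac b.
  move=> ij; have [d0 [n0 ->]] := Hd ij.
  exists (n0 * \prod_(kl | kl != ij) d kl).
  have gen (F : fieldType) (x y z : F) : x != 0 -> x * y * (z / x) = z * y by move=> x0; field.
  by rewrite (bigD1 ij) //= !tofracM gen // tofrac_eq0.
exists (\matrix_(i, j) B (i, j)); apply/matrixP => i j; rewrite !mxE.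
exact: (HB (i, j)).
Qed.

Local Notation fr := (map_mx (@tofrac {poly _})).

Lemma frM (F : fieldType) m n k (A : 'M[{poly F}]_(m, n)) (B : 'M[{poly F}]_(n, k)) :
  fr (A *m B) = fr A *m fr B.
Proof. exact: map_mxM. Qed.

Lemma fr_inj (F : fieldType) m n (A B : 'M[{poly F}]_(m, n)) : fr A = fr B -> A = B.
Proof.
move=> /matrixP E; apply/matrixP => i j; have := E i j; rewrite !mxE => /eqP.
by rewrite tofrac_eq => /eqP.
Qed.

Lemma fr_eq0 (F : fieldType) m n (A : 'M[{poly F}]_(m, n)) : fr A = 0 -> A = 0.
Proof. by move=> E; apply: fr_inj; rewrite E map_mx0. Qed.

(** Take the least [p] such that [t p] depends on its predecessors over the field of fractions:
    minimality makes those independent, and clearing denominators gives the polynomial relation. *)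
Lemma dep_exists (F : fieldType) q (t : nat -> 'rV[{poly F}]_q) : t 0%N != 0 ->
  exists p, [/\ (0 < p <= q)%N, row_free (fr (\matrix_(k < p) t k)) &
   exists2 de : {poly F}, de != 0 & exists c : 'I_p -> {poly F},
     de *: t p = \sum_k c k *: t k].
Proof.
move=> t0; pose mx p : 'M[{poly F}]_(p, q) := \matrix_(k < p) t k.
pose P p := (fr (t p) <= fr (mx p))%MS.
have sub k : (fr (mx k) <= fr (mx k.+1))%MS.
  apply/row_subP => i; rewrite -map_row rowK.
  have -> : t i = row (widen_ord (leqnSn k) i) (mx k.+1) by rewrite rowK.
  by rewrite map_row row_sub.
have sub1 k : (fr (t k) <= fr (mx k.+1))%MS.
  have -> : t k = row ord_max (mx k.+1) by rewrite rowK.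
  by rewrite map_row row_sub.
have rk k : (forall j, (j < k)%N -> ~~ P j) -> \rank (fr (mx k)) = k.
  elim: k => [|k IH] H; first by apply/eqP; rewrite -leqn0 rank_leq_row.
  apply/eqP; rewrite eqn_leq rank_leq_row /=.
  rewrite -{1}[k]IH; last by move=> j jk; apply: H; exact: ltnW.
  apply: rank_ltmx; rewrite ltmxE sub /=; apply: contra (H k (leqnn _)) => le.
  exact: submx_trans (sub1 k) le.
have exP : exists p, P p.
  apply: contrapT => nP; have : \rank (fr (mx q.+1)) = q.+1.
    by apply: rk => j _; apply/negP => Pj; apply: nP; exists j.
  by move=> E; have := rank_leq_col (fr (mx q.+1)); rewrite E ltnn.
case: (ex_minnP exP) => p Pp pmin.
have rp : \rank (fr (mx p)) = p.
  by apply: rk => j jp; apply/negP => /pmin; rewrite leqNgt jp.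
exists p; split.
- apply/andP; split; last by rewrite -{1}rp rank_leq_col.
  rewrite lt0n; apply: contraNneq t0 => p0; subst p.
  by apply/eqP/fr_eq0; apply/eqP; rewrite -submx0; apply: submx_trans Pp _; rewrite flatmx0 sub0mx.
- by rewrite /row_free -/(mx p) rp.
- case/submxP: Pp => u E; have [e e0 [B HB]] := clear_denom u.
  exists e => //; exists (fun k => B 0 k).
  apply: fr_inj.
  have -> : fr (e *: t p) = tofrac e *: fr (t p) by apply/matrixP => i j; rewrite !mxE rmorphM.
  rewrite E scalemxAl HB -frM; congr (fr _); rewrite mulmx_sum_row.
  by apply: eq_bigr => k _; rewrite rowK.
Qed.

(** [E] selects [p] independent columns. Being constant, it does not raise degrees. *)
Lemma col_selection (F : fieldType) p q (t : 'M[{poly F}]_(p, q)) : row_free (fr t) ->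
  exists E : 'M[F]_(q, p), \det (t *m map_mx polyC E) != 0.
Proof.
move=> rf.
have gen s : \rank (fr t)^T = s -> exists f : 'I_s -> 'I_q, row_free (rowsub f (fr t)^T).
  by move=> <-; exists (maxrankfun (fr t)^T); exact: maxrowsub_free.
have [f Hf] : exists f : 'I_p -> 'I_q, row_free (rowsub f (fr t)^T).
  by apply: gen; rewrite mxrank_tr; exact/eqP.
exists (\matrix_(i, j) (i == f j)%:R).
have -> : t *m map_mx polyC (\matrix_(i, j) (i == f j)%:R) = colsub f t.
  apply/matrixP => i j; rewrite !mxE (bigD1 (f j)) //= !mxE eqxx mulr1 big1 ?addr0 //.
  by move=> k kf; rewrite !mxE (negPf kf) mulr0.
move: Hf; rewrite row_free_unit unitmxE unitfE.
have -> : rowsub f (fr t)^T = (fr (colsub f t))^T by apply/matrixP => i j; rewrite !mxE.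
by rewrite det_tr det_map_mx tofrac_eq0.
Qed.

End Fractions.

(** * Polynomial relations between solutions and their bounded equations *)

Section Relations.
Variable R : realType.
Local Notation C := (R[i]).
Hint Extern 0 (is_true (@Order.le _ _ _ (cabs _))) => exact: cabs_ge0 : core.
Local Notation fr := (map_mx (@tofrac {poly _})).

(** Near a point where [f] is non-zero, a small vertical shift avoids the finitely many roots of
    [d], and [d * f] is non-zero there. *)
Lemma cont_torsion (r : R) (f : C -> C) (d : {poly C}) : d != 0 ->
  (forall z, slitdisk r z -> ccont f z) -> (forall z, slitdisk r z -> d.[z] * f z = 0) ->
  forall z, slitdisk r z -> f z = 0.
Proof.
move=> d0 cf H z Dz; apply/eqP; apply: contraT => fz.
have fz0 : 0 < cabs (f z) / 2 by rewrite divr_gt0 // cabs_gt0.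
have [e e0 He] := cf z Dz _ fz0; have [e' e'0 He'] := slitdisk_open Dz.
have [s Hs] := poly_roots d0.
have [y /andP[y1 y2] ys] := @avoid_seq R (map (fun rho => complex.Im rho - complex.Im z) s)
   0 (Num.min e e') ltac:(by rewrite lt_min e0).
move: y2; rewrite lt_min => /andP[ye ye'].
pose h : C := Complex 0 y.
have ch : cabs h = y by rewrite /cabs /= expr0n add0r sqrtr_sqr gtr0_norm.
have Dzh : slitdisk r (z + h) by apply: He'; rewrite ch.
have dh : d.[z + h] != 0.
  apply: contra ys => rh; apply/mapP; exists (z + h); first by rewrite -Hs.
  by rewrite ImD /=; lra.
have := H _ Dzh => /eqP; rewrite mulf_eq0 (negPf dh) /= => /eqP fh.
by have := He h; rewrite ch fh sub0r cabsN => /(_ ye); lra.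
Qed.

(** Over the field of fractions the relations span a subspace, cut out by a cokernel matrix whose
    denominators are then cleared. Conversely a solution of these equations is a relation after
    multiplication by some [d], and [cont_torsion] removes [d]. *)
Lemma rel_eqs (r : R) N (g : 'I_N -> C -> C) :
  (forall i z, slitdisk r z -> ccont (g i) z) ->
  exists B : 'M[{poly C}]_N, forall v : 'rV[{poly C}]_N,
    (forall z, slitdisk r z -> \sum_i (v 0 i).[z] * g i z = 0) <-> v *m B = 0.
Proof.
move=> cg.
pose Rel (v : 'rV[{poly C}]_N) := forall z, slitdisk r z -> \sum_i (v 0 i).[z] * g i z = 0.
pose V (u : 'rV[{fraction {poly C}}]_N) := exists d : {poly C}, exists v,
  [/\ d != 0, tofrac d *: u = fr v & Rel v].
have RelL (a b : {poly C}) v v' : Rel v -> Rel v' -> Rel (a *: v + b *: v').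
  move=> Hv Hv' z Dz.
  have : \sum_i ((a *: v + b *: v') 0 i).[z] * g i z =
    a.[z] * (\sum_i (v 0 i).[z] * g i z) + b.[z] * (\sum_i (v' 0 i).[z] * g i z).
    rewrite !mulr_sumr -big_split /=; apply: eq_bigr => i _.
    by rewrite !mxE hornerD !hornerM; ring.
  by move=> ->; rewrite Hv // Hv' // !mulr0 addr0.
have frS m n (a : {poly C}) (M : 'M[{poly C}]_(m, n)) : fr (a *: M) = tofrac a *: fr M.
  by apply/matrixP => i j; rewrite !mxE rmorphM.
have V0 : V 0.
  exists 1, 0; split; rewrite ?oner_neq0 ?scaler0 ?map_mx0 //.
  by move=> z _; rewrite big1 // => i _; rewrite mxE horner0 mul0r.
have VL a u v : V u -> V v -> V (a *: u + v).
  move=> [d [w [d0 E Hw]]] [d' [w' [d'0 E' Hw']]].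
  have [n [e [e0 aE]]] := frac_exists a.
  exists (e * (d * d')), ((n * d') *: w + (e * d) *: w'); split; last exact: RelL.
    by rewrite !mulf_neq0.
  rewrite map_mxD !frS -E -E' scalerDr !scalerA; congr (_ *: _ + _ *: _).
    have gen (F : fieldType) (x y n0 z : F) : z != 0 -> z * (x * y) * (n0 / z) = n0 * y * x.
      by move=> z0; field.
    by rewrite aE !tofracM gen // tofrac_eq0.
  by rewrite !tofracM mulrA.
have [M HM] := subspace_mx V0 VL.
have [e e0 [B HB]] := clear_denom (cokermx M).
exists B => v; split=> [Hv|vB].
  have : V (fr v) by exists 1, v; split; rewrite ?oner_neq0 ?tofrac1 ?scale1r.
  move=> /HM; rewrite submxE => /eqP E.
  by apply: fr_eq0; rewrite frM -HB -scalemxAr E scaler0.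
have : V (fr v).
  apply/HM; rewrite submxE; apply/eqP.
  have e0' : tofrac e != 0 by rewrite tofrac_eq0.
  by apply: (scalerI e0'); rewrite scaler0 scalemxAr HB -frM vB map_mx0.
move=> [d [w [d0 E Hw]]].
have wE : w = d *: v by apply: fr_inj; rewrite -E frS.
apply: (@cont_torsion r (fun z => \sum_i (v 0 i).[z] * g i z) d d0) => z Dz.
  apply: ccont_sum => i _; apply: ccontM; last exact: cg.
  exact: cdiff_ccont (cdiff_poly _ _).
rewrite -[RHS](Hw z Dz) wE mulr_sumr; apply: eq_bigr => i _.
by rewrite mxE hornerM mulrA.
Qed.

Lemma sum_enum_pair (V : nmodType) (I J : finType) (F : 'I_#|{: I * J}| -> V) :
  \sum_m F m = \sum_i \sum_j F (enum_rank (i, j)).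
Proof.
rewrite pair_bigA /= (reindex (@enum_rank {: I * J})) /=.
  by apply: eq_bigr => -[i j].
by exists enum_val => x _; rewrite (enum_rankK, enum_valK).
Qed.

Lemma kernel_bounded_eq (F : fieldType) p s q N (Rm : 'M[{poly F}]_(q, N))
    (E : 'M[{poly F}]_(q, p)) (t : 'M[{poly F}]_(p, q)) d : q = (p + s)%N ->
  t *m Rm = 0 -> \det (t *m E) != 0 -> (s <= \rank (fr Rm))%N ->
  (forall i j, (size (Rm i j) <= d.+1)%N) -> (forall i j, (size (E i j) <= d.+1)%N) ->
  exists dd : {poly F}, exists Mt : 'M[{poly F}]_(p, q),
    [/\ dd != 0, (forall i j, (size (Mt i j) <= (q * d).+1)%N) &
     forall V : 'rV[{poly F}]_q, V *m Rm = 0 -> dd *: V = V *m E *m Mt].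
Proof. by move=> qE; subst q; exact: kernel_bounded. Qed.

(* The relations satisfied by a combination [Phi *m Cz] of the columns of [Phi] are linear
   equations whose coefficients have a degree independent of [Cz]. *)
Lemma bounded_package (r : R) q (Phi : C -> 'M[C]_q) : 0 < r ->
  (forall i j z, slitdisk r z -> ccont (fun u => Phi u i j) z) ->
  (forall z, slitdisk r z -> Phi z \in unitmx) ->
  exists c2 : nat, forall p s (Cz : 'M[C]_(q, s)) (t : 'M[{poly C}]_(p, q)) (E : 'M[C]_(q, p)),
    q = (p + s)%N -> \rank Cz = s -> \det (t *m map_mx polyC E) != 0 ->
    (forall k z, slitdisk r z -> map_mx (horner_eval z) (row k t) *m (Phi z *m Cz) = 0) ->
    exists dd : {poly C}, exists Mt : 'M[{poly C}]_(p, q),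
      [/\ dd != 0, (forall i j, (size (Mt i j) <= c2.+1)%N) &
       forall V : 'rV[{poly C}]_q,
         (forall z, slitdisk r z -> map_mx (horner_eval z) V *m (Phi z *m Cz) = 0) ->
         dd *: V = V *m map_mx polyC E *m Mt].
Proof.
move=> r0 cPhi uPhi.
pose I := ('I_q * 'I_q)%type; pose N := #|{: I}|.
have [B HB] := @rel_eqs r N (fun m z => Phi z (enum_val m).1 (enum_val m).2)
  (fun m z Dz => cPhi _ _ z Dz).
pose d := \max_(ij : 'I_N * 'I_N) size (B ij.1 ij.2).
exists (q * d)%N => p s Cz t E qE rC dt tZ.
pose N' := #|{: 'I_s * 'I_N}|.
(* A relation for the columns of [Phi *m Cz] is a relation between the [q * q] entries of [Phi],
   whose equations [B] are fixed; [Cz] enters through constant coefficients only, so the degree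
   stays that of [B]. *)
pose Rm : 'M[{poly C}]_(q, N') := \matrix_(i, j) \sum_k (Cz k (enum_val j).1)%:P *
   B (enum_rank (i, k)) (enum_val j).2.
have key (V : 'rV[{poly C}]_q) :
   (forall z, slitdisk r z -> map_mx (horner_eval z) V *m (Phi z *m Cz) = 0) <-> V *m Rm = 0.
  pose W l : 'rV[{poly C}]_N := \row_m (V 0 (enum_val m).1 * (Cz (enum_val m).2 l)%:P).
  have e1 l z : (map_mx (horner_eval z) V *m (Phi z *m Cz)) 0 l =
     \sum_m (W l 0 m).[z] * Phi z (enum_val m).1 (enum_val m).2.
    rewrite mxE sum_enum_pair.
    apply: eq_bigr => i _; rewrite !mxE mulr_sumr; apply: eq_bigr => k _.
    by rewrite !mxE !enum_rankK /= hornerM hornerC /horner_eval; ring.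
  have e2 l m : (W l *m B) 0 m = (V *m Rm) 0 (enum_rank (l, m)).
    rewrite !mxE sum_enum_pair.
    apply: eq_bigr => i _; rewrite mxE !enum_rankK /= mulr_sumr; apply: eq_bigr => k _.
    by rewrite !mxE !enum_rankK /=; ring.
  split=> [H|H].
    apply/rowP => j; rewrite [RHS]mxE.
    have -> : j = enum_rank ((enum_val j).1, (enum_val j).2) by rewrite -surjective_pairing enum_valK.
    rewrite -e2; have := proj1 (HB (W (enum_val j).1)) _ => ->; first by rewrite mxE.
    by move=> z Dz; rewrite -e1 H // mxE.
  move=> z Dz; apply/rowP => l; rewrite e1 mxE.
  apply: (proj2 (HB (W l))) => //; apply/rowP => m; rewrite e2 H !mxE //.
(* Otherwise more than [p] independent polynomial rows would be relations. They remain independent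
   at a suitable point [y], where they annihilate a matrix of rank [s]; this is too many in
   dimension [p + s]. *)
have rank_ge : (s <= \rank (fr Rm))%N.
  rewrite leqNgt; apply/negP => lt.
  have [e e0 [K HK]] := clear_denom (kermx (fr Rm)).
  have frS m n (a : {poly C}) (M : 'M[{poly C}]_(m, n)) : fr (a *: M) = tofrac a *: fr M.
    by apply/matrixP => i j; rewrite !mxE rmorphM.
  have e0' : tofrac e != 0 by rewrite tofrac_eq0.
  have rK : (p < \rank (fr K))%N.
    rewrite -HK (eqmx_scale _ e0') mxrank_ker -(ltn_add2r s) -qE.
    by rewrite -[X in (X < _)%N](@subnK (\rank (fr Rm))) ?ltn_add2l // rank_leq_row.
  have KR : K *m Rm = 0.
    by apply: fr_eq0; rewrite frM -HK -scalemxAl mulmx_ker scaler0.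
  pose f := maxrankfun (fr K); pose T := rowsub f K.
  have Tf : row_free (fr T).
    have -> : fr T = rowsub f (fr K) by apply/matrixP => i j; rewrite !mxE.
    exact: maxrowsub_free.
  have [E' HE'] := col_selection Tf.
  have [y /andP[y0 y1] Hy] := poly_nonroot HE' r0.
  have Dy : slitdisk r y%:C%C by apply: slitdisk_pos; rewrite y0.
  pose Ty := map_mx (horner_eval y%:C%C) T.
  have rTy : \rank Ty = \rank (fr K).
    apply/eqP; rewrite eqn_leq rank_leq_row /=.
    have u : Ty *m map_mx (horner_eval y%:C%C) (map_mx polyC E') \in unitmx.
      by rewrite -map_mxM unitmxE unitfE det_map_mx.
    by rewrite -{1}(mxrank_unit u) mxrankM_maxl.
  have TZ : Ty *m (Phi y%:C%C *m Cz) = 0.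
    apply/row_matrixP => i; rewrite row_mul -map_row row0.
    apply: (proj2 (key (row i T))) => //.
    have -> : row i T = row (f i) K by apply/rowP => k; rewrite !mxE.
    by rewrite -row_mul KR row0.
  have := mulmx0_rank_max TZ; rewrite rTy.
  have -> : \rank (Phi y%:C%C *m Cz) = s.
    by rewrite -mxrank_tr trmx_mul mxrankMfree ?mxrank_tr // row_free_unit unitmx_tr uPhi.
  by move=> le; move: (leq_trans (leq_add rK (leqnn s)) le); rewrite addSn -qE ltnn.
have tR : t *m Rm = 0.
  by apply/row_matrixP => k; rewrite row_mul row0; apply/key => z Dz; exact: tZ.
have sR i j : (size (Rm i j) <= d.+1)%N.
  rewrite mxE; apply: size_sum_bound => k _; rewrite mul_polyC.
  apply: leq_trans (size_scale_leq _ _) _; apply: leqW.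
  exact: (@leq_bigmax _ (fun ij : 'I_N * 'I_N => size (B ij.1 ij.2))
     (enum_rank (i, k), (enum_val j).2)).
have sE i j : (size ((map_mx polyC E) i j) <= d.+1)%N.
  by rewrite mxE; apply: leq_trans (size_polyC_leq1 _) _.
have [dd [Mt [d0 sM HM]]] := kernel_bounded_eq qE tR dt rank_ge sR sE.
exists dd, Mt; split=> // V HV; apply: HM; exact/key.
Qed.

End Relations.

(** * Orders along the positive reals and flat functions *)

Section Flat.
Variable R : realType.
Local Notation C := (R[i]).
Hint Extern 0 (is_true (@Order.le _ _ _ (cabs _))) => exact: cabs_ge0 : core.

(** [expR (tau * ln x)] is the real power of [x] with exponent [tau]. Any real order is allowed,
    since the exponents in the Nilsson class have arbitrary real parts. *)
Definition Oray (tau : R) (g : C -> C) := exists K : R, exists2 x1 : R, 0 < x1 &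
  forall x : R, 0 < x < x1 -> cabs (g x%:C%C) <= K * expR (tau * ln x).

Definition flat g := forall k : nat, Oray k%:R g.

Lemma expR_ln_le (s t x : R) : 0 < x < 1 -> s <= t -> expR (t * ln x) <= expR (s * ln x).
Proof.
move=> /andP[x0 x1] st; rewrite ler_expR; apply: ler_wnM2r => //.
by apply: ln_le0; exact: ltW.
Qed.

Lemma Oray_le s t g : s <= t -> Oray t g -> Oray s g.
Proof.
move=> st [K [x1 x10 H]]; exists `|K|, (Num.min x1 1); first by rewrite lt_min x10 ltr01.
move=> x /andP[x0]; rewrite lt_min => /andP[xx1 x11].
apply: le_trans (H x _) _; first by rewrite x0.
apply: le_trans (ler_wpM2r (expR_ge0 _) (ler_norm K)) _.
by apply: ler_wpM2l => //; apply: expR_ln_le => //; rewrite x0.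
Qed.

Lemma Oray_ext t g g' : (forall x : R, 0 < x -> g x%:C%C = g' x%:C%C) -> Oray t g -> Oray t g'.
Proof.
move=> E [K [x1 x10 H]]; exists K, x1 => // x /andP[x0 xx1].
by rewrite -E // H // x0.
Qed.

Lemma Oray0 t : Oray t (fun=> 0).
Proof. by exists 0, 1 => // x _; rewrite cabs0 mul0r. Qed.

Lemma OrayD t g g' : Oray t g -> Oray t g' -> Oray t (fun z => g z + g' z).
Proof.
move=> [K [x1 x10 H]] [K' [x2 x20 H']]; exists (K + K'), (Num.min x1 x2).
  by rewrite lt_min x10.
move=> x /andP[x0]; rewrite lt_min => /andP[xx1 xx2].
apply: le_trans (cabsD _ _) _; rewrite mulrDl.
by apply: lerD; [apply: H|apply: H']; rewrite x0.
Qed.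

Lemma OrayM s t g g' : Oray s g -> Oray t g' -> Oray (s + t) (fun z => g z * g' z).
Proof.
move=> [K [x1 x10 H]] [K' [x2 x20 H']]; exists (K * K'), (Num.min x1 x2).
  by rewrite lt_min x10.
move=> x /andP[x0]; rewrite lt_min => /andP[xx1 xx2].
have h1 := H x ltac:(by rewrite x0); have h2 := H' x ltac:(by rewrite x0).
rewrite cabsM mulrDl expRD mulrACA; exact: ler_pM.
Qed.

Lemma Oray_sum t (I : Type) (s : seq I) (P : pred I) (g : I -> C -> C) :
  (forall i, P i -> Oray t (g i)) -> Oray t (fun z => \sum_(i <- s | P i) g i z).
Proof.
move=> H; elim: s => [|i s IH].
  by apply: Oray_ext (Oray0 t) => x _; rewrite big_nil.
case Pi : (P i).
  by apply: Oray_ext (OrayD (H i Pi) IH) => x _; rewrite big_cons Pi.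
by apply: Oray_ext IH => x _; rewrite big_cons Pi.
Qed.

Lemma Oray_cst (c : C) : Oray 0 (fun=> c).
Proof. by exists (cabs c), 1 => // x _; rewrite mul0r expR0 mulr1. Qed.

Lemma OrayZ t (c : C) g : Oray t g -> Oray t (fun z => c * g z).
Proof. by move=> H; have := OrayM (Oray_cst c) H; rewrite add0r. Qed.

Lemma Oray_id : Oray 1 id.
Proof.
exists 1, 1 => // x /andP[x0 _]; rewrite mul1r mul1r lnK ?posrE // cabsR ger0_norm //.
exact: ltW.
Qed.

Lemma Oray_poly (p : {poly C}) : Oray 0 (fun z => p.[z]).
Proof.
elim/poly_ind: p => [|p c IH].
  by apply: Oray_ext (Oray0 0) => x _; rewrite horner0.
have h := OrayD (Oray_le _ (OrayM IH Oray_id)) (Oray_cst c).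
apply: Oray_ext (h _) => [x _|]; last by rewrite add0r.
by rewrite hornerMXaddC.
Qed.

Lemma Oray_prod (I : Type) (s : seq I) (tau : I -> R) (g : I -> C -> C) :
  (forall i, Oray (tau i) (g i)) -> Oray (\sum_(i <- s) tau i) (fun z => \prod_(i <- s) g i z).
Proof.
move=> H; elim: s => [|i s IH].
  by rewrite big_nil; apply: Oray_ext (Oray_cst 1) => x _; rewrite big_nil.
by rewrite big_cons; apply: Oray_ext (OrayM (H i) IH) => x _; rewrite big_cons.
Qed.

Lemma flat_sum (I : Type) (s : seq I) (P : pred I) (g : I -> C -> C) :
  (forall i, P i -> flat (g i)) -> flat (fun z => \sum_(i <- s | P i) g i z).
Proof. by move=> H k; apply: Oray_sum => i Pi; exact: H. Qed.

Lemma flatM g g' : Oray 0 g -> flat g' -> flat (fun z => g z * g' z).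
Proof. by move=> H H' k; have := OrayM H (H' k); rewrite add0r. Qed.

(** The coefficient vectors whose combination has order at least [k] form a decreasing chain of
    subspaces; [k0] is an index where it has stabilised. *)
Lemma span_flat (J : finType) (w : J -> C -> C) : exists k0 : nat, forall c : J -> C,
  Oray k0%:R (fun z => \sum_j c j * w j z) -> flat (fun z => \sum_j c j * w j z).
Proof.
pose g (v : 'rV[C]_#|J|) z := \sum_j v 0 (enum_rank j) * w j z.
have [|||k0 H] := @chain_stable C #|J| (fun k v => Oray k%:R (g v)).
- by move=> k; apply: Oray_ext (Oray0 _) => x _; rewrite /g big1 // => j _; rewrite mxE mul0r.
- move=> k a u v Hu Hv; apply: Oray_ext (OrayD (OrayZ a Hu) Hv) => x _.
  by rewrite /g mulr_sumr -big_split /=; apply: eq_bigr => j _; rewrite !mxE; ring.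
- by move=> k v; apply: Oray_le; rewrite ler_nat.
exists k0 => c Hc k; pose v : 'rV[C]_#|J| := \row_i c (enum_val i).
have E z : g v z = \sum_j c j * w j z.
  by apply: eq_bigr => j _; rewrite mxE enum_rankK.
by apply: Oray_ext (H k v _) => [x _|]; [exact: E|apply: Oray_ext Hc => x _; rewrite E].
Qed.

(** A determinant is not linear in its coefficients, but it lies in the span of the products
    [\prod_i u (f i)], a finite family independent of them. The bound is the maximum over the sizes
    [m <= q]. *)
Lemma det_flat N (u : 'I_N -> C -> C) q : exists tau0 : nat,
  forall m, (m <= q)%N -> forall c : 'I_m -> 'I_m -> 'I_N -> C,
  let g z := \det (\matrix_(i, j) \sum_k c i j k * u k z) in Oray tau0%:R g -> flat g.
Proof.
have /choice[T HT] : forall m, exists t : nat, forall c : 'I_m -> 'I_m -> 'I_N -> C,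
  let g z := \det (\matrix_(i, j) \sum_k c i j k * u k z) in Oray t%:R g -> flat g.
  move=> m; pose w (f : {ffun 'I_m -> 'I_N}) z := \prod_i u (f i) z.
  have [k0 H] := span_flat w; exists k0 => c g.
  pose c' (f : {ffun 'I_m -> 'I_N}) : C := \sum_(s : 'S_m) (-1) ^+ s * \prod_i c i (s i) (f i).
  have E z : g z = \sum_f c' f * w f z.
    rewrite /g /determinant.
    have -> : \sum_f c' f * w f z =
       \sum_(f : {ffun 'I_m -> 'I_N}) \sum_(s : 'S_m) (-1) ^+ s * (\prod_i c i (s i) (f i) * w f z).
      by apply: eq_bigr => f _; rewrite mulr_suml; apply: eq_bigr => s _; rewrite mulrA.
    rewrite exchange_big /=; apply: eq_bigr => s _; rewrite -mulr_sumr; congr (_ * _).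
    under eq_bigr do rewrite mxE.
    rewrite bigA_distr_bigA /=; apply: eq_bigr => f _; by rewrite big_split.
  move=> Hg k; apply: (@Oray_ext _ (fun z => \sum_f c' f * w f z)) => [x _|]; first by rewrite E.
  by apply: H; apply: Oray_ext Hg => x _; rewrite E.
exists (\max_(m < q.+1) T m)%N => m mq c g Hg; apply: HT; apply: Oray_le Hg.
by rewrite ler_nat; exact: (@leq_bigmax _ (fun m : 'I_q.+1 => T m) (Ordinal (mq : (m < q.+1)%N))).
Qed.

(* A weak form of Cauchy-Binet: the sum runs over all maps, not only the increasing ones. *)
Lemma det_mul_expand (S : comNzRingType) m p (A : 'M[S]_(m, p)) (B : 'M[S]_(p, m)) :
  \det (A *m B) = \sum_(f : {ffun 'I_m -> 'I_p}) (\prod_i A i (f i)) * \det (rowsub f B).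
Proof.
have -> : \sum_(f : {ffun 'I_m -> 'I_p}) (\prod_i A i (f i)) * \det (rowsub f B) =
   \sum_(f : {ffun 'I_m -> 'I_p}) \sum_(s : 'S_m)
     (-1) ^+ s * (\prod_i A i (f i) * \prod_i B (f i) (s i)).
  apply: eq_bigr => f _; rewrite mulr_sumr; apply: eq_bigr => s _.
  by rewrite mulrCA; congr (_ * (_ * _)); apply: eq_bigr => i _; rewrite !mxE.
rewrite exchange_big /=; apply: eq_bigr => s _; rewrite -mulr_sumr; congr (_ * _).
under eq_bigr do rewrite mxE.
by rewrite bigA_distr_bigA /=; apply: eq_bigr => f _; rewrite big_split.
Qed.

End Flat.

(** * Division by a polynomial *)

Section FlatDiv.
Variable R : realType.
Local Notation C := (R[i]).
Hint Extern 0 (is_true (@Order.le _ _ _ (cabs _))) => exact: cabs_ge0 : core.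

(** Near [0] the modulus of [D] is at least a constant times that of [z ^+ k], where [k <= o] is its
    multiplicity there, so dividing costs at most [o]. *)
Lemma Oray_div t (D : {poly C}) o g : ~~ ('X ^+ o.+1 %| D) ->
  Oray t (fun z => D.[z] * g z) -> Oray (t - o%:R) g.
Proof.
move=> nD.
have D0 : D != 0 by apply: contraNneq nD => ->; rewrite dvdp0.
have [k [D' [kD rD]]] : exists k, exists D' : {poly C}, D = D' * 'X ^+ k /\ D'.[0] != 0.
  have [k [D' [n0 E]]] := multiplicity_XsubC D 0.
  by exists k, D'; rewrite E subr0; split=> //; move: n0; rewrite D0.
have ko : (k <= o)%N.
  rewrite leqNgt; apply: contra nD => ok; rewrite kD dvdp_mull //.
  by rewrite dvdp_exp2l.
move=> H; apply: (@Oray_le _ _ (t - k%:R)); first by rewrite lerD2l lerN2 ler_nat.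
have c0 : 0 < cabs D'.[0] / 2 by rewrite divr_gt0 ?cabs_gt0.
have [e e0 He] := cdiff_ccont (cdiff_poly D' 0) c0.
have [K [x1 x10 HK]] := H.
exists (K / (cabs D'.[0] / 2)), (Num.min x1 e); first by rewrite lt_min x10.
move=> x /andP[x0]; rewrite lt_min => /andP[xx1 xe].
have h1 := HK x ltac:(by rewrite x0).
have h2 := He x%:C%C; rewrite cabsR gtr0_norm // add0r in h2.
have {}h2 := h2 xe.
have h3 : cabs D'.[0] / 2 <= cabs D'.[x%:C%C].
  have := cabsD (D'.[x%:C%C]) (D'.[0] - D'.[x%:C%C]); rewrite addrCA subrr addr0.
  by rewrite (cabsBC D'.[0]); lra.
have xk : x ^+ k = expR (k%:R * ln x).
  by rewrite mulrC expRM_natr lnK ?posrE.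
rewrite kD hornerM hornerXn !cabsM cabsX cabsR gtr0_norm // xk in h1.
have ex : expR ((t - k%:R) * ln x) * expR (k%:R * ln x) = expR (t * ln x).
  by rewrite -expRD; congr expR; ring.
rewrite -(ler_pM2r (expR_gt0 (k%:R * ln x))) -[leRHS]mulrA ex.
rewrite -(ler_pM2l c0).
have -> : cabs D'.[0] / 2 * (K / (cabs D'.[0] / 2) * expR (t * ln x)) = K * expR (t * ln x).
  by field; move: c0; lra.
apply: le_trans h1; rewrite -[_ * _ * cabs _]mulrA [expR _ * _]mulrC.
by apply: ler_wpM2r => //; apply: mulr_ge0; rewrite ?expR_ge0.
Qed.

End FlatDiv.

(** * Orders in sectors around the positive reals *)

Section Sector.
Variable R : realType.
Local Notation C := (R[i]).
Hint Extern 0 (is_true (@Order.le _ _ _ (cabs _))) => exact: cabs_ge0 : core.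

(** Discs with radius proportional to [x] fill a sector and leave room for the Cauchy estimate at
    scale [x]. The bound [s <= 1 / 2] in [Osec] keeps them in the right half-plane, with [cabs z]
    between [x / 2] and [2 * x]. *)
Definition sec (s x1 x : R) (z : C) := 0 < x < x1 /\ cabs (z - x%:C%C) < s * x.

Definition Osec (tau : R) (g : C -> C) := exists s x1 K : R, [/\ 0 < s <= 1 / 2, 0 < x1 &
  forall x z, sec s x1 x z -> cabs (g z) <= K * expR (tau * ln x)].

Lemma sec_le s x1 s' x1' x z : s <= s' -> x1 <= x1' -> sec s x1 x z -> sec s' x1' x z.
Proof.
move=> ss xx [/andP[x0 xx1] H]; split; first by rewrite x0 (lt_le_trans xx1).
by apply: lt_le_trans H _; apply: ler_wpM2r => //; exact: ltW.
Qed.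

Lemma sec_bounds s x1 x z : s <= 1 / 2 -> sec s x1 x z ->
  [/\ x / 2 <= cabs z, cabs z <= 2 * x, 0 < complex.Re z & 0 < x].
Proof.
move=> s2 [/andP[x0 _] H].
have Hx : cabs (z - x%:C%C) < 1 / 2 * x.
  by apply: lt_le_trans H _; apply: ler_wpM2r => //; exact: ltW.
have cx : cabs x%:C%C = x by rewrite cabsR gtr0_norm.
have h1 := cabsD (z - x%:C%C) x%:C%C; rewrite subrK cx in h1.
have h2 := cabsD (x%:C%C - z) z; rewrite subrK cx cabsBC in h2.
have h3 := Re_cabs (z - x%:C%C); rewrite ReB /= ler_norml in h3.
move/andP: h3 => [h3 _]; split=> //; lra.
Qed.

Lemma sec_ray s x1 (x : R) : 0 < s -> 0 < x < x1 -> sec s x1 x x%:C%C.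
Proof. by move=> s0 xx; split=> //; rewrite subrr cabs0 mulr_gt0 //; case/andP: xx. Qed.

Lemma Osec_near tau g (x1 : R) : 0 < x1 -> Osec tau g -> exists s y K : R,
  [/\ 0 < s <= 1 / 2, 0 < y <= x1, 0 <= K &
   forall x z, sec s y x z -> cabs (g z) <= K * expR (tau * ln x)].
Proof.
move=> x10 [s [y [K [s0 y0 H]]]]; exists s, (Num.min y x1), `|K|; split=> //.
  by rewrite lt_min y0 x10 ge_min lexx orbT.
move=> x z Hs; apply: le_trans (H x z _) _; last by rewrite ler_wpM2r ?expR_ge0 ?ler_norm.
by apply: sec_le Hs => //; rewrite ge_min lexx.
Qed.

Lemma Osec2 tau g tau' g' : Osec tau g -> Osec tau' g' -> exists s y K : R,
  [/\ 0 < s <= 1 / 2, 0 < y <= 1, 0 <= K &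
   forall x z, sec s y x z ->
     cabs (g z) <= K * expR (tau * ln x) /\ cabs (g' z) <= K * expR (tau' * ln x)].
Proof.
move=> /(Osec_near ltr01)[s [y [K [/andP[s0 s2] /andP[y0 y1] K0 H]]]].
move=> /(Osec_near ltr01)[s' [y' [K' [/andP[s'0 s'2] /andP[y'0 y'1] K'0 H']]]].
exists (Num.min s s'), (Num.min y y'), (K + K'); split.
- by rewrite lt_min s0 s'0 ge_min s2.
- by rewrite lt_min y0 y'0 ge_min y1.
- exact: addr_ge0.
move=> x z Hs; split.
  apply: le_trans (H x z _) _; first by apply: sec_le Hs => //; rewrite ge_min lexx.
  by rewrite ler_wpM2r ?expR_ge0 // lerDl.
apply: le_trans (H' x z _) _; first by apply: sec_le Hs => //; rewrite ge_min lexx orbT.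
by rewrite ler_wpM2r ?expR_ge0 // lerDr.
Qed.

Lemma Osec_ext tau g g' (x1 : R) : 0 < x1 ->
  (forall z, 0 < complex.Re z -> cabs z < x1 -> g z = g' z) -> Osec tau g -> Osec tau g'.
Proof.
move=> x10 E Hg; have x120 : 0 < x1 / 2 by lra.
have [s [y [K [s0 /andP[y0 y1] K0 H]]]] := Osec_near x120 Hg.
exists s, y, K; split=> // x z Hs; have [/andP[_ s2] [xy _]] := (s0, Hs).
have [b1 b2 b3 b4] := sec_bounds s2 Hs; rewrite -E ?H //.
by move/andP: xy => [_ xy]; lra.
Qed.

Lemma Osec_le s t g : s <= t -> Osec t g -> Osec s g.
Proof.
move=> st /(Osec_near ltr01)[s' [y [K [s0 /andP[y0 y1] K0 H]]]].
exists s', y, K; split=> // x z Hs; apply: le_trans (H x z Hs) _; apply: ler_wpM2l => //.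
by have [/andP[x0 xy] _] := Hs; apply: expR_ln_le => //; rewrite x0 (lt_le_trans xy).
Qed.

Lemma Osec0 t : Osec t (fun=> 0).
Proof. by exists (1 / 2), 1, 0; split=> [||x z _]; rewrite ?cabs0 ?mul0r //; apply/andP; split; lra. Qed.

Lemma OsecD t g g' : Osec t g -> Osec t g' -> Osec t (fun z => g z + g' z).
Proof.
move=> H H'; have [s [y [K [s0 /andP[y0 y1] K0 HH]]]] := Osec2 H H'.
exists s, y, (K + K); split=> // x z Hs; have [h1 h2] := HH x z Hs.
by apply: le_trans (cabsD _ _) _; rewrite mulrDl lerD.
Qed.

Lemma OsecM t t' g g' : Osec t g -> Osec t' g' -> Osec (t + t') (fun z => g z * g' z).
Proof.
move=> H H'; have [s [y [K [s0 /andP[y0 y1] K0 HH]]]] := Osec2 H H'.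
exists s, y, (K * K); split=> // x z Hs; have [h1 h2] := HH x z Hs.
by rewrite cabsM mulrDl expRD mulrACA; exact: ler_pM.
Qed.

Lemma Osec_cst (c : C) : Osec 0 (fun=> c).
Proof.
exists (1 / 2), 1, (cabs c); split=> // [|x z _]; last by rewrite mul0r expR0 mulr1.
by apply/andP; split; lra.
Qed.

Lemma OsecZ t (c : C) g : Osec t g -> Osec t (fun z => c * g z).
Proof. by move=> H; have := OsecM (Osec_cst c) H; rewrite add0r. Qed.

Lemma OsecB t g g' : Osec t g -> Osec t g' -> Osec t (fun z => g z - g' z).
Proof.
move=> H /(OsecZ (-1)) H'; apply: Osec_ext ltr01 _ (OsecD H H') => z _ _.
by rewrite mulN1r.
Qed.

Lemma Osec_sum t (I : eqType) (s : seq I) (g : I -> C -> C) :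
  (forall i, i \in s -> Osec t (g i)) -> Osec t (fun z => \sum_(i <- s) g i z).
Proof.
elim: s => [|i s IH] H.
  by apply: Osec_ext ltr01 _ (Osec0 t) => x _ _; rewrite big_nil.
apply: Osec_ext ltr01 _ (OsecD (H i _) (IH _)) => [z _ _||j js].
- by rewrite big_cons.
- by rewrite inE eqxx.
- by apply: H; rewrite inE js orbT.
Qed.

Lemma Osec_id : Osec 1 id.
Proof.
exists (1 / 2), 1, 2; split=> // [|x z Hs]; first by apply/andP; split; lra.
have [_ h _ x0] := sec_bounds (lexx _) Hs.
by rewrite mul1r lnK ?posrE.
Qed.

Lemma Osec_poly (p : {poly C}) : Osec 0 (fun z => p.[z]).
Proof.
elim/poly_ind: p => [|p c IH].
  by apply: Osec_ext ltr01 _ (Osec0 0) => x _ _; rewrite horner0.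
have h := OsecD (Osec_le _ (OsecM IH Osec_id)) (Osec_cst c).
apply: Osec_ext ltr01 _ (h _) => [x _ _|]; last by rewrite add0r.
by rewrite hornerMXaddC.
Qed.

Lemma Osec_poly0 (p : {poly C}) : Osec 1 (fun z => p.[z] - p.[0]).
Proof.
have /factor_theorem[q E] : root (p - p.[0]%:P) 0 by rewrite /root !hornerE subrr.
have := OsecM (Osec_poly q) Osec_id; rewrite add0r; apply: Osec_ext ltr01 _ => z _ _.
have := congr1 (fun u => u.[z]) E; rewrite /= subr0 hornerM hornerX hornerD hornerN hornerC => ->.
by [].
Qed.

Lemma Osec_Oray t g : Osec t g -> Oray t g.
Proof.
move=> [s [x1 [K [/andP[s0 _] x10 H]]]]; exists K, x1 => // x xx.
by apply: H; exact: sec_ray.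
Qed.

Lemma ln_sec s x1 x z : s <= 1 / 2 -> sec s x1 x z -> `|ln (cabs z) - ln x| <= ln 2.
Proof.
move=> s2 /(sec_bounds s2)[h1 h2 h3 x0].
have cz : 0 < cabs z by lra.
have l2 : ln (2 * x) = ln 2 + ln x by rewrite lnM ?posrE.
have l3 : ln (x / 2) = ln x - ln 2 by rewrite ln_div ?posrE.
have x20 : 0 < x / 2 by lra.
have x20' : 0 < 2 * x by lra.
have h1' : ln (x / 2) <= ln (cabs z) by rewrite ler_ln ?posrE.
have h2' : ln (cabs z) <= ln (2 * x) by rewrite ler_ln ?posrE.
by rewrite ler_norml; apply/andP; split; lra.
Qed.

Lemma Osec_cpow (e : C) : Osec (complex.Re e) (fun z => cpow z e).
Proof.
exists (1 / 2), 1, (expR (`|complex.Re e| * ln 2 + `|complex.Im e| * pi)).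
split=> // [|x z Hs]; first by apply/andP; split; lra.
have h := ln_sec (lexx _) Hs.
have [_ _ h3 x0] := sec_bounds (lexx _) Hs.
rewrite cabs_cpow // -expRD ler_expR.
have -> : complex.Re e * ln (cabs z) = complex.Re e * (ln (cabs z) - ln x) + complex.Re e * ln x.
  by ring.
have i1 : complex.Re e * (ln (cabs z) - ln x) <= `|complex.Re e| * ln 2.
  by apply: le_trans (ler_norm _) _; rewrite normrM ler_wpM2l.
have i2 : - (complex.Im e * carg z) <= `|complex.Im e| * pi.
  by apply: le_trans (ler_norm _) _; rewrite normrN normrM ler_wpM2l // carg_bound.
lra.
Qed.

Lemma Osec_clog (eta : R) : 0 < eta -> Osec (- eta) (@clog R).
Proof.
move=> eta0; exists (1 / 2), 1, (1 / eta + ln 2 + pi).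
split=> // [|x z Hs]; first by apply/andP; split; lra.
have h := ln_sec (lexx _) Hs.
have [_ _ h3 x0] := sec_bounds (lexx _) Hs.
have [/andP[_ x1] _] := Hs.
have lx : ln x <= 0 by apply: ln_le0; exact: ltW.
have l2 : 0 <= ln 2 :> R by apply: ln_ge0; lra.
(* A logarithm is dominated by any negative power: [1 + u <= expR u] with [u = - eta * ln x]. *)
have e1 := expR_ge1Dx (- eta * ln x).
have e2 : 1 <= expR (- eta * ln x).
  by apply: le_trans e1; rewrite lerDl mulNr oppr_ge0 mulr_ge0_le0 // ltW.
have e3 : - ln x <= 1 / eta * expR (- eta * ln x).
  rewrite -(ler_pM2l eta0) mulrA.
  have -> : eta * (1 / eta) = 1 by field; exact: lt0r_neq0.
  by lra.
apply: le_trans (cabs_ReIm _) _ => /=.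
have c1 := carg_bound h3.
have n1 : `|ln (cabs z)| <= - ln x + ln 2.
  have -> : ln (cabs z) = (ln (cabs z) - ln x) + ln x by ring.
  apply: le_trans (ler_normD _ _) _; rewrite (ler0_norm lx); lra.
have n2 : ln 2 <= ln 2 * expR (- eta * ln x) by rewrite ler_peMr.
have n3 : pi <= pi * expR (- eta * ln x) by rewrite ler_peMr // pi_ge0.
apply: le_trans (lerD n1 c1) _; rewrite 2!mulrDl; exact: lerD (lerD e3 n2) n3.
Qed.

Lemma Osec_clogX (eta : R) k : 0 < eta -> Osec (- eta) (fun z => clog z ^+ k).
Proof.
move=> eta0; case: k => [|k].
  by apply: Osec_le (Osec_cst 1); rewrite oppr_le0 ltW.
(* The allowed loss [eta] is shared equally among the [k.+1] logarithms. *)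
have k0 : 0 < eta / k.+1%:R by rewrite divr_gt0 ?ltr0n.
have H j : Osec (- (j%:R * (eta / k.+1%:R))) (fun z => clog z ^+ j).
  elim: j => [|j IH]; first by rewrite mul0r oppr0; exact: Osec_cst.
  have := OsecM (Osec_clog k0) IH; set u := eta / _.
  rewrite (_ : - u - j%:R * u = - (j.+1%:R * u)); last by rewrite -[j.+1]addn1 natrD; ring.
  by apply: Osec_ext ltr01 _ => z _ _; rewrite exprS.
have := H k.+1; have -> : k.+1%:R * (eta / k.+1%:R) = eta; last by [].
by rewrite mulrC divfK // pnatr_eq0.
Qed.

Lemma Osec_clog_poly (eta : R) (p : {poly C}) : 0 < eta -> Osec (- eta) (fun z => p.[clog z]).
Proof.
move=> eta0; apply: (@Osec_ext _ (fun z => \sum_(i <- index_iota 0 (size p)) p`_i * clog z ^+ i) _ _ ltr01).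
  by move=> z _ _; rewrite horner_coef big_mkord.
by apply: Osec_sum => i _; apply: OsecZ; exact: Osec_clogX.
Qed.

Lemma Osec_holo (h : C -> C) : holo_at h 0 -> Osec 1 (fun z => h z - h 0).
Proof.
move=> [rho rho0 H]; have /cdiff_derivable H0 := H 0 ltac:(by rewrite subr0 cabs0).
set l := derive _ _ _ in H0; have [d d0 Hd] := H0 1 ltr01.
exists (1 / 2), (d / 2), (2 * (1 + cabs l)); split=> [||x z Hs]; try lra.
have [_ b2 _ x0] := sec_bounds (lexx _) Hs; have [/andP[_ xd] _] := Hs.
have zd : cabs z < d by lra.
have {Hd} := Hd z zd; rewrite add0r mul1r => Hd.
have := cabsD (h z - h 0 - l * z) (l * z); rewrite subrK cabsM => h1.
rewrite mul1r lnK ?posrE //; apply: le_trans h1 _.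
have : cabs l * cabs z <= cabs l * (2 * x) by rewrite ler_wpM2l.
lra.
Qed.

End Sector.

(** * Finite sums of powers times polynomials in the logarithm *)

Section LogSums.
Variable R : realType.
Local Notation C := (R[i]).
Hint Extern 0 (is_true (@Order.le _ _ _ (cabs _))) => exact: cabs_ge0 : core.
Implicit Types (E : seq C) (p : C -> {poly C}).

Definition logsum E p z : C := \sum_(e <- E) cpow z e * (p e).[clog z].

(** The action of [z * d/dz - e0] on the coefficients of a [logsum]: [z * d/dz] multiplies
    [cpow z e] by [e] and differentiates the polynomial in [clog z]. *)
Definition theta (e0 : C) p (e : C) : {poly C} := (e - e0) *: p e + deriv (p e).

Definition half (r : R) (z : C) := slitdisk r z /\ 0 < complex.Re z.

Lemma half_open r : cop (half r).
Proof.
move=> z [Dz Rz]; have [d d0 Hd] := slitdisk_open Dz.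
exists (Num.min d (complex.Re z)); first by rewrite lt_min d0.
move=> h; rewrite lt_min => /andP[hd hR]; split; first exact: Hd.
have := Re_cabs h; rewrite ler_norml ReD => /andP[h1 _].
by rewrite -[_ + _]opprK oppr_gt0; lra.
Qed.

Lemma half_sec (r s x1 x : R) z : s <= 1 / 2 -> x1 <= r / 2 -> sec s x1 x z -> half r z.
Proof.
move=> s2 xr Hs; have [b1 b2 b3 b4] := sec_bounds s2 Hs.
have [/andP[_ xx] _] := Hs; split=> //; split; first by apply/andP; split; lra.
by move=> [_]; lra.
Qed.

Lemma half_neq0 r z : half r z -> z != 0.
Proof. by move=> [_ Rz]; apply: contraTneq Rz => ->; rewrite /= ltxx. Qed.

Lemma C2ex_primitive (D : set C) g k : C2ex D k -> (forall z, D z -> cdiff g z (k z)) -> C2ex D g.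
Proof.
move=> [k1 [k2 H]] dg; exists k, k1 => z Dz; have [d1 d2 c2] := H z Dz.
by split=> //; [exact: dg|exact: cdiff_ccont d2].
Qed.

Lemma C2ex_logder (D : set C) g k : C2ex D k -> (forall z, D z -> cdiff g z (k z * g z)) -> C2ex D g.
Proof.
move=> [k1 [k2 H]] dg; exists (fun z => k z * g z), (fun z => k1 z * g z + k z * (k z * g z)).
move=> z Dz; have [d1 d2 c2] := H z Dz; split; [exact: dg|exact: cdiffM (dg z Dz)|].
have ck := cdiff_ccont d1; have cg := cdiff_ccont (dg z Dz).
by apply: ccontD; apply: ccontM => //; [exact: cdiff_ccont d2|exact: ccontM].
Qed.

Lemma C2ex_half_inv r : C2ex (half r) (fun z => z^-1).
Proof.
have := @C2ex_polyV R (half r) 'X; under eq_fun do rewrite hornerX.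
by apply=> z /half_neq0; rewrite hornerX.
Qed.

Lemma C2ex_logsum r E p : C2ex (half r) (logsum E p).
Proof.
apply: C2ex_sum => e; apply: C2exM.
  apply: (@C2ex_logder _ _ (fun z => e * z^-1)).
    by apply: C2exM; [exact: C2ex_cst|exact: C2ex_half_inv].
  by move=> z [_ Rz]; exact: cdiff_cpow.
have cl : C2ex (half r) (@clog R).
  by apply: (C2ex_primitive (C2ex_half_inv r)) => z [_ Rz]; exact: cdiff_clog.
elim/poly_ind: (p e) => [|f c IH].
  by under eq_fun do rewrite horner0; exact: C2ex_cst.
under eq_fun do rewrite hornerMXaddC.
by apply: C2exD; [exact: C2exM|exact: C2ex_cst].
Qed.

Lemma logsum_diff E p z : 0 < complex.Re z ->
  cdiff (logsum E p) z (logsum E (theta 0 p) z / z).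
Proof.
move=> Rz.
have := @cdiff_sum R _ E xpredT (fun e u => cpow u e * (p e).[clog u])
  (fun e => e * z^-1 * cpow z e * (p e).[clog z] + cpow z e * ((deriv (p e)).[clog z] * z^-1)) z
  (fun e _ => cdiffM (cdiff_cpow e Rz)
     (@cdiff_comp R (fun w => (p e).[w]) _ z _ _ (cdiff_poly (p e) _) (cdiff_clog Rz))).
congr cdiff; rewrite /logsum mulr_suml; apply: eq_bigr => e _.
by rewrite /theta subr0 hornerD hornerZ; ring.
Qed.

Lemma logsum_theta E p e0 z : logsum E (theta e0 p) z = logsum E (theta 0 p) z - e0 * logsum E p z.
Proof.
rewrite /logsum mulr_sumr -sumrB; apply: eq_bigr => e _.
by rewrite /theta !hornerD !hornerZ; ring.
Qed.

Lemma Osec_logsum E p (sg eta : R) : (forall e, e \in E -> sg <= complex.Re e) -> 0 < eta ->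
  Osec (sg - eta) (logsum E p).
Proof.
move=> HE eta0; apply: Osec_sum => e /HE He.
apply: (@Osec_le _ _ (complex.Re e - eta)); first by rewrite lerD2r.
by apply: OsecM; [exact: Osec_cpow|exact: Osec_clog_poly].
Qed.

(** The Euler derivative keeps the order: the Cauchy estimate on a disc of radius [s * x / 4] loses
    a factor of size [1 / x], which [z] restores. The aperture shrinks from [s] to [s / 2]. *)
Lemma Osec_Euler (r tau : R) g g1 : 0 < r -> C2ex (half r) g ->
  (forall z, half r z -> cdiff g z (g1 z)) -> Osec tau g -> Osec tau (fun z => z * g1 z).
Proof.
move=> r0 [k1 [k2 H]] dg Og; have r20 : 0 < r / 2 by lra.
have [s [y [K [/andP[s0 s2] /andP[y0 y1] K0 HK]]]] := Osec_near r20 Og.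
exists (s / 2), y, (16 * K / s); split=> [||x z Hs] //; first by apply/andP; split; lra.
have s22 : s / 2 <= 1 / 2 by lra.
have hz := half_sec s22 y1 Hs; have [b1 b2 b3 x0] := sec_bounds s22 Hs.
have k1E : k1 z = g1 z by have [d1 _ _] := H z hz; exact: cdiff_uniq d1 (dg z hz).
have rho0 : 0 < s * x / 4 by rewrite divr_gt0 // mulr_gt0.
have sub w : cabs (w - z) <= s * x / 4 -> sec s y x w.
  move=> Hw; have [xy Hz] := Hs; split=> //.
  have -> : w - x%:C%C = (w - z) + (z - x%:C%C) by ring.
  by apply: le_lt_trans (cabsD _ _) _; move: Hz; rewrite mulrAC; lra.
have := cauchy_estimate (@half_open r) H rho0
  (fun w Hw => half_sec s2 y1 (sub w Hw)) (fun w Hw => HK x w (sub w Hw)).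
rewrite k1E cabsM => ce; apply: le_trans (ler_pM _ _ b2 ce) _ => //.
rewrite le_eqVlt; apply/orP; left; apply/eqP; field.
by rewrite !lt0r_neq0.
Qed.

End LogSums.

(** * Euler operators acting on remainders and on their leading terms *)

Section Operators.
Variables (R : realType) (q : nat).
Local Notation C := (R[i]).
Variables (a b : {poly C}) (kp : nat) (At : 'M[{poly C}]_q) (r : R).
Hypothesis r0 : 0 < r.
Hypothesis a0 : forall z, slitdisk r z -> a.[z] != 0.
Hypothesis aE : a = 'X * ('X ^+ kp * b).
Hypothesis b0 : b.[0] != 0.
Hint Extern 0 (is_true (@Order.le _ _ _ (cabs _))) => exact: cabs_ge0 : core.
Implicit Types (V : 'rV[{poly C}]_q) (E : seq C) (p : C -> {poly C}).

(* If [rdot V Y = z^N g], then [opr (e + N)] and [opp e] are the effect of [b * (z d/dz - e)]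
   on the row [V] and on the leading exponents of [g]; the new row defines [z^(N + kp)] times
   the new function. *)
Definition opr (e : C) V := Trow a At V - (e *: ('X ^+ kp * b)) *: V.
Definition opp (e : C) p (e' : C) : {poly C} := b.[0] *: theta e p e'.
Fixpoint oprs es V := if es is e :: es' then opr (e + (kp * size es')%:R) (oprs es' V) else V.

Lemma cdiff_expV N (z : C) : z != 0 ->
  cdiff (fun u => (u ^+ N)^-1) z (- (N%:R / z * (z ^+ N)^-1)).
Proof.
move=> z0; elim: N => [|N IH].
  rewrite mul0r mul0r oppr0; apply: cdiff_eqf (cdiff_cst 1 z) => u; by rewrite expr0 invr1.
have := cdiffM (cdiff_inv z0) IH.
have -> : (fun u : C => u^-1 * (u ^+ N)^-1) = fun u => (u ^+ N.+1)^-1.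
  by apply/funext => u; rewrite exprS invfM.
congr cdiff; have -> : N.+1%:R = N%:R + 1 :> C by rewrite -addn1 natrD.
have gen (x y n : C) : x != 0 -> - (x ^+ 2)^-1 * y + x^-1 * - (n / x * y) = - ((n + 1) / x * (x^-1 * y)).
  by move=> x0; field.
by rewrite [in RHS]exprS [in RHS]invfM; exact: gen.
Qed.

Lemma C2ex_rdot V Y : psol a At r Y -> C2ex (slitdisk r) (rdot V Y).
Proof.
move=> sY; have [v1 [v2 Hv]] := @C2ex_polyV R (slitdisk r) a a0.
exists (fun z => rdot (Trow a At V) Y z * a.[z]^-1),
  (fun z => rdot (Trow a At (Trow a At V)) Y z / a.[z] * a.[z]^-1 + rdot (Trow a At V) Y z * v1 z).
move=> z Dz; have [d1 d2 c2] := Hv z Dz.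
have dr V' := @rdot_diff R q a At r a0 V' Y z sY Dz.
split; [exact: dr|exact: (cdiffM (dr (Trow a At V)) d1)|].
have cr V' := cdiff_ccont (dr V').
have ca := cdiff_ccont d1.
by apply: ccontD; apply: ccontM => //; [apply: ccontM|exact: cdiff_ccont d2].
Qed.

Lemma rdotD V V' Y z : rdot (V + V') Y z = rdot V Y z + rdot V' Y z.
Proof. by rewrite /rdot -big_split; apply: eq_bigr => i _; rewrite !mxE hornerD mulrDl. Qed.

Lemma rdotZ (f : {poly C}) V Y z : rdot (f *: V) Y z = f.[z] * rdot V Y z.
Proof. by rewrite /rdot mulr_sumr; apply: eq_bigr => i _; rewrite !mxE hornerM mulrA. Qed.

(** Applying [b * (z * d/dz - e0)] to the error preserves its order by [Osec_Euler]. The operator on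
    leading terms uses the constant [b.[0]] instead of [b]; the difference gains a full power of
    [z], which [tau < sg + 1] makes affordable. *)
Lemma Osec_opr V Y E p (sg tau : R) e0 N : psol a At r Y ->
  (forall e, e \in E -> sg <= complex.Re e) -> tau < sg + 1 ->
  Osec tau (fun z => rdot V Y z / z ^+ N - logsum E p z) ->
  Osec tau (fun z => rdot (opr (e0 + N%:R) V) Y z / z ^+ (N + kp) - logsum E (opp e0 p) z).
Proof.
move=> sY HE tsg OG; set G := fun z => _ in OG.
have CG : C2ex (half r) G.
  have [h1 [h2 H]] := C2ex_rdot V sY.
  have CV : C2ex (half r) (fun z => (z ^+ N)^-1).
    have := @C2ex_polyV R (half r) ('X ^+ N); under eq_fun do rewrite hornerXn.
    by apply=> z /half_neq0 z0; rewrite hornerXn expf_neq0.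
  have CR : C2ex (half r) (rdot V Y) by exists h1, h2 => z [Dz _]; exact: H.
  have := C2exD (C2exM CR CV) (C2exM (C2ex_cst _ (-1)) (C2ex_logsum r E p)).
  by under eq_fun do rewrite mulN1r.
have dG z : half r z -> cdiff G z (rdot (Trow a At V) Y z / a.[z] * (z ^+ N)^-1 +
    rdot V Y z * - (N%:R / z * (z ^+ N)^-1) - logsum E (theta 0 p) z / z).
  move=> hz; have [Dz Rz] := hz; apply: cdiffB; last exact: logsum_diff.
  apply: (cdiffM (@rdot_diff R q a At r a0 V Y z sY Dz)).
  exact: cdiff_expV (half_neq0 hz).
have H1 := OsecM (Osec_poly b) (OsecB (Osec_Euler r0 CG dG OG) (OsecZ e0 OG)).
(* The logarithmic loss is chosen so that [(b.[z] - b.[0])] times the sum has order exactly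
   [tau]. *)
have eta0 : 0 < sg + 1 - tau by lra.
have H2 := OsecM (Osec_poly0 b) (Osec_logsum (theta e0 p) HE eta0).
rewrite add0r in H1; rewrite (_ : 1 + (sg - (sg + 1 - tau)) = tau) in H2; last by ring.
apply: Osec_ext r0 _ (OsecD H1 H2) => z Rz zr /=.
have z0 : z != 0 by apply: contraTneq Rz => ->; rewrite /= ltxx.
have Dz : slitdisk r z.
  by split; [rewrite cabs_gt0 z0 zr|move=> [_]; lra].
have az := a0 Dz; have bz : b.[z] != 0.
  by apply: contraNneq az => bz; rewrite aE !hornerM bz !mulr0.
have -> : logsum E (opp e0 p) z = b.[0] * logsum E (theta e0 p) z.
  by rewrite /logsum mulr_sumr; apply: eq_bigr => e _; rewrite /opp hornerZ mulrCA.
have oE : rdot (opr (e0 + N%:R) V) Y z =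
    rdot (Trow a At V) Y z + - ((e0 + N%:R) * (z ^+ kp * b.[z])) * rdot V Y z.
  rewrite /opr -scaleNr (rdotD (Trow a At V)) (rdotZ (- ((e0 + N%:R) *: ('X ^+ kp * b))) V).
  by rewrite hornerN hornerZ hornerM hornerXn.
rewrite (logsum_theta E p e0) oE /G.
have -> : a.[z] = z * (z ^+ kp * b.[z]) by rewrite aE !hornerM hornerX hornerXn.
rewrite exprD; have gen (z' Z K w x y u v c n : C) : z' != 0 -> Z != 0 -> K != 0 -> w != 0 ->
  w * (z' * (x / (z' * (K * w)) * Z^-1 + y * - (n / z' * Z^-1) - v / z') - e0 * (y / Z - u)) +
    (w - c) * (v - e0 * u) =
  (x + - ((e0 + n) * (K * w)) * y) / (Z * K) - c * (v - e0 * u).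
  by move=> h1 h2 h3 h4; field; rewrite h1 h2 h3.
by apply: gen; rewrite ?expf_neq0.
Qed.

Lemma Osec_oprs es V Y E p (sg tau : R) : psol a At r Y ->
  (forall e, e \in E -> sg <= complex.Re e) -> tau < sg + 1 ->
  Osec tau (fun z => rdot V Y z - logsum E p z) ->
  Osec tau (fun z => rdot (oprs es V) Y z / z ^+ (kp * size es) - logsum E (foldr opp p es) z).
Proof.
move=> sY HE ts H; elim: es => [|e es IH] /=; last by rewrite mulnS addnC; exact: Osec_opr HE ts IH.
by apply: Osec_ext ltr01 _ H => z _ _; rewrite muln0 expr0 divr1.
Qed.

Lemma Osec_Trow V Y tau : psol a At r Y -> Osec tau (rdot V Y) -> Osec tau (rdot (Trow a At V) Y).
Proof.
move=> sY H; have CR : C2ex (half r) (rdot V Y).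
  by have [h1 [h2 H1]] := C2ex_rdot V sY; exists h1, h2 => z [Dz _]; exact: H1.
have dR z : half r z -> cdiff (rdot V Y) z (rdot (Trow a At V) Y z / a.[z]).
  by move=> [Dz _]; exact: (@rdot_diff R q a At r a0 V Y z sY Dz).
have := OsecM (Osec_poly ('X ^+ kp * b)) (Osec_Euler r0 CR dR H); rewrite add0r.
apply: Osec_ext r0 _ => z Rz zr.
have z0 : z != 0 by apply: contraTneq Rz => ->; rewrite /= ltxx.
have Dz : slitdisk r z.
  by split; [rewrite cabs_gt0 z0 zr|move=> [_]; lra].
have := a0 Dz; rewrite aE hornerM hornerX mulf_eq0 negb_or => /andP[_ w0].
have gen (z' w x : C) : z' != 0 -> w != 0 -> w * (z' * (x / (z' * w))) = x by move=> h1 h2; field; rewrite ?h1 ?h2.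
by rewrite gen.
Qed.

(** An operator with exponent [e] acts on [p e] as a derivation and lowers its degree; for any other
    exponent the term with factor [e - e0] dominates and the degree is kept. The subtraction is
    truncated, so enough repetitions give [0]. *)
Lemma size_opps es p e : size (foldr opp p es e) = (size (p e) - count_mem e es)%N.
Proof.
elim: es => [|e' es IH] /=; first by rewrite subn0.
rewrite /opp size_scale // /theta; set f := foldr _ _ _ _ in IH *.
have sd : size (deriv f) = (size f).-1.
  have [f0|f0] := eqVneq f 0; first by rewrite f0 deriv0 size_poly0.
  have : (0 < size f)%N by rewrite size_poly_gt0.
  case Es : (size f) => [//|[|n]] _.
    by rewrite (size1_polyC (eq_leq Es)) derivC size_poly0.
  apply/eqP; rewrite eqn_leq; apply/andP; split; first by rewrite -ltnS -Es lt_size_deriv.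
  rewrite ltnNge; apply/negP => /leq_sizeP/(_ n (leqnn n))/eqP.
  rewrite coef_deriv mulrn_eq0 /= -[n.+1]/(n.+2.-1) -Es -lead_coefE lead_coef_eq0.
  by rewrite (negPf f0).
have [->|ne] := eqVneq e' e.
  by rewrite subrr scale0r add0r sd IH add1n subnS.
rewrite add0n -IH; have [f0|f0] := eqVneq f 0.
  by rewrite f0 scaler0 deriv0 addr0.
rewrite size_polyDl size_scale ?subr_eq0 1?eq_sym // sd.
by rewrite prednK // lt0n size_poly_eq0.
Qed.

End Operators.

(** * Separation of leading terms and a determinant that is not flat *)

Section Stage.
Variables (R : realType) (q m : nat).
Local Notation C := (R[i]).
Variables (a b : {poly C}) (kp : nat) (At : 'M[{poly C}]_q) (r : R).
Hypothesis r0 : 0 < r.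
Hypothesis a0 : forall z, slitdisk r z -> a.[z] != 0.
Hypothesis aE : a = 'X * ('X ^+ kp * b).
Hypothesis b0 : b.[0] != 0.
Variables (Ym : C -> 'M[C]_(q, m)) (t0 : 'rV[{poly C}]_q).
Hypothesis sY : forall c : 'cV[C]_m, psol a At r (fun z => Ym z *m c).
Hint Extern 0 (is_true (@Order.le _ _ _ (cabs _))) => exact: cabs_ge0 : core.
Implicit Types (V : 'rV[{poly C}]_q) (E : seq C) (p : C -> {poly C}).
Local Notation oprs := (oprs a b kp At).
Local Notation opp := (opp b).

Definition comb V (c : 'cV[C]_m) z := rdot V (fun z => Ym z *m c) z.

Lemma comb_sum V d (B : 'M[C]_(m, d)) (c : 'cV[C]_d) z :
  comb V (B *m c) z = \sum_k c k 0 * comb V (col k B) z.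
Proof.
rewrite /comb /rdot.
under [RHS]eq_bigr do rewrite mulr_sumr.
rewrite exchange_big /=; apply: eq_bigr => i _.
rewrite mulmxA mxE mulr_sumr; apply: eq_bigr => k _.
have -> : (Ym z *m col k B) i ord0 = (Ym z *m B) i k; last by ring.
by rewrite !mxE; apply: eq_bigr => l _; rewrite mxE.
Qed.

Definition combd es (c : 'cV[C]_m) z := comb (oprs es t0) c z / z ^+ (kp * size es).

(** Only the exponents of real part [sg] are kept; everything else belongs to an error smaller by
    [dl]. The condition outside [E] allows enlarging [E] so that several combinations share it. *)
Definition lead (c : 'cV[C]_m) (sg dl : R) E p :=
  [/\ uniq E, forall e, e \in E -> complex.Re e = sg, forall e, e \notin E -> p e = 0 &
   Osec (sg + dl) (fun z => comb t0 c z - logsum E p z)].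

Definition has_lead c := exists sg dl E p,
  [/\ 0 < dl < 1, lead c sg dl E p & exists2 e, e \in E & p e != 0].

Lemma logsum_ext E E' p z : uniq E -> uniq E' -> {subset E <= E'} ->
  (forall e, e \notin E -> p e = 0) -> logsum E' p z = logsum E p z.
Proof.
move=> uE uE' sub p0; rewrite /logsum (bigID (mem E)) /= [X in _ + X]big1 ?addr0.
  rewrite -big_filter; apply: perm_big; apply: uniq_perm => //; first exact: filter_uniq.
  by move=> e; rewrite mem_filter; apply/andb_idr => /sub.
by move=> e eE; rewrite p0 // horner0 mulr0.
Qed.

Lemma pos_lb (I : finType) (u : I -> R) : (forall i, 0 < u i) ->
  exists2 dl, 0 < dl < 1 & forall i, dl <= u i.
Proof.
move=> u0; suff [dl d1 H] : exists2 dl, 0 < dl < 1 & forall i, i \in enum I -> dl <= u i.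
  by exists dl => // i; apply: H; rewrite mem_enum.
elim: (enum I) => [|i s [dl /andP[d0 d1] H]]; first by exists (1 / 2) => //; lra.
exists (Num.min dl (u i)); first by rewrite lt_min d0 u0 gt_min d1.
move=> j; rewrite inE => /predU1P[->|/H Hj]; first by rewrite ge_min lexx orbT.
by rewrite ge_min Hj.
Qed.

Lemma count_exists E (e0 : C) i0 (N : C -> nat) : exists es, count_mem e0 es = i0 /\
  forall e, e \in E -> e != e0 -> (N e <= count_mem e es)%N.
Proof.
elim: E => [|e E [es [H1 H2]]].
  by exists (nseq i0 e0); split=> //; rewrite count_nseq /= eqxx mul1n.
exists (nseq (if e == e0 then 0%N else N e) e ++ es).
split=> [|e' ]; first by rewrite count_cat count_nseq H1 /=; case: eqVneq.
rewrite count_cat count_nseq inE => /predU1P[->|e'E] ne.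
  by rewrite /= eqxx mul1n (negPf ne) leq_addr.
by apply: leq_trans (H2 e' e'E ne) _; exact: leq_addl.
Qed.

Lemma logsum_opps0 es E p z :
  (forall e, e \in E -> (size (p e) <= count_mem e es)%N) -> logsum E (foldr opp p es) z = 0.
Proof.
move=> H; rewrite /logsum big_seq big1 // => e eE.
have /eqP := size_opps b0 es p e; rewrite (eqP (H e eE : (size (p e) - _)%N == 0%N)).
by rewrite size_poly_eq0 => /eqP ->; rewrite horner0 mulr0.
Qed.

Lemma small_power (dl K e : R) : 0 < dl -> 0 < e -> exists2 x1 : R, 0 < x1 &
  forall x, 0 < x < x1 -> K * expR (dl * ln x) <= e.
Proof.
move=> d0 e0; have K0 : 0 < `|K| + 1 by rewrite ltr_wpDl.
have eK : 0 < e / (`|K| + 1) by rewrite divr_gt0.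
exists (expR (ln (e / (`|K| + 1)) / dl)); first exact: expR_gt0.
move=> x /andP[x0 xx].
have lx : ln x <= ln (e / (`|K| + 1)) / dl by rewrite -[leRHS]expRK ler_ln ?posrE ?expR_gt0 // ltW.
have h : expR (dl * ln x) <= e / (`|K| + 1).
  rewrite -[leRHS]lnK ?posrE // ler_expR mulrC -ler_pdivlMr //.
apply: (@le_trans _ _ ((`|K| + 1) * expR (dl * ln x))).
  by rewrite ler_wpM2r ?expR_ge0 //; have := ler_norm K; lra.
by rewrite mulrC -ler_pdivlMr.
Qed.

Lemma comb_oprs es (c : 'cV[C]_m) (sg dl : R) E p : dl < 1 -> lead c sg dl E p ->
  Osec (sg + dl) (fun z => combd es c z - logsum E (foldr opp p es) z).
Proof.
move=> d1 [uE HE p0 H].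
have := @Osec_oprs R q a b kp At r r0 a0 aE es t0 _ E p sg (sg + dl) (sY c) _ _ H.
by apply=> [e /HE ->|] //; rewrite ltrD2l.
Qed.

Lemma comb_oprs_le es (c : 'cV[C]_m) (sg dl eta : R) E p : 0 < dl < 1 -> 0 < eta ->
  lead c sg dl E p -> Osec (sg - eta) (combd es c).
Proof.
move=> /andP[d0 d1] eta0 H; have H1 := comb_oprs es d1 H; have [uE HE p0 _] := H.
have H2 : Osec (sg - eta) (logsum E (foldr opp p es)).
  by apply: Osec_logsum => // e /HE ->.
have H3 : Osec (sg - eta) (fun z => combd es c z - logsum E (foldr opp p es) z).
  by apply: Osec_le H1; lra.
by apply: Osec_ext ltr01 _ (OsecD H3 H2) => z _ _; rewrite subrK.
Qed.

(** Diagonal entries have exact order [sg l], and entries above the diagonal gain [dl] over the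
    order of their column. Entries below are controlled by [comb_oprs_le], up to an arbitrarily
    small loss. *)
Definition triangular d (v : 'I_d -> 'cV[C]_m) (sg : 'I_d -> R) (qs : 'I_d -> seq C) (dl : R) :=
  [/\ 0 < dl < 1, forall j, exists E p, lead (v j) (sg j) dl E p,
   forall l, exists c : R, exists2 x1 : R, 0 < c /\ 0 < x1 & forall x : R, 0 < x < x1 ->
     c * expR (sg l * ln x) <= cabs (combd (qs l) (v l) x%:C%C) &
   forall l j : 'I_d, (l < j)%N -> Osec (sg j + dl) (combd (qs l) (v j))].

Lemma lead_le c sg dl dl' E p : dl' <= dl -> lead c sg dl E p -> lead c sg dl' E p.
Proof. by move=> dd [h1 h2 h3 h4]; split=> //; apply: Osec_le h4; rewrite lerD2l. Qed.

(** The operators annihilate every exponent but [e0], whose polynomial is reduced to a non-zero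
    constant. On the positive reals the modulus of [cpow x e0] is exactly the power [sg] of [x], so
    the error cannot cancel it. *)
Lemma lead_diag (c : 'cV[C]_m) (sg dl : R) E p e0 es : 0 < dl < 1 -> lead c sg dl E p ->
  e0 \in E -> size (p e0) = (count_mem e0 es).+1 ->
  (forall e, e \in E -> e != e0 -> (size (p e) <= count_mem e es)%N) ->
  exists k : R, exists2 x1 : R, 0 < k /\ 0 < x1 & forall x : R, 0 < x < x1 ->
     k * expR (sg * ln x) <= cabs (combd es c x%:C%C).
Proof.
move=> /andP[d0 d1] Hl e0E s0 sE; have H := comb_oprs es d1 Hl; have [uE HE p0 _] := Hl.
have /size_poly1P[k k0 kE] : size (foldr opp p es e0) == 1%N.
  by rewrite size_opps // s0 subSnn.
have LE z : logsum E (foldr opp p es) z = cpow z e0 * k.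
  rewrite /logsum (bigD1_seq e0) //= kE hornerC big_seq_cond big1 ?addr0 // => e /andP[eE ne].
  have /eqP := size_opps b0 es p e; rewrite (eqP (sE e eE ne : (size (p e) - _)%N == 0%N)).
  by rewrite size_poly_eq0 => /eqP ->; rewrite horner0 mulr0.
have [K [x1 x10 HK]] := Osec_Oray H.
have k20 : 0 < cabs k / 2 by rewrite divr_gt0 ?cabs_gt0.
have [x2 x20 Hx2] := small_power K d0 k20.
exists (cabs k / 2), (Num.min x1 x2); first by split; rewrite // lt_min x10.
move=> x /andP[x0]; rewrite lt_min => /andP[xx1 xx2].
have h1 := HK x ltac:(by rewrite x0); have h2 := Hx2 x ltac:(by rewrite x0).
have cp : cabs (cpow x%:C%C e0) = expR (sg * ln x).
  rewrite cabs_cpow //= cabsR gtr0_norm // HE //.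
  by have := clogR x0; rewrite /clog => -[_ ->]; rewrite mulr0 subr0.
rewrite LE in h1; set f := combd _ _ _ in h1 *.
have h3 := cabsD (cpow x%:C%C e0 * k - f) f; rewrite subrK cabsBC cabsM cp in h3.
have h4 : K * expR ((sg + dl) * ln x) <= cabs k / 2 * expR (sg * ln x).
  by rewrite mulrDl expRD [expR _ * _]mulrC mulrA ler_wpM2r ?expR_ge0.
have -> : cabs k / 2 * expR (sg * ln x) = expR (sg * ln x) * cabs k - cabs k / 2 * expR (sg * ln x).
  by field.
lra.
Qed.

(** Gaussian elimination on one leading coefficient: at the lowest order [sg] and one exponent [e0],
    the pivot column [k0] has the highest power of the logarithm, and [T] subtracts multiples of it
    to remove this power from the other columns. *)
Lemma stage_step d (B : 'M[C]_(m, d.+1)) :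
  (forall c : 'cV[C]_d.+1, c != 0 -> has_lead (B *m c)) ->
  exists k0 : 'I_d.+1, exists T : 'M[C]_(d.+1, d), exists sg dl : R, exists E : seq C,
  exists pc : 'cV[C]_d.+1 -> C -> {poly C}, exists2 e0 : C, e0 \in E & exists i0 : nat,
   [/\ 0 < dl < 1, forall c, lead (B *m c) sg dl E (pc c),
     forall c : 'cV[C]_d, c != 0 -> T *m c != 0,
     size (pc (delta_mx k0 0) e0) = i0.+1 &
     forall c : 'cV[C]_d, (size (pc (T *m c) e0) <= i0)%N].
Proof.
move=> HB.
have H1 k : has_lead (col k B).
  rewrite colE; apply: HB; apply/eqP => /colP/(_ k)/eqP; rewrite !mxE !eqxx oner_eq0 //.
have /choice[sgk H2] := H1; have /choice[dlk H3] := H2; have /choice[Ek H4] := H3.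
have /choice[pk {H1 H2 H3 H4}Hk] := H4.
pose k1 := [arg min_(k < ord0) sgk k]%O; pose sg := sgk k1.
have sgmin k : sg <= sgk k by rewrite /sg /k1; case: arg_minP => // i _; apply.
(* A column of larger order must count as error at level [sg]: one half of the gap is the required
   gain, the other pays for its logarithms. *)
have [|dl d01 Hdl] := @pos_lb _ (fun k => Num.min (dlk k) (if sgk k == sg then 1 else (sgk k - sg) / 2)).
  move=> k; rewrite lt_min; have [/andP[-> _] _ _] := Hk k => /=.
  by case: eqVneq => // ne; rewrite divr_gt0 // subr_gt0 lt_def ne sgmin.
have /andP[d0 d1] := d01.
pose E := [seq e <- undup (flatten [seq Ek k | k <- enum 'I_d.+1]) | complex.Re e == sg].
have uE : uniq E by rewrite filter_uniq // undup_uniq.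
have HE e : e \in E -> complex.Re e = sg by rewrite mem_filter => /andP[/eqP].
have subE k : sgk k = sg -> {subset Ek k <= E}.
  move=> ks e eE; have [_ [_ h _ _] _] := Hk k.
  rewrite mem_filter h // ks eqxx mem_undup /=; apply/flattenP; exists (Ek k) => //.
  by apply/mapP; exists k => //; rewrite mem_enum.
pose p0 k e : {poly C} := if sgk k == sg then pk k e else 0.
have p0E k e : e \notin E -> p0 k e = 0.
  move=> eE; rewrite /p0; case: eqVneq => // ks; have [_ [_ _ h _] _] := Hk k.
  by apply: h; apply: contra eE; exact: subE.
have Hp0 k : Osec (sg + dl) (fun z => comb t0 (col k B) z - logsum E (p0 k) z).
  have [/andP[dk0 dk1] [uEk hEk hpk hO] _] := Hk k.
  have := Hdl k; rewrite le_min => /andP[ddk].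
  case: eqVneq => [ks _|ks dks].
    apply: Osec_ext ltr01 _ (Osec_le _ hO) => [z _ _|]; last by rewrite ks lerD2l.
    congr (_ - _); rewrite -(logsum_ext z uEk uE) //; last exact: subE.
    by apply: eq_bigr => e _; rewrite /p0 ks eqxx.
  have h1 : Osec (sg + dl) (logsum (Ek k) (pk k)).
    apply: (@Osec_le _ _ (sgk k - dl)); first by lra.
    by apply: Osec_logsum => // e /hEk ->.
  have h2 : Osec (sg + dl) (fun z => comb t0 (col k B) z - logsum (Ek k) (pk k) z).
    by apply: Osec_le hO; have := sgmin k; lra.
  apply: Osec_ext ltr01 _ (OsecD h2 h1) => z _ _; rewrite subrK [X in _ - X]big1 ?subr0 //.
  by move=> e _; rewrite /p0 (negPf ks) horner0 mulr0.
pose pc (c : 'cV[C]_d.+1) e : {poly C} := \sum_k c k 0 *: p0 k e.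
have Hpc c : lead (B *m c) sg dl E (pc c).
  split=> // [e eE|]; first by rewrite /pc big1 // => k _; rewrite p0E // scaler0.
  have := @Osec_sum R (sg + dl) _ (index_enum 'I_d.+1)
    (fun k z => c k 0 * (comb t0 (col k B) z - logsum E (p0 k) z)) (fun k _ => OsecZ _ (Hp0 k)).
  apply: Osec_ext ltr01 _ => z _ _; rewrite comb_sum /logsum.
  under eq_bigr do rewrite mulrBr; rewrite sumrB; congr (_ - _).
  under eq_bigr do rewrite mulr_sumr; rewrite exchange_big; apply: eq_bigr => e _.
  rewrite /pc horner_sum mulr_sumr; apply: eq_bigr => k _; rewrite hornerZ; ring.
have [e0 e0E p1] : exists2 e0, e0 \in E & p0 k1 e0 != 0.
  have [_ _ [e eE pe]] := Hk k1; exists e; first exact: (subE k1).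
  by rewrite /p0 eqxx.
pose k0 := [arg max_(k > k1) size (p0 k e0)].
have kmax k : (size (p0 k e0) <= size (p0 k0 e0))%N.
  by rewrite /k0; case: arg_maxnP => // i _; apply.
have s0 : (0 < size (p0 k0 e0))%N by apply: leq_trans (kmax k1); rewrite size_poly_gt0.
pose i0 := (size (p0 k0 e0)).-1; pose la k := (p0 k e0)`_i0.
have la0 : la k0 != 0 by rewrite /la -lead_coefE lead_coef_eq0 -size_poly_gt0.
(* Column [j] is the basis vector of [lift k0 j], corrected along [k0] to cancel the coefficient of
   degree [i0]; it is injective because the coordinates other than [k0] are unchanged. *)
pose T : 'M[C]_(d.+1, d) := \matrix_(k, j)
  ((k == lift k0 j)%:R - la (lift k0 j) / la k0 * (k == k0)%:R).
have Tl (c : 'cV[C]_d) j : (T *m c) (lift k0 j) 0 = c j 0.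
  rewrite mxE (bigD1 j) //= mxE eqxx eq_sym (negPf (neq_lift _ _)) mulr0 subr0 mul1r.
  rewrite big1 ?addr0 // => l lj; rewrite mxE (inj_eq lift_inj) eq_sym (negPf lj).
  by rewrite eq_sym (negPf (neq_lift _ _)) mulr0 subr0 mul0r.
have T0 (c : 'cV[C]_d) : (T *m c) k0 0 = - \sum_j la (lift k0 j) / la k0 * c j 0.
  rewrite mxE -sumrN; apply: eq_bigr => j _.
  by rewrite mxE eqxx (negPf (neq_lift _ _)) mulr1 sub0r mulNr.
exists k0, T, sg, dl, E, pc; exists e0 => //; exists i0; split=> //.
- move=> c; apply: contraNneq => Tc; apply/eqP/colP => j; by rewrite -Tl Tc !mxE.
- rewrite /pc (bigD1 k0) //= mxE !eqxx scale1r big1 ?addr0 ?prednK // => k kk.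
  by rewrite mxE (negPf kk) scale0r.
move=> c; have sz : (size (pc (T *m c) e0) <= i0.+1)%N.
  rewrite /pc prednK //; apply: size_sum_bound => k _.
  exact: leq_trans (size_scale_leq _ _) (kmax k).
apply/leq_sizeP => j; rewrite leq_eqVlt => /predU1P[<-|ij]; last first.
  by apply: (leq_sizeP _ _ sz).
rewrite /pc coef_sum (bigD1_ord k0) //= coefZ T0 -/(la k0) mulNr mulr_suml.
under [X in _ + X]eq_bigr do rewrite coefZ Tl -/(la _).
rewrite addrC -sumrB big1 // => l _; set x := la _; rewrite mulrAC divfK //.
by rewrite mulrC subrr.
Qed.

(** Induction puts the pivot first and applies the result to the eliminated columns [B *m T]. The
    new operator list must isolate the pivot term and kill the leading terms of all the other
    vectors. *)
Lemma stage d (B : 'M[C]_(m, d)) : (forall c : 'cV[C]_d, c != 0 -> has_lead (B *m c)) ->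
  exists v sg qs dl, triangular v sg qs dl /\ forall j : 'I_d, exists u, v j = B *m u.
Proof.
elim: d B => [|d IH] B HB.
  exists (fun=> 0), (fun=> 0), (fun=> [::]), (1 / 2); split; last by case.
  by split; [lra|case|case|case].
have [k0 [T [sg [dl [E [pc [e0 e0E [i0 [d01 Hpc HT s0 sT]]]]]]]]] := stage_step HB.
have [c c0|v [sg' [qs [dl' [[d01' Hl Hd Ht] Hu]]]]] := IH (B *m T).
  by rewrite -mulmxA; apply: HB; exact: HT.
have /choice[u {}Hu] := Hu; have /choice[E' {}Hl] := Hl; have /choice[p' {}Hl] := Hl.
(* The exponent [e0] occurs exactly [i0] times: the pivot, of degree [i0], becomes a constant there,
   and the eliminated vectors, of smaller degree, become [0]. Every other exponent occurs often
   enough to disappear. *)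
have [es [es0 esN]] := @count_exists (E ++ flatten [seq E' j | j <- enum 'I_d]) e0 i0
  (fun e => size (pc (delta_mx k0 0%R) e) +
     \sum_j (size (p' j e) + size (pc (T *m u j) e)))%N.
have es1 e : e \in E -> e != e0 -> (size (pc (delta_mx k0 0%R) e) <= count_mem e es)%N.
  move=> eE ne; apply: leq_trans (esN e _ ne); last by rewrite mem_cat eE.
  exact: leq_addr.
have es2 j e : e \in E -> e != e0 -> (size (pc (T *m u j) e) <= count_mem e es)%N.
  move=> eE ne; apply: leq_trans (esN e _ ne); last by rewrite mem_cat eE.
  by rewrite (bigD1 j) //= addnCA -!addnA addnCA leq_addr.
have es3 j e : e \in E' j -> e != e0 -> (size (p' j e) <= count_mem e es)%N.
  move=> eE ne; apply: leq_trans (esN e _ ne).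
    by rewrite (bigD1 j) //= addnCA -!addnA leq_addr.
  rewrite mem_cat; apply/orP; right; apply/flattenP; exists (E' j) => //.
  by apply/mapP; exists j => //; rewrite mem_enum.
have /andP[d0 d1] := d01; have /andP[d0' d1'] := d01'.
have Bk : B *m delta_mx k0 (0 : 'I_1) = col k0 B by rewrite colE.
pose dm := Num.min dl dl'; have dm1 : dm <= dl by rewrite ge_min lexx.
have dm2 : dm <= dl' by rewrite ge_min lexx orbT.
exists (fun j => if unlift ord0 j is Some j' then v j' else col k0 B),
  (fun j => if unlift ord0 j is Some j' then sg' j' else sg),
  (fun j => if unlift ord0 j is Some j' then qs j' else es), dm; split.
  split=> [|j|l|l j].
  - by rewrite lt_min d0 d0' gt_min d1.
  - case: unliftP => [j' _|_]; first by exists (E' j'), (p' j'); exact: lead_le (Hl j').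
    by exists E, (pc (delta_mx k0 0)); rewrite -Bk; exact: lead_le (Hpc _).
  - case: unliftP => [l' _|_]; first exact: Hd.
    by rewrite -Bk; apply: lead_diag d01 (Hpc _) e0E _ es1; rewrite s0 es0.
  case: (unliftP ord0 j) => [j' ->|->]; last by rewrite ltn0.
  case: (unliftP ord0 l) => [l' ->|-> _].
    by rewrite /= /bump !leq0n !add1n ltnS => lj; apply: Osec_le (Ht l' j' lj); rewrite lerD2l.
  (* If the vector has leading order at most [sg], its expansion at level [sg] is killed and the
     error there suffices. Otherwise its own expansion is used; its exponents have real part above
     [sg], so [e0] is not among them. *)
  have [le|lt] := leP (sg' j') sg.
    apply: (@Osec_le _ _ (sg + dl)); first by rewrite lerD.
    have := comb_oprs es d1 (Hpc (T *m u j')); rewrite mulmxA -Hu.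
    apply: Osec_ext ltr01 _ => z _ _; rewrite logsum_opps0 ?subr0 // => e eE.
    by have [->|ne] := eqVneq e e0; [rewrite es0; exact: sT|exact: es2].
  apply: (@Osec_le _ _ (sg' j' + dl')); first by rewrite lerD2l.
  have := comb_oprs es d1' (Hl j'); apply: Osec_ext ltr01 _ => z _ _.
  rewrite logsum_opps0 ?subr0 // => e eE; apply: es3 => //.
  have [_ hE' _ _] := Hl j'; have [_ hE _ _] := Hpc 0.
  by apply: contraTneq lt => e_e0; rewrite -(hE' e eE) e_e0 hE // ltxx.
move=> j; case: unliftP => [j' _|_]; last by exists (delta_mx k0 0).
by exists (T *m u j'); rewrite Hu mulmxA.
Qed.

Lemma perm_le_id d (s : 'S_d) : (forall l : 'I_d, (s l <= l)%N) -> s = 1%g.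
Proof.
move=> H; suff F n (l : 'I_d) : (l < n)%N -> s l = l.
  by apply/permP => l; rewrite perm1; exact: (F l.+1).
elim: n l => // n IH l; rewrite ltnS => ln.
have := H l; rewrite leq_eqVlt => /predU1P[/val_inj //|lt].
exact: (@perm_inj _ s) (IH _ (leq_trans lt ln)).
Qed.

(** A permutation other than the identity picks at least one entry above the diagonal, so its
    product is smaller than the diagonal product, which is bounded below by a multiple of the power
    [S] of [x]. *)
Lemma triangular_not_flat d v sg qs dl : @triangular d v sg qs dl ->
  ~ flat (fun z => \det (\matrix_(l, j) combd (qs l) (v j) z)).
Proof.
move=> [d01 Hl Hd Ht] Hf; have /andP[d0 d1] := d01.
pose g l j := combd (qs l) (v j).
(* The [d] logarithmic losses together stay below [dl / 2], so every non-identity permutation keeps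
   a gain of [dl / 2]. *)
pose eta := dl / (2 * d.+1%:R); have D0 : 0 < d.+1%:R :> R by rewrite ltr0n.
have eta0 : 0 < eta by rewrite divr_gt0 // mulr_gt0.
pose tau (l j : 'I_d) := sg j - eta + (if (l < j)%N then dl else 0).
have Og l j : Oray (tau l j) (g l j).
  apply: Osec_Oray; rewrite /tau; case: ifP => lj.
    by apply: Osec_le (Ht l j lj); lra.
  by rewrite addr0; have [E [p H]] := Hl j; exact: comb_oprs_le d01 eta0 H.
pose S := \sum_j sg j.
have Os (s : 'S_d) : s != 1%g -> Oray (S + dl / 2) (fun z => (-1) ^+ s * \prod_l g l (s l) z).
  move=> s1; apply: OrayZ; apply: Oray_le (Oray_prod _ (fun l => Og l (s l))).
  have [l0 Hl0] : exists l : 'I_d, (l < s l)%N.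
    apply/existsP; apply: contraNT s1 => /existsPn H; apply/eqP; apply: perm_le_id => l.
    by rewrite leqNgt.
  have hS : \sum_i sg (s i) = S by rewrite /S [RHS](reindex_inj (@perm_inj _ s)).
  rewrite /tau big_split sumrB /= hS.
  have h1 : dl <= \sum_(i < d) (if (i < s i)%N then dl else 0).
    rewrite (bigD1 l0) //= Hl0 lerDl; apply: sumr_ge0 => i _; case: ifP => // _; exact: ltW.
  have h2 : \sum_(i < d) eta <= dl / 2.
    rewrite sumr_const card_ord -[_ *+ d]mulr_natl.
    have dd : d%:R <= d.+1%:R :> R by rewrite ler_nat.
    apply: le_trans (ler_wpM2r (ltW eta0) dd) _.
    have gen (x : R) : x != 0 -> x * (dl / (2 * x)) = dl / 2 by move=> x0; field.
    by rewrite gen // lt0r_neq0.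
  lra.
have Hd' : Oray (S + dl / 2) (fun z => \prod_l g l l z).
  have H1 : Oray (S + dl / 2) (fun z => \sum_(s : 'S_d | s != 1%g) (-1) ^+ s * \prod_l g l (s l) z).
    exact: Oray_sum.
  have H2 : Oray (S + dl / 2) (fun z => \det (\matrix_(l, j) combd (qs l) (v j) z)).
    have [k Hk] : exists k : nat, S + dl / 2 <= k%:R.
      exists (Num.Def.archi_bound `|S + dl / 2|); apply: le_trans (ler_norm _) (ltW _).
      exact: archi_boundP.
    by apply: Oray_le Hk _; exact: Hf.
  apply: Oray_ext (OrayD H2 (OrayZ (-1) H1)) => x _; rewrite /determinant (bigD1 (1%g : 'S_d)) //=.
  rewrite odd_perm1 mul1r mulN1r -addrA [X in _ + X](_ : _ = 0) ?addr0.
    by apply: eq_bigr => l _; rewrite perm1 mxE.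
  apply/eqP; rewrite subr_eq0; apply/eqP; apply: eq_bigr => s _; congr (_ * _).
  by apply: eq_bigr => l _; rewrite mxE.
have [k [x1 [k0 x10] Hk]] : exists k : R, exists2 x1 : R, 0 < k /\ 0 < x1 & forall x : R, 0 < x < x1 ->
     k * expR (S * ln x) <= cabs (\prod_l g l l x%:C%C).
  rewrite /S; elim: (index_enum 'I_d) => [|j s [k [x1 [k0 x10] Hk]]].
    by exists 1, 1 => // x _; rewrite !big_nil mul0r expR0 mul1r cabs1.
  have [k' [x1' [k'0 x1'0] Hk']] := Hd j.
  exists (k' * k), (Num.min x1 x1'); first by rewrite mulr_gt0 // lt_min x10.
  move=> x /andP[x0]; rewrite lt_min => /andP[xx1 xx1'].
  rewrite !big_cons mulrDl expRD mulrACA cabsM; apply: ler_pM.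
  - by rewrite mulr_ge0 ?expR_ge0 // ltW.
  - by rewrite mulr_ge0 ?expR_ge0 // ltW.
  - by apply: Hk'; rewrite x0.
  - by apply: Hk; rewrite x0.
have [K [x2 x20 HK]] := Hd'.
have k20 : 0 < k / 2 by lra.
have dl20 : 0 < dl / 2 by lra.
have [x3 x30 Hx3] := small_power K dl20 k20.
pose y := Num.min x1 (Num.min x2 x3); have y0 : 0 < y by rewrite !lt_min x10 x20.
have y1 : y <= x1 by rewrite ge_min lexx.
have y2 : y <= x2 by rewrite !ge_min lexx ?orbT.
have y3 : y <= x3 by rewrite !ge_min lexx ?orbT.
have xx z : y <= z -> 0 < y / 2 < z by move=> yz; apply/andP; split; lra.
have h1 := Hk _ (xx _ y1); have h2 := HK _ (xx _ y2); have h3 := Hx3 _ (xx _ y3).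
have := le_trans h1 h2; rewrite mulrDl expRD [expR _ * _]mulrC mulrA ler_pM2r ?expR_gt0 //.
lra.
Qed.

End Stage.

(** * From the Nilsson class to orders and leading terms *)

Section Nilsson.
Variable R : realType.
Local Notation C := (R[i]).
Hint Extern 0 (is_true (@Order.le _ _ _ (cabs _))) => exact: cabs_ge0 : core.

Lemma nilsson_ext (r : R) (f g : C -> C) E I h tau : 0 < r -> nilsson_rep r f E I h ->
  Osec tau (fun z => \sum_(e <- E) \sum_(i < I) h e i z * cpow z e * clog z ^+ i - g z) ->
  Osec tau (fun z => f z - g z).
Proof.
move=> r0 [_ _ [rho rho0 H]]; apply: (@Osec_ext _ _ _ _ (Num.min r rho)).
  by rewrite lt_min r0.
move=> z Rz; rewrite lt_min => /andP[zr zrho]; rewrite -H //; split.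
  by rewrite zr cabs_gt0 andbT; apply: contraTneq Rz => ->; rewrite /= ltxx.
by move=> [_]; lra.
Qed.

Lemma Osec_holo0 (h : C -> C) : holo_at h 0 -> Osec 0 h.
Proof.
move=> /Osec_holo/(Osec_le ler01) H; apply: Osec_ext ltr01 _ (OsecD H (Osec_cst (h 0))) => z _ _.
by rewrite subrK.
Qed.

(** The powers of the logarithm cost an arbitrarily small order; one full unit is given up for all
    of them. *)
Lemma nilsson_small (r : R) f E I h (T : R) : 0 < r -> nilsson_rep r f E I h ->
  (forall e, e \in E -> T <= complex.Re e) -> Osec (T - 1) f.
Proof.
move=> r0 H HT; have := @nilsson_ext r f (fun=> 0) E I h (T - 1) r0 H.
have [_ hol _] := H.
move=> /(_ _) H1; apply: (@Osec_ext _ _ (fun z => f z - 0) _ _ ltr01).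
  by move=> z _ _; rewrite subr0.
apply: H1; apply: (@Osec_ext _ _ (fun z => \sum_(e <- E) \sum_(i < I) h e i z * cpow z e * clog z ^+ i) _ _ ltr01).
  by move=> z _ _; rewrite subr0.
apply: Osec_sum => e eE; apply: Osec_sum => i _.
apply: Osec_le (OsecM (OsecM (Osec_holo0 (hol e i eE (ltn_ord i))) (Osec_cpow e)) (Osec_clogX i ltr01)).
by rewrite add0r lerD2r HT.
Qed.

Lemma Re_min (E : seq C) : E != [::] -> exists2 e1, e1 \in E & forall e, e \in E -> complex.Re e1 <= complex.Re e.
Proof.
elim: E => // e [|e' E] IH _.
  by exists e; rewrite ?mem_head // => e'; rewrite inE => /eqP ->.
have [//|e1 e1E H] := IH; have [le|/ltW le] := leP (complex.Re e) (complex.Re e1).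
  exists e; rewrite ?mem_head // => x; rewrite inE => /predU1P[->//|/H]; exact: le_trans.
by exists e1; rewrite 1?inE ?e1E ?orbT // => x; rewrite inE => /predU1P[->//|/H].
Qed.

Lemma Re_gap (E : seq C) (sg : R) : (forall e, e \in E -> sg <= complex.Re e) ->
  exists2 dl : R, 0 < dl < 1 & forall e, e \in E -> complex.Re e != sg -> sg + dl <= complex.Re e - dl.
Proof.
elim: E => [|e E IH] H; first by exists (1 / 2) => //; lra.
have [|dl /andP[d0 d1] Hd] := IH; first by move=> x xE; apply: H; rewrite inE xE orbT.
have he := H e (mem_head _ _).
have [ee|ne] := eqVneq (complex.Re e) sg.
  exists dl; rewrite ?d0 // => x; rewrite inE => /predU1P[->|]; last exact: Hd.
  by rewrite ee eqxx.
have lt : sg < complex.Re e by rewrite lt_def ne.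
exists (Num.min dl ((complex.Re e - sg) / 2)); first by rewrite lt_min gt_min d0 d1 /=; lra.
set d' := Num.min _ _; have h1 : d' <= dl by rewrite ge_min lexx.
have h2 : d' <= (complex.Re e - sg) / 2 by rewrite ge_min lexx orbT.
move=> x; rewrite inE => /predU1P[->|xE] nx; first by lra.
by have := Hd x xE nx; lra.
Qed.

(** Replacing [h e i z] by [h e i 0] changes a term by a factor of order one. Normalisation makes
    the polynomial with coefficients [h e i 0] non-zero at every exponent, in particular at one of
    least real part. *)
Lemma nilsson_lead (r : R) f E I h : 0 < r -> nilsson_rep r f E I h -> normalized E I h ->
  E != [::] -> exists (sg dl : R) (E' : seq C) (p : C -> {poly C}),
  [/\ 0 < dl < 1, [/\ uniq E', forall e, e \in E' -> complex.Re e = sg,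
    forall e, e \notin E' -> p e = 0 & Osec (sg + dl) (fun z => f z - logsum E' p z)] &
    exists2 e, e \in E' & p e != 0].
Proof.
move=> r0 H nE E0; have [uE hol _] := H.
have [e1 e1E He1] := Re_min E0; pose sg := complex.Re e1.
have [dl d01 Hdl] := Re_gap He1; have /andP[d0 d1] := d01.
pose E' := [seq e <- E | complex.Re e == sg].
pose pe e : {poly C} := \poly_(i < I) h e i 0.
pose p e := if e \in E' then pe e else 0.
exists sg, dl, E', p; split=> //; last first.
  exists e1; first by rewrite mem_filter eqxx.
  have [i hi] := nE e1 e1E; rewrite /p mem_filter eqxx e1E /=.
  apply: contraNneq hi => /(congr1 (fun u : {poly C} => u`_i)); rewrite coef_poly ltn_ord coef0 => ->.
  by [].
split=> [|e|e|].
- exact: filter_uniq.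
- by rewrite mem_filter => /andP[/eqP].
- by rewrite /p => /negPf ->.
apply: (nilsson_ext r0 H).
apply: (@Osec_ext _ _ (fun z => \sum_(e <- E) (\sum_(i < I) (h e i z - h e i 0) * cpow z e * clog z ^+ i +
   if complex.Re e == sg then 0 else cpow z e * (pe e).[clog z])) _ _ ltr01) => [z _ _|].
  rewrite /logsum big_filter [X in _ = _ - X]big_mkcond -sumrB big_seq [RHS]big_seq.
  apply: eq_bigr => e eE; have -> : \sum_(i < I) (h e i z - h e i 0) * cpow z e * clog z ^+ i =
     \sum_(i < I) h e i z * cpow z e * clog z ^+ i - cpow z e * (pe e).[clog z].
    rewrite horner_poly mulr_sumr -sumrB; apply: eq_bigr => i _; ring.
  rewrite /p mem_filter eE andbT; case: ifP => _; rewrite ?addr0 //.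
  by rewrite subrK subr0.
apply: Osec_sum => e eE; apply: OsecD.
  apply: Osec_sum => i _; have eta0 : 0 < 1 - dl by lra.
  apply: Osec_le (OsecM (OsecM (Osec_holo (hol e i eE (ltn_ord i))) (Osec_cpow e)) (Osec_clogX i eta0)).
  by have := He1 e eE; rewrite -/sg; lra.
case: eqVneq => [_|ne]; first exact: Osec0.
by apply: Osec_le (OsecM (Osec_cpow e) (Osec_clog_poly (pe e) d0)); exact: Hdl.
Qed.

End Nilsson.

(** * Lower bound for the order of the determinant at the origin *)

Section OrderBound.
Variable R : realType.
Local Notation C := (R[i]).
Hint Extern 0 (is_true (@Order.le _ _ _ (cabs _))) => exact: cabs_ge0 : core.
Local Notation fr := (map_mx (@tofrac {poly _})).
Local Notation "M ^@ z" := (map_mx (horner_eval z) M) (at level 2).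

(** Complete the selected unit rows to an invertible [N] and let [G] be the last columns of its
    inverse: [N *m row_mx Psi G] is block triangular with the minor as one block. [G] is independent
    of [Psi]. *)
Lemma minor_completion (F : fieldType) m k (f : 'I_m -> 'I_(m + k)) : injective f ->
  exists G : 'M[F]_(m + k, k), exists2 c : F, c != 0 &
    forall Psi : 'M[F]_(m + k, m), \det (rowsub f Psi) = c * \det (row_mx Psi G).
Proof.
move=> fi; pose Ef : 'M[F]_(m, m + k) := rowsub f 1%:M.
have EE n (Psi : 'M[F]_(m + k, n)) : Ef *m Psi = rowsub f Psi by rewrite mul_rowsub_mx mul1mx.
have Efree : row_free Ef.
  apply/row_freeP; exists (colsub f 1%:M); rewrite EE; apply/matrixP => i j; rewrite !mxE.
  by rewrite (inj_eq fi).
have [N uN NE] := unit_completion Efree.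
exists (rsubmx (invmx N)), (\det N); first by rewrite -unitfE -unitmxE.
move=> Psi; rewrite -det_mulmx mul_mx_row -EE -NE.
have -> : N *m rsubmx (invmx N) = col_mx 0 1%:M.
  rewrite -[LHS](row_mxKr (N *m lsubmx (invmx N))) -mul_mx_row hsubmxK mulmxV //.
  by rewrite scalar_mx_block block_mxEh row_mxKr.
have -> : row_mx (N *m Psi) (col_mx 0 1%:M) = block_mx (usubmx N *m Psi) 0 (dsubmx N *m Psi) 1%:M.
  by rewrite block_mxEh -mul_col_mx vsubmxK.
by rewrite det_lblock det1 mulr1.
Qed.

Lemma Oray_det n (tau : 'I_n -> R) (g : C -> 'M[C]_n) :
  (forall i j, Oray (tau j) (fun z => g z i j)) -> Oray (\sum_j tau j) (fun z => \det (g z)).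
Proof.
move=> H; apply: Oray_sum => s _; apply: OrayZ.
rewrite (reindex_inj (@perm_inj _ s)) /=.
exact: (Oray_prod _ (fun i => H i (s i))).
Qed.

Lemma rdot_mx q (V : 'rV[{poly C}]_q) (Y : C -> 'cV[C]_q) z :
  rdot V Y z = (V^@z *m Y z) 0 0.
Proof. by rewrite mxE; apply: eq_bigr => i _; rewrite mxE. Qed.

Variables (q : nat) (a b : {poly C}) (kp : nat) (At : 'M[{poly C}]_q) (r : R).
Hypothesis r0 : 0 < r.
Hypothesis a0 : forall z, slitdisk r z -> a.[z] != 0.
Hypothesis aE : a = 'X * ('X ^+ kp * b).
Hypothesis b0 : b.[0] != 0.
Variable Phi : C -> 'M[C]_q.
Hypothesis sPhi : forall c : 'cV[C]_q, psol a At r (fun z => Phi z *m c).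
Hypothesis uPhi : forall z, slitdisk r z -> Phi z \in unitmx.

Lemma rdot_Trow0 V Y : psol a At r Y -> (forall z, slitdisk r z -> rdot V Y z = 0) ->
  forall z, slitdisk r z -> rdot (Trow a At V) Y z = 0.
Proof.
move=> sY H z Dz; have [e e0 He] := slitdisk_open Dz.
have d0 : cdiff (rdot V Y) z 0.
  apply: cdiff_ext (cdiff_cst 0 z); exists e => // h he; by rewrite H //; exact: He.
have /eqP := cdiff_uniq (@rdot_diff R q a At r a0 V Y z sY Dz) d0.
by rewrite mulf_eq0 invr_eq0 (negPf (a0 Dz)) orbF => /eqP.
Qed.

Lemma Phi_ccont i j z : slitdisk r z -> ccont (fun u => Phi u i j) z.
Proof.
move=> Dz; have := cdiff_ccont (sPhi (delta_mx j 0) Dz i); congr ccont.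
by apply/funext => u; rewrite -colE mxE.
Qed.

(** At a generic point the first [p] rows have rank [p] on the values of the solutions, and by
    [rdot_kernel] their vanishing at that point already implies that [t 0 . Y] is zero. So the
    relation is the kernel of a constant matrix of rank [p], of dimension [q - p]. *)
Lemma rel_kernel (t : nat -> 'rV[{poly C}]_q) p (de : {poly C}) (c : 'I_p -> {poly C}) (E : 'M[C]_(q, p)) :
  (forall k, t k.+1 = Trow a At (t k)) -> de *: t p = \sum_k c k *: t k -> de != 0 -> (0 < p)%N ->
  \det ((\matrix_(k < p) t k) *m map_mx polyC E) != 0 ->
  exists s, exists2 Cz : 'M[C]_(q, s), q = (p + s)%N /\ \rank Cz = s &
    forall y : 'cV[C]_q, (forall z, slitdisk r z -> rdot (t 0%N) (fun z => Phi z *m y) z = 0) <->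
      exists u, y = Cz *m u.
Proof.
move=> tS tp de0 p0 dE; set tm := \matrix_(k < p) t k in dE *.
have [x xr /[!hornerM]] := poly_nonroot (mulf_neq0 de0 dE) r0.
rewrite mulf_eq0 negb_or => /andP[dex dEx].
have Dx : slitdisk r x%:C%C by exact: slitdisk_pos.
pose K : 'M[C]_(p, q) := tm^@(x%:C%C) *m Phi x%:C%C.
have rK : \rank K = p.
  rewrite mxrankMfree ?row_free_unit ?uPhi //; apply/eqP; rewrite eqn_leq rank_leq_row /=.
  have u : tm^@(x%:C%C) *m (map_mx polyC E)^@(x%:C%C) \in unitmx.
    by rewrite -map_mxM unitmxE unitfE det_map_mx.
  by rewrite -{1}(mxrank_unit u) mxrankM_maxl.
pose B := row_base (kermx K^T); exists (\rank (kermx K^T)), B^T.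
  rewrite mxrank_tr; split; last by apply/eqP; exact: row_base_free.
  by rewrite mxrank_ker mxrank_tr rK subnKC // -rK rank_leq_col.
have KE y (k : 'I_p) : (K *m y) k 0 = rdot (t k) (fun z => Phi z *m y) x%:C%C.
  rewrite rdot_mx /K -mulmxA [LHS]mxE [RHS]mxE; apply: eq_bigr => i _.
  by rewrite [X in X * _]mxE [in RHS]mxE mxE.
have Ky y : (forall z, slitdisk r z -> rdot (t 0%N) (fun z => Phi z *m y) z = 0) <-> K *m y = 0.
  split=> [H|H].
    apply/colP => k; rewrite [RHS]mxE KE.
    have Hk n : forall z, slitdisk r z -> rdot (t n) (fun z => Phi z *m y) z = 0.
      by elim: n => // n IH; rewrite tS; apply: rdot_Trow0.
    exact: Hk.
  have HK := @rdot_kernel R q a At r a0 t p de c _ x tS tp xr dex (sPhi y).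
  apply: HK => // k.
  by rewrite -KE H mxE.
move=> y; rewrite Ky; split=> [H|[u ->]].
  have : (y^T <= B)%MS.
    rewrite eq_row_base; apply/sub_kermxP; by rewrite -trmx_mul H trmx0.
  by move=> /submxP[u yE]; exists u^T; rewrite -[y]trmxK yE trmx_mul.
have : (B <= kermx K^T)%MS by rewrite eq_row_base.
move=> /sub_kermxP BK; apply: trmx_inj; rewrite trmx0 !trmx_mul trmxK -mulmxA BK mulmx0 //.
Qed.

Lemma flat_ext (g g' : C -> C) : (forall z, g z = g' z) -> flat g -> flat g'.
Proof. by move=> E H k; apply: Oray_ext (H k) => x _; rewrite E. Qed.

Lemma not_dvd_Xn (F : fieldType) (D : {poly F}) : D != 0 -> ~~ ('X ^+ (size D).+1 %| D).
Proof.
by move=> D0; apply/negP => /(dvdp_leq D0); rewrite size_polyXn => /ltnW; rewrite ltnn.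
Qed.

(** [tau0] depends on the system and [Phi] only. Some minor of [Psi] is not flat, hence not of order
    [tau0]; its product with the determinant has order at least [m * (T - 1)], so the determinant
    must supply the difference. *)
Lemma order_bound : exists tau0 : nat,
  forall (t : nat -> 'rV[{poly C}]_q) p (de : {poly C}) (c : 'I_p -> {poly C}) m
    (Cy : 'M[C]_(q, m)) (T : R),
  (forall k, t k.+1 = Trow a At (t k)) -> de *: t p = \sum_k c k *: t k -> de != 0 ->
  (0 < p <= q)%N -> row_free (fr (\matrix_(k < p) t k)) ->
  (forall c : 'cV[C]_m, c != 0 -> has_lead (fun z => Phi z *m Cy) (t 0%N) c) ->
  (forall j, Osec (T - 1) (rdot (t 0%N) (fun z => Phi z *m col j Cy))) ->
  exists2 E : 'M[C]_(q, p), \det ((\matrix_(k < p) t k) *m map_mx polyC E) != 0 &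
    forall o : nat, ~~ ('X ^+ o.+1 %| \det ((\matrix_(k < p) t k) *m map_mx polyC E)) ->
      m%:R * (T - 1) - tau0%:R < o%:R.
Proof.
have [c2 Hc2] := bounded_package r0 Phi_ccont uPhi.
(* The functions [z ^+ e * Phi z k l] with [e <= c2] span all entries of [Mt *m Phi *m Cy], whatever
   [Mt] of the bounded degree. *)
pose J := ('I_q * 'I_q * 'I_c2.+1)%type.
pose u (n : 'I_#|{: J}|) z : C :=
  z ^+ (enum_val n).2 * Phi z (enum_val n).1.1 (enum_val n).1.2.
have [tau0 Htau] := det_flat u q; exists tau0.
move=> t p de c m Cy T tS tp de0 /andP[p0 pq] tf HL HT.
have [E dE] := col_selection tf; exists E => //.
have [s [Cz [qE rC] HCz]] := rel_kernel tS tp de0 p0 dE.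
set tm := \matrix_(k < p) t k in dE tf *.
pose Rel V := forall j z, slitdisk r z -> rdot V (fun z => Phi z *m col j Cz) z = 0.
have RelE V : Rel V -> forall z, slitdisk r z -> V^@z *m (Phi z *m Cz) = 0.
  move=> H z Dz; apply/rowP => j; rewrite [RHS]mxE -(H j z Dz) rdot_mx colE !mulmxA.
  by rewrite -colE [RHS]mxE.
have RelT V : Rel V -> Rel (Trow a At V).
  by move=> H j; apply: rdot_Trow0 => // z; exact: H.
have Rel0 : Rel (t 0%N).
  by move=> j; apply/HCz; exists (delta_mx j 0); rewrite colE.
have Relt k : Rel (t k) by elim: k => // k IH; rewrite tS; exact: RelT.
have RelV es : Rel (oprs a b kp At es (t 0%N)).
  elim: es => //= e es IH j z Dz; rewrite /opr -scaleNr rdotD rdotZ IH // mulr0 addr0.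
  exact: RelT.
have [|dd [Mt [dd0 sM HM]]] := Hc2 p s Cz tm E qE rC dE.
  by move=> k z Dz; rewrite rowK; exact: RelE.
have {HM} HM V : Rel V -> forall z, dd.[z] *: V^@z = (V *m map_mx polyC E)^@z *m Mt^@z.
  move=> HV z; have := congr1 (map_mx (horner_eval z)) (HM V (RelE V HV)).
  by rewrite map_mxZ map_mxM.
pose Psi z := Mt^@z *m Phi z *m Cy.
have sYm (y : 'cV[C]_m) : psol a At r (fun z => (Phi z *m Cy) *m y).
  by have := sPhi (Cy *m y); congr psol; apply/funext => z; rewrite mulmxA.
have [B1|v [sg [qs [dl [Htri _]]]]] := @stage R q m a b kp At r r0 a0 aE b0 (fun z => Phi z *m Cy)
   (t 0%N) sYm m 1%:M.
  by move=> y0; rewrite mul1mx; exact: HL.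
have nflat := triangular_not_flat r0 a0 aE sYm Htri.
pose V l := oprs a b kp At (qs l) (t 0%N).
pose Vm : 'M[C]_m := \matrix_(i, j) v j i 0.
pose W z : 'M[C]_(m, p) := \matrix_(l, k) ((V l *m map_mx polyC E) 0 k).[z].
(* The rows produced by the operators still annihilate the relation space, so they too are recovered
   from their product with [E]; this brings the same factor [Psi] into the determinant known not to
   be flat. *)
have key z : dd.[z] *: (\matrix_(l, j) comb (fun z => Phi z *m Cy) (V l) (v j) z) =
    W z *m Psi z *m Vm.
  apply/row_matrixP => l; rewrite 2!row_mul; apply/rowP => j.
  have -> : row l (W z) = (V l *m map_mx polyC E)^@z by apply/rowP => k; rewrite !mxE.
  rewrite /Psi -!mulmxA mulmxA -HM; last exact: RelV.
  rewrite -scalemxAl [RHS]mxE [LHS]mxE [LHS]mxE; congr (_ * _).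
  rewrite mxE /comb rdot_mx !mulmxA [LHS]mxE [RHS]mxE; apply: eq_bigr => i _.
  by rewrite [Vm i j]mxE.
have [f Hf] : exists f : {ffun 'I_m -> 'I_p}, ~ flat (fun z => \det (rowsub f (Psi z))).
  apply: contrapT => /forallNP H; apply: nflat => k.
  have fl : flat (fun z => \det (W z *m Psi z)).
    apply: (@flat_ext (fun z => \sum_(f : {ffun 'I_m -> 'I_p}) (\prod_i W z i (f i)) *
       \det (rowsub f (Psi z)))); first by move=> z; rewrite det_mul_expand.
    apply: flat_sum => f _; apply: flatM; last exact: contrapT (H f).
    have -> : 0 = \sum_(i < m) (0 : R) by rewrite big1.
    apply: Oray_prod => i; apply: Oray_ext (Oray_poly ((V i *m map_mx polyC E) 0 (f i))) => x _.
    by rewrite [RHS]mxE.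
  (* All polynomial factors between the two determinants; dividing by a fixed polynomial preserves
     flatness. *)
  pose Dm := dd ^+ m * \prod_l 'X ^+ (kp * size (qs l)); pose o := size Dm.
  have Dm0 : Dm != 0.
    by rewrite mulf_neq0 ?expf_neq0 //; apply/prodf_neq0 => l _; rewrite expf_neq0 ?polyX_eq0.
  have := @Oray_div R (k + o)%:R Dm o _ (not_dvd_Xn Dm0) _.
  rewrite natrD addrK; apply.
  have flo := fl (k + o)%N; rewrite natrD in flo.
  apply: Oray_ext (OrayZ (\det Vm) flo) => x x0; set z := x%:C%C.
  have z0 : z != 0 by rewrite -cabs_gt0 cabsR gtr0_norm.
  rewrite mulrC -det_mulmx -key detZ hornerM horner_exp -mulrA; congr (_ * _).
  rewrite horner_prod (_ : \prod_l _ = \det (diag_mx (\row_l ('X ^+ (kp * size (qs l))).[z]))) -?det_mulmx ?mul_diag_mx; last first.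
    by rewrite det_diag; apply: eq_bigr => l _; rewrite mxE.
  rewrite ?mul_diag_mx; congr (\det _).
  apply/matrixP => l j; rewrite !mxE hornerXn /combd mulrC divfK // expf_neq0 //.
have fi : injective f.
  move=> i j fij; apply/eqP; apply: contrapT => /negP ij; apply: Hf => k.
  apply: Oray_ext (Oray0 _) => x _; apply/esym.
  by apply: (determinant_alternate ij) => l; rewrite !mxE fij.
have mp : (m <= p)%N by have := leq_card f fi; rewrite !card_ord.
have nO : ~ Oray tau0%:R (fun z => \det (rowsub f (Psi z))).
  move=> HO; apply: Hf.
  pose cf (i j : 'I_m) (n : 'I_#|{: J}|) : C :=
    (Mt (f i) (enum_val n).1.1)`_(enum_val n).2 * Cy (enum_val n).1.2 j.
  have E1 z : \det (rowsub f (Psi z)) = \det (\matrix_(i, j) \sum_k cf i j k * u k z).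
    congr (\det _); apply/matrixP => i j; rewrite mxE [RHS]mxE sum_enum_pair.
    have -> : \sum_kl \sum_e cf i j (enum_rank (kl, e)) * u (enum_rank (kl, e)) z =
        \sum_k \sum_l \sum_e cf i j (enum_rank ((k, l), e)) * u (enum_rank ((k, l), e)) z.
      by rewrite [RHS]pair_bigA /=; apply: eq_bigr => -[k l].
    rewrite exchange_big mxE; apply: eq_bigr => l _; rewrite mxE mulr_suml; apply: eq_bigr => k _.
    rewrite mxE /horner_eval (horner_coef_wide _ (sM (f i) k)) !mulr_suml; apply: eq_bigr => e _.
    by rewrite /cf /u enum_rankK /=; ring.
  apply: (@flat_ext (fun z => \det (\matrix_(i, j) \sum_k cf i j k * u k z))).
    by move=> z; rewrite E1.
  by apply: (Htau m (leq_trans mp pq) cf); apply: Oray_ext HO => x _; rewrite E1.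
move=> o no; rewrite ltNge; apply/negP => le; apply: nO.
have {}HT (k : nat) j : Osec (T - 1) (rdot (t k) (fun z => Phi z *m col j Cy)).
  by elim: k => // k IH; rewrite tS; apply: (Osec_Trow r0 a0 aE).
apply: Oray_le (Oray_div no _) => [|{no le o}]; first by rewrite lerBrDl addrC -lerBrDl; exact: le.
have [k pE] : exists k, p = (m + k)%N by exists (p - m)%N; rewrite subnKC.
subst p; have [G [c0 c00 HG]] := @minor_completion C m k f fi.
pose g z := (tm *m map_mx polyC E)^@z *m row_mx (Psi z) G.
(* The first [m] columns are remainders of the rows [t i], up to the factor [dd]; the columns coming
   from [G] are polynomial, of order at least [0]. *)
pose tau (j : 'I_(m + k)) : R := if fintype.split j is inl _ then T - 1 else 0.
have -> : m%:R * (T - 1) = \sum_j tau j.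
  rewrite big_split_ord /= [X in _ = _ + X]big1 ?addr0 => [|j _]; last first.
    by rewrite /tau -[rshift m j]/(unsplit (inr j)) unsplitK.
  under eq_bigr do rewrite /tau -[lshift k _]/(unsplit (inl _)) unsplitK.
  by rewrite sumr_const card_ord mulr_natl.
apply: (@Oray_ext _ _ (fun z => c0 * \det (g z))).
  by move=> x _; rewrite HG /g det_mulmx det_map_mx /horner_eval mulrCA.
apply: OrayZ; apply: Oray_det => i j; rewrite /tau.
case: (split_ordP j) => j' ->.
  have H := OrayM (Oray_poly dd) (Osec_Oray (HT i j')); rewrite add0r in H.
  apply: Oray_ext H => x _; set z := x%:C%C; rewrite /g mul_mx_row row_mxEl.
  have Er : row i ((tm *m map_mx polyC E)^@z *m Psi z) = dd.[z] *: ((t i)^@z *m (Phi z *m Cy)).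
    have rE : row i ((tm *m map_mx polyC E)^@z) = (t i *m map_mx polyC E)^@z.
      by rewrite -map_row row_mul rowK.
    have PE : Psi z = Mt^@z *m (Phi z *m Cy) by rewrite mulmxA.
    rewrite row_mul rE PE (mulmxA _ (Mt^@z)) -HM; last exact: Relt.
    by rewrite -scalemxAl.
  have := congr1 (fun M : 'rV[C]_m => M 0 j') Er; rewrite [LHS]mxE => ->.
  rewrite [RHS]mxE rdot_mx colE !mulmxA -colE; congr (_ * _); by rewrite [LHS]mxE.
apply: Oray_ext (Oray_poly ((tm *m map_mx polyC E *m map_mx polyC G) i j')) => x _.
rewrite /g mul_mx_row row_mxEr [LHS](_ : _ = ((tm *m map_mx polyC E *m map_mx polyC G)^@(x%:C%C)) i j').
  rewrite map_mxM; congr ((_ *m _) i j'); apply/matrixP => l l'; rewrite !mxE.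
  exact: hornerC.
by rewrite [RHS]mxE.
Qed.

End OrderBound.

(** * Common denominator of the system, iterated rows and their degrees *)

Lemma frac_eq (D : idomainType) (n d n' d' : D) : d != 0 -> d' != 0 ->
  tofrac n / tofrac d = tofrac n' / tofrac d' <-> n * d' = n' * d.
Proof.
move=> d0 d'0; have e0 : tofrac d != 0 by rewrite tofrac_eq0.
have e'0 : tofrac d' != 0 by rewrite tofrac_eq0.
split=> [/eqP|H]; last by apply/eqP; rewrite eqr_div // -!tofracM H.
by rewrite eqr_div // -!tofracM tofrac_eq => /eqP.
Qed.

Section SystemData.
Variable R : realType.
Local Notation C := (R[i]).
Local Notation Fz := {fraction {poly C}}.
Hint Extern 0 (is_true (@Order.le _ _ _ (cabs _))) => exact: cabs_ge0 : core.
Implicit Types (n d : {poly C}) (x : Fz).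

Lemma fevalE x n d (z : C) : d.[z] != 0 -> x = tofrac n / tofrac d -> feval x z = n.[z] / d.[z].
Proof.
move=> dz xE; rewrite /feval.
have /xgetPex H : exists v, [set v | exists n d : {poly C},
           [/\ d.[z] != 0, x = tofrac n / tofrac d & v = n.[z] / d.[z]]] v.
  by exists (n.[z] / d.[z]), n, d.
have [n' [d' [d'z xE' ->]]] := H 0.
have nz e : e.[z] != 0 -> e != 0 by apply: contraNneq => ->; rewrite horner0.
move: xE'; rewrite xE => /(frac_eq _ _ (nz _ dz) (nz _ d'z)) E.
by apply/eqP; rewrite eqr_div // -!hornerM E.
Qed.

(** In lowest terms the denominator divides every other one, so it vanishes only where the fraction
    is not regular. *)
Lemma frac_den x : exists n d, [/\ d != 0, x = tofrac n / tofrac d &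
  forall z, fregular x z -> d.[z] != 0].
Proof.
have [n0 [d0 [d00 xE]]] := frac_exists x; pose g := gcdp n0 d0.
have g0 : g != 0 by rewrite gcdp_eq0 negb_and d00 orbT.
pose n := n0 %/ g; pose d := d0 %/ g.
have nE : n0 = n * g by rewrite divpK // dvdp_gcdl.
have dE : d0 = d * g by rewrite divpK // dvdp_gcdr.
have cop : coprimep n d by apply: coprimep_div_gcd; rewrite d00 orbT.
have d0' : d != 0 by apply: contraNneq d00; rewrite dE => ->; rewrite mul0r.
exists n, d; split=> // [|z [n' [d' [d'z xE']]]].
  by rewrite xE; apply/frac_eq => //; rewrite nE dE; ring.
have d'0 : d' != 0 by apply: contraNneq d'z => ->; rewrite horner0.
have /frac_eq E : tofrac n0 / tofrac d0 = tofrac n' / tofrac d' :> Fz by rewrite -xE -xE'.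
have {}E : n * d' = n' * d.
  by apply: (mulIf g0); have := E d00 d'0; rewrite nE dE => E'; rewrite mulrAC E'; ring.
have : d %| d'.
  have cop' : coprimep d n by rewrite coprimep_sym.
  by rewrite -(Gauss_dvdpr _ cop') E dvdp_mull.
move=> /dvdpP[k kE]; apply: contraNneq d'z => dz; rewrite kE hornerM dz mulr0 //.
Qed.

Lemma system_data q (A : 'M[Fz]_q) : exists (a b : {poly C}) (kp : nat) (At : 'M[{poly C}]_q),
  [/\ a = 'X * ('X ^+ kp * b), b.[0] != 0, forall i j, A i j = tofrac (At i j) / tofrac a &
   forall z, z != 0 -> ~ singular A z -> a.[z] != 0].
Proof.
have /choice[nn H1] : forall ij : 'I_q * 'I_q, exists n d, [/\ d != 0,
  A ij.1 ij.2 = tofrac n / tofrac d & forall z, fregular (A ij.1 ij.2) z -> d.[z] != 0].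
  by move=> ij; exact: frac_den.
have /choice[dd {}H1] := H1.
pose a1 := \prod_ij dd ij.
have a10 : a1 != 0 by apply/prodf_neq0 => ij _; have [] := H1 ij.
have [kp [b [n0 bE]]] := multiplicity_XsubC a1 0.
(* The additional factor ['X] makes [a * d/dz] a polynomial multiple of [z * d/dz] even when [0] is
   an ordinary point, and adds no zero outside [0]. *)
exists ('X * a1), b, kp, (\matrix_(i, j) (nn (i, j) * ('X * \prod_(kl | kl != (i, j)) dd kl))).
split=> [|||z z0 sz].
- by rewrite bE subr0 [b * _]mulrC.
- by move: n0; rewrite a10.
- move=> i j; have [d0 AE _] := H1 (i, j); rewrite -[A i j]/(A (i, j).1 (i, j).2) AE.
  apply/frac_eq => //; first by rewrite mulf_neq0 ?polyX_eq0.
  by rewrite mxE /a1 (bigD1 (i, j)) //=; ring.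
rewrite hornerM hornerX mulf_neq0 // horner_prod; apply/prodf_neq0 => -[i j] _.
have [_ _ H] := H1 (i, j); apply: H; apply: contrapT => nr; apply: sz.
by exists i, j.
Qed.

Lemma punctured_radius (a : {poly C}) : a != 0 ->
  exists2 rho : R, 0 < rho & forall z, 0 < cabs z < rho -> a.[z] != 0.
Proof.
move=> /poly_roots[s Hs].
suff [rho rho0 H] : exists2 rho : R, 0 < rho & forall z, z \in s -> z != 0 -> rho <= cabs z.
  exists rho => // z /andP[z0 zr]; apply: contraTneq zr => az; rewrite -leNgt; apply: H.
    by rewrite -Hs /root ?az.
  by rewrite -cabs_gt0.
elim: {Hs} s => [|y s [rho rho0 H]]; first by exists 1.
have [->|y0] := eqVneq y 0.
  by exists rho => // z; rewrite inE => /predU1P[->|/H //]; rewrite eqxx.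
exists (Num.min rho (cabs y)); first by rewrite lt_min rho0 cabs_gt0.
move=> z; rewrite inE => /predU1P[->|zs] z0; first by rewrite ge_min lexx orbT.
by rewrite ge_min H.
Qed.

(** [fderiv] is defined on a chosen representative; differentiating the cross-multiplied equality
    shows that the choice is irrelevant. *)
Lemma fderivE n d : d != 0 ->
  fderiv (tofrac n / tofrac d) = tofrac (deriv n * d - n * deriv d) / tofrac (d * d).
Proof.
move=> d0; rewrite /fderiv; set y := generic_quotient.repr _.
have d0' : y.2 != 0 := denom_ratioP y.
have /frac_eq E : tofrac n / tofrac d = tofrac y.1 / tofrac y.2 :> Fz by rewrite -fracE.
have {}E := E d0 d0'; have E' := congr1 (@deriv C) E; rewrite !derivM in E'.
apply/frac_eq; rewrite ?mulf_neq0 //.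
have gen (S : comNzRingType) (u v u' v' w e w' e' : S) : u * e = w * v ->
  u' * e + u * e' = w' * v + w * v' ->
  (w' * e - w * e') * (v * v) = (u' * v - u * v') * (e * e).
  move=> h1 h2; apply/eqP; rewrite -subr_eq0; apply/eqP.
  have -> : (w' * e - w * e') * (v * v) - (u' * v - u * v') * (e * e) =
    e * v * (w' * v + w * v' - (u' * e + u * e')) - (w * v - u * e) * (v * e' + e * v') by ring.
  by rewrite h1 h2 !subrr mulr0 mul0r subr0.
exact: gen.
Qed.

(** The numerator of [Pk] over [a ^+ k]: differentiating the denominator [a ^+ k] produces the
    correction by [k * deriv a]. *)
Fixpoint prow q (a : {poly C}) (At : 'M[{poly C}]_q) (v : 'rV[{poly C}]_q) k : 'rV[{poly C}]_q :=
  if k is k'.+1 then Trow a At (prow a At v k') - (k'%:R * deriv a) *: prow a At v k' else v.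

Lemma Pk_prow q (A : 'M[Fz]_q) a (At : 'M[{poly C}]_q) (P : 'I_q -> {poly C}) k i : a != 0 ->
  (forall i j, A i j = tofrac (At i j) / tofrac a) ->
  Pk A P k i ord0 = tofrac (prow a At (\row_i P i) k 0 i) / tofrac (a ^+ k).
Proof.
move=> a0 AE; elim: k i => [|k IH] i /=; first by rewrite !mxE expr0 tofrac1 divr1.
rewrite [LHS]mxE [X in X + _]mxE IH fderivE ?expf_neq0 // [X in _ + X]mxE.
set p := prow _ _ _ k.
have -> : \sum_j A^T i j * Pk A P k j ord0 = tofrac ((p *m At) 0 i) / tofrac (a ^+ k.+1).
  rewrite mxE rmorph_sum mulr_suml; apply: eq_bigr => j _; rewrite mxE AE IH mulf_div -!tofracM.
  by rewrite -exprS [At j i * _]mulrC.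
have dak : a * deriv (a ^+ k) = k%:R * deriv a * a ^+ k.
  rewrite deriv_exp; case: k {IH p} => [|k]; first by rewrite mulr0n mulr0 mul0r mul0r.
  by rewrite -mulr_natl exprS /=; ring.
have -> : tofrac (deriv (p 0 i) * a ^+ k - p 0 i * deriv (a ^+ k)) / tofrac (a ^+ k * a ^+ k) =
   tofrac (a * deriv (p 0 i) - k%:R * deriv a * p 0 i) / tofrac (a ^+ k.+1) :> Fz.
  apply/frac_eq; rewrite ?mulf_neq0 ?expf_neq0 // exprS.
  have gen (S : comNzRingType) (x u u' X X' c : S) : x * X' = c * X ->
    (u' * X - u * X') * (x * X) = (x * u' - c * u) * (X * X).
    move=> h; have -> : (u' * X - u * X') * (x * X) = u' * x * X * X - u * (x * X') * X by ring.
    by rewrite h; ring.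
  exact: gen dak.
rewrite -mulrDl -rmorphD; congr (tofrac _ / _); rewrite [in RHS]mxE /Trow.
have -> : (- ((k%:R * deriv a) *: p)) 0 i = - (k%:R * deriv a * p 0 i) by rewrite !mxE.
have -> : (a *: map_mx (@deriv _) p + p *m At) 0 i = a * deriv (p 0 i) + (p *m At) 0 i.
  by rewrite [LHS]mxE; congr (_ + _); rewrite !mxE.
by rewrite addrAC.
Qed.

(** The two recursions differ by a multiple of the previous row, so each iterate of [Trow] is a
    polynomial combination of the numerators up to the same index. A vector killed by all numerators
    at a point is killed by the rows [t k] there. *)
Lemma Trow_span q (a : {poly C}) (At : 'M[{poly C}]_q) (t : nat -> 'rV[{poly C}]_q) k :
  (forall k, t k.+1 = Trow a At (t k)) ->
  exists g : nat -> {poly C}, t k = \sum_(j < k.+1) g j *: prow a At (t 0%N) j.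
Proof.
move=> tS; elim: k => [|k [g gE]].
  by exists (fun=> 1); rewrite big_ord_recl big_ord0 addr0 scale1r.
set p := prow a At (t 0%N) in gE *.
exists (fun j => (if (j <= k)%N then a * deriv (g j) + g j * (j%:R * deriv a) else 0) +
   (if j is j'.+1 then g j' else 0)).
have TD (I : Type) (s : seq I) (f : I -> 'rV[{poly C}]_q) :
    Trow a At (\sum_(i <- s) f i) = \sum_(i <- s) Trow a At (f i).
  rewrite /Trow big_split /= -scaler_sumr mulmx_suml; congr (a *: _ + _).
  elim: s => [|i s IH]; first by rewrite !big_nil; apply/rowP => l; rewrite !mxE deriv0.
  by rewrite !big_cons -IH; apply/rowP => l; rewrite !mxE derivD.
have TZ (f : {poly C}) j : Trow a At (f *: p j) =
    (a * deriv f + f * (j%:R * deriv a)) *: p j + f *: p j.+1.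
  rewrite /p /= -/p scalerDl -addrA; apply/rowP => l; rewrite /Trow -scalemxAl !mxE derivM.
  set u := \sum_j0 _; ring.
rewrite tS gE TD; under eq_bigr do rewrite TZ.
rewrite big_split /=.
under [RHS]eq_bigr do rewrite scalerDl.
rewrite [RHS]big_split /=; congr (_ + _).
  rewrite [RHS]big_ord_recr /= ltnn scale0r addr0; apply: eq_bigr => j _.
  by rewrite -ltnS ltn_ord.
by rewrite [RHS]big_ord_recl /= scale0r add0r; apply: eq_bigr => j _.
Qed.

Lemma size_Trow q (a : {poly C}) (At : 'M[{poly C}]_q) (t : nat -> 'rV[{poly C}]_q) c0 (n0 : nat) :
  (forall k, t k.+1 = Trow a At (t k)) -> (size a <= c0.+1)%N ->
  (forall i j, (size (At i j) <= c0.+1)%N) -> (forall i, (size (t 0%N 0%R i) <= n0.+1)%N) ->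
  forall k i, (size (t k 0%R i) <= (n0 + k * c0).+1)%N.
Proof.
move=> tS sa sA s0; elim=> [|k IH] i; first by rewrite mul0n addn0.
have le : ((n0 + k * c0) + c0 = n0 + k.+1 * c0)%N by rewrite mulSn -addnA [(_ * _ + _)%N]addnC.
rewrite tS !mxE; apply: leq_trans (size_polyD _ _) _; rewrite geq_max; apply/andP; split.
  rewrite mulrC -le; apply: size_mul_bound => //.
  have [->|f0] := eqVneq (t k 0 i) 0; first by rewrite deriv0 size_poly0.
  exact: leq_trans (ltnW (lt_size_deriv f0)) (IH i).
by apply: size_sum_bound => j _; rewrite -le; exact: size_mul_bound.
Qed.

End SystemData.

(** * Solution spaces on different disks and their dimensions *)

Section Solutions.
Variable R : realType.
Local Notation C := (R[i]).
Hint Extern 0 (is_true (@Order.le _ _ _ (cabs _))) => exact: cabs_ge0 : core.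
Variables (q : nat) (A : 'M[{fraction {poly C}}]_q) (a : {poly C}) (At : 'M[{poly C}]_q).
Hypothesis AE : forall i j, A i j = tofrac (At i j) / tofrac a.

Lemma psol_le (r r' : R) (Y : C -> 'cV[C]_q) : r' <= r -> psol a At r Y -> psol a At r' Y.
Proof. by move=> rr sY z Dz; apply: sY; exact: slitdisk_le Dz. Qed.

Lemma is_sol_psol (r : R) Y : (forall z, slitdisk r z -> a.[z] != 0) ->
  is_sol A (slitdisk r) Y -> psol a At r Y.
Proof.
move=> a0 [_ sY] z Dz i; have [dY eY] := sY z Dz i.
have := cdiff_derivable dY; rewrite eY; congr cdiff; apply: eq_bigr => j _.
by rewrite (fevalE (a0 z Dz) (AE i j)).
Qed.

Lemma psol_is_sol (r : R) Y : (forall z, slitdisk r z -> a.[z] != 0) ->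
  psol a At r Y -> (forall z, ~ slitdisk r z -> Y z = 0) -> is_sol A (slitdisk r) Y.
Proof.
move=> a0 sY Y0; split=> // z Dz i; have [d1 d2] := is_derive_cdiff (sY z Dz i).
split; first exact: d1.
rewrite [LHS]d2; apply: eq_bigr => j _.
by rewrite (fevalE (a0 z Dz) (AE i j)).
Qed.

(** On the small disk all rows [t k] vanish on [Y]; one point with [de] non-zero is enough for
    [rdot_kernel] to spread the vanishing to the larger disk. *)
Lemma rdot_continue (r r1 : R) (t : nat -> 'rV[{poly C}]_q) p (de : {poly C}) (c : 'I_p -> {poly C}) Y :
  (forall z, slitdisk r z -> a.[z] != 0) -> 0 < r1 <= r ->
  (forall k, t k.+1 = Trow a At (t k)) -> de *: t p = \sum_k c k *: t k -> de != 0 -> (0 < p)%N ->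
  psol a At r Y -> (forall z, slitdisk r1 z -> rdot (t 0%N) Y z = 0) ->
  forall z, slitdisk r z -> rdot (t 0%N) Y z = 0.
Proof.
move=> a0 /andP[r10 r1r] tS tp de0 p0 sY H.
have [x /andP[x0 xr1] dex] := poly_nonroot de0 r10.
have a01 z : slitdisk r1 z -> a.[z] != 0 by move=> /(slitdisk_le r1r); exact: a0.
have Hk n : forall z, slitdisk r1 z -> rdot (t n) Y z = 0.
  by elim: n => // n IH; rewrite tS; apply: (rdot_Trow0 a01) => //; exact: psol_le sY.
have xr : 0 < x < r by rewrite x0 (lt_le_trans xr1).
have HK := @rdot_kernel R q a At r a0 t p de c Y x tS tp xr dex sY.
by apply: HK => // k; apply: Hk; apply: slitdisk_pos; rewrite x0.
Qed.

(** Either radius may be the larger. A second fundamental matrix on the disk of radius [r],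
    normalised at a point common to both disks, labels each solution by the coordinates it has with
    respect to [Phi]. *)
Lemma sol_param (r rho : R) (Phi : C -> 'M[C]_q) : 0 < r -> 0 < rho ->
  (forall z, slitdisk r z -> a.[z] != 0) -> (forall z, slitdisk rho z -> a.[z] != 0) ->
  (forall c : 'cV[C]_q, psol a At rho (fun z => Phi z *m c)) ->
  (forall z, slitdisk rho z -> Phi z \in unitmx) ->
  exists Sol : 'cV[C]_q -> C -> 'cV[C]_q,
  [/\ forall c, is_sol A (slitdisk r) (Sol c),
      forall c z, slitdisk (Num.min r rho) z -> Sol c z = Phi z *m c,
      forall Y, is_sol A (slitdisk r) Y -> exists c, Y = Sol c,
      forall k c c' z, Sol (k *: c + c') z = k *: Sol c z + Sol c' z &
      forall c, (forall z, Sol c z = 0) -> c = 0].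
Proof.
move=> r0 rho0 ar arho sPhi uPhi; set r1 := Num.min r rho.
have r10 : 0 < r1 by rewrite lt_min r0.
have r1r : r1 <= r by rewrite ge_min lexx.
have r1rho : r1 <= rho by rewrite ge_min lexx orbT.
have x0r1 : 0 < r1 / 2 < r1 by apply/andP; split; lra.
have x0r : 0 < r1 / 2 < r by apply/andP; split; lra.
have x0rho : 0 < r1 / 2 < rho by apply/andP; split; lra.
set x0 := r1 / 2 in x0r1 x0r x0rho.
have [Phir [P1 Ps Pu]] := @fund_exists R q a At r ar x0 x0r.
have a1 z : slitdisk r1 z -> a.[z] != 0 by move=> /(slitdisk_le r1r); exact: ar.
pose Sol (c : 'cV[C]_q) z : 'cV[C]_q :=
  if pselect (slitdisk r z) then Phir z *m (Phi x0%:C%C *m c) else 0.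
have SolD c z : slitdisk r z -> Sol c z = Phir z *m (Phi x0%:C%C *m c).
  by rewrite /Sol; case: pselect.
have Sol0 c z : ~ slitdisk r z -> Sol c z = 0 by rewrite /Sol; case: pselect.
have sSol c : psol a At r (Sol c).
  move=> z Dz i; have [e e0 He] := slitdisk_open Dz.
  have := cdiff_ext _ (Ps (Phi x0%:C%C *m c) z Dz i); rewrite SolD //; apply.
  by exists e => // h he; rewrite SolD //; exact: He.
have Dx0 : slitdisk r x0%:C%C by exact: slitdisk_pos.
have ux0 : Phi x0%:C%C \in unitmx by apply: uPhi; exact: slitdisk_pos.
have Solx0 c : Sol c x0%:C%C = Phi x0%:C%C *m c by rewrite SolD // P1 mul1mx.
exists Sol; split=> [c|c z Dz|Y sY|k c c' z|c H].
- by apply: psol_is_sol => // z; exact: Sol0.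
- have sW := psol_lin (-1) (psol_le r1rho (sPhi c)) (psol_le r1r (sSol c)).
  have := @psol_unique R q a At r1 a1 _ x0 x0r1 sW _ z Dz.
  by rewrite Solx0 !scaleN1r addNr => /(_ erefl)/eqP; rewrite addrC subr_eq0 => /eqP.
- have pY := is_sol_psol ar sY; exists (invmx (Phi x0%:C%C) *m Y x0%:C%C).
  set c := invmx _ *m _; have sW := psol_lin (-1) (sSol c) pY.
  apply/funext => z; case: (pselect (slitdisk r z)) => Dz; last first.
    by rewrite Sol0 //; have [-> //] := sY.
  have := @psol_unique R q a At r ar _ x0 x0r sW _ z Dz.
  rewrite Solx0 mulmxA mulmxV // mul1mx !scaleN1r addNr => /(_ erefl)/eqP.
  by rewrite addrC subr_eq0 => /eqP.
- case: (pselect (slitdisk r z)) => Dz; last by rewrite !Sol0 // scaler0 addr0.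
  by rewrite !SolD // !mulmxDr -!scalemxAr.
by have := H x0%:C%C; rewrite Solx0 => /(congr1 (mulmx (invmx (Phi x0%:C%C)))); rewrite mulmxA mulVmx // mul1mx mulmx0.
Qed.

Variable Sol : 'cV[C]_q -> C -> 'cV[C]_q.
Hypothesis Slin : forall k c c' z, Sol (k *: c + c') z = k *: Sol c z + Sol c' z.
Hypothesis Sinj : forall c, (forall z, Sol c z = 0) -> c = 0.

Lemma Sol0E z : Sol 0 z = 0.
Proof. by have := Slin (-1) 0 0 z; rewrite scaler0 addr0 scaleN1r addNr. Qed.

Lemma Sol_mul n (u : 'rV[C]_n) (M : 'M[C]_(n, q)) z :
  Sol (u *m M)^T z = \sum_j u 0 j *: Sol (row j M)^T z.
Proof.
rewrite mulmx_sum_row raddf_sum /=.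
elim: (index_enum _) => [|j s IH]; first by rewrite !big_nil Sol0E.
by rewrite !big_cons linearZ /= Slin IH.
Qed.

Lemma Sol_tr_inj (v v' : 'rV[C]_q) : (forall z, Sol v^T z = Sol v'^T z) -> v = v'.
Proof.
move=> H; have : (-1) *: v^T + v'^T = 0.
  by apply: Sinj => z; rewrite Slin H scaleN1r addNr.
by rewrite scaleN1r addrC => /eqP; rewrite subr_eq0 => /eqP/trmx_inj.
Qed.

Variable V : set (C -> 'cV[C]_q).
Hypothesis VS : forall Y, V Y -> exists c, Y = Sol c.

Lemma dim_exists n (M : 'M[C]_(n, q)) : (forall v : 'rV[C]_q, V (Sol v^T) <-> (v <= M)%MS) ->
  has_dim V (\rank M).
Proof.
move=> HM; exists (fun j => Sol (row j (row_base M))^T); split=> [j|c Hc j|Y VY].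
- by apply/HM; rewrite (submx_trans (row_sub _ _)) // eq_row_base.
- have : (\row_j c j) *m row_base M = 0.
    apply: Sol_tr_inj => z; rewrite Sol_mul trmx0 Sol0E -[RHS](Hc z).
    by apply: eq_bigr => l _; rewrite mxE.
  rewrite -[0 in RHS](mul0mx _ (row_base M)) => /(row_free_inj (row_base_free M)) /rowP/(_ j).
  by rewrite !mxE.
have [y yE] := VS VY; have : (y^T <= row_base M)%MS.
  by rewrite eq_row_base; apply/HM; rewrite trmxK -yE.
move=> /submxP[u uE]; exists (fun j => u 0 j) => z.
by rewrite -Sol_mul -uE trmxK yE.
Qed.

Lemma dim_unique n (M : 'M[C]_(n, q)) k : (forall v : 'rV[C]_q, V (Sol v^T) <-> (v <= M)%MS) ->
  has_dim V k -> k = \rank M.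
Proof.
move=> HM [B [VB Bi Bs]].
have /choice[y yE] : forall j, exists y, B j = Sol y by move=> j; exact: VS.
pose N : 'M[C]_(k, q) := \matrix_j (y j)^T.
have NE u z : Sol (u *m N)^T z = \sum_j u 0 j *: B j z.
  by rewrite Sol_mul; apply: eq_bigr => j _; rewrite rowK trmxK yE.
have Nf : row_free N.
  apply: inj_row_free => u uN; apply/rowP => j; rewrite mxE; apply: (Bi (fun j => u 0 j)) => z.
  by rewrite -NE uN trmx0 Sol0E.
have NM : (N :=: M)%MS.
  apply/eqmxP; apply/andP; split.
    by apply/row_subP => j; apply/HM; rewrite rowK trmxK -yE.
  apply/row_subP => i; have /HM/Bs[c cE] : (row i M <= M)%MS by exact: row_sub.
  apply/submxP; exists (\row_j c j); apply: Sol_tr_inj => z; rewrite NE cE.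
  by apply: eq_bigr => j _; rewrite mxE.
by rewrite -NM; apply/esym/eqP.
Qed.

End Solutions.

(** * Multiplicities against degree, and the final inequalities *)

Section Numeric.
Variable R : realType.
Local Notation C := (R[i]).

Lemma mult_bound (D : {poly C}) (al : C) : D != 0 -> al != 0 -> exists o mu : nat,
  [/\ ~~ ('X ^+ o.+1 %| D), ~~ (('X - al%:P) ^+ mu.+1 %| D) & (o + mu < size D)%N].
Proof.
move=> D0 al0.
have [k [Q [Q0 DE]]] := multiplicity_XsubC D 0; rewrite D0 /= subr0 in Q0 DE.
have Qn : Q != 0 by apply: contraNneq Q0 => ->; rewrite root0.
have [mu [Q' [Q'0 QE]]] := multiplicity_XsubC Q al; rewrite Qn /= in Q'0.
have Q'n : Q' != 0 by apply: contraNneq Q'0 => ->; rewrite root0.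
exists k, mu; split.
- rewrite DE exprS dvdp_mul2r ?expf_neq0 ?polyX_eq0 //.
  by rewrite -['X]subr0 -[0]/(0%:P) dvdp_XsubCl.
- rewrite DE QE mulrAC exprS dvdp_mul2r ?expf_neq0 ?polyXsubC_eq0 // dvdp_XsubCl rootM negb_or Q'0.
  by rewrite rootE hornerXn expf_neq0.
rewrite DE QE size_Mmonic ?monicXn //; last by rewrite mulf_neq0 ?expf_neq0 ?polyXsubC_eq0.
rewrite size_Mmonic ?monic_exp ?monicXsubC // size_exp_XsubC size_polyXn.
have : (0 < size Q')%N by rewrite size_poly_gt0.
by move: (size Q') => j; lia.
Qed.

(** Integrality turns [p * dF < m * q] into a surplus of [n] after multiplication by [n], while
    [m * eps <= q / (q + 1)]. What remains is [n / (q + 1)], bounded by terms independent of [n]. *)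
Lemma numeric_lt (n q p m dF tau0 c0 o : nat) (w eps : R) : 0 <= w -> 0 <= eps ->
  eps <= q.+1%:R^-1 -> (0 < dF <= q)%N -> (p <= q)%N -> (m <= q)%N -> (p * dF < m * q)%N ->
  m%:R * ((q%:R - eps) * n%:R / dF%:R - w - 1) - tau0%:R < o%:R ->
  (o <= p * (n + q * c0))%N ->
  n%:R <= q.+1%:R * (q%:R ^+ 2 * (w + 1) + tau0%:R * q%:R + q%:R ^+ 3 * c0%:R).
Proof.
move=> w0 e0 e1 /andP[d0 dq] pq mq pm H1 H2.
have D0 : 0 < dF%:R :> R by rewrite ltr0n.
have Q0 : 0 < q.+1%:R :> R by rewrite ltr0n.
have H2' : o%:R <= p%:R * (n%:R + q%:R * c0%:R) :> R.
  by rewrite -natrM -natrD -natrM ler_nat.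
have H3 : p%:R * dF%:R + 1 <= m%:R * q%:R :> R by rewrite -!natrM natr1 ler_nat.
have nn : 0 <= n%:R :> R by [].
have dq' : dF%:R <= q%:R :> R by rewrite ler_nat.
have pq' : p%:R <= q%:R :> R by rewrite ler_nat.
have mq' : m%:R <= q%:R :> R by rewrite ler_nat.
have qS : q.+1%:R = q%:R + 1 :> R by rewrite natr1.
have t0 : 0 <= tau0%:R :> R by [].
have cc0 : 0 <= c0%:R :> R by [].
have qq0 : 0 <= q%:R :> R by [].
have pp0 : 0 <= p%:R :> R by [].
have mm0 : 0 <= m%:R :> R by [].
have H4 : m%:R * eps <= q%:R / q.+1%:R by apply: ler_pM.
have H5 := lt_le_trans H1 H2'.
rewrite -(ltr_pM2r D0) in H5.
have E5 : (m%:R * ((q%:R - eps) * n%:R / dF%:R - w - 1) - tau0%:R) * dF%:R =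
   (m%:R * q%:R) * n%:R - (m%:R * eps) * n%:R - m%:R * dF%:R * (w + 1) - tau0%:R * dF%:R.
  by field; exact: lt0r_neq0.
rewrite E5 in H5.
have H6 := ler_wpM2r nn H3; have H7 := ler_wpM2r nn H4.
have w1 : 0 <= w + 1 by lra.
have H8 : m%:R * dF%:R * (w + 1) <= q%:R ^+ 2 * (w + 1).
  by rewrite ler_wpM2r // expr2 ler_pM.
have H9 : tau0%:R * dF%:R <= tau0%:R * q%:R :> R by rewrite ler_wpM2l.
have H10 : p%:R * (q%:R * c0%:R) * dF%:R <= q%:R ^+ 3 * c0%:R :> R.
  have -> : q%:R ^+ 3 * c0%:R = q%:R * (q%:R * c0%:R) * q%:R :> R by ring.
  by rewrite ler_pM ?mulr_ge0 // ler_wpM2r ?mulr_ge0.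
have H11 : n%:R - q%:R / q.+1%:R * n%:R <= q%:R ^+ 2 * (w + 1) + tau0%:R * q%:R + q%:R ^+ 3 * c0%:R.
  have gen (x y p' m' d t c iq e w' : R) : m' * y * x - m' * e * x - m' * d * (w' + 1) - t * d <
      p' * (x + y * c) * d -> (p' * d + 1) * x <= m' * y * x -> m' * e * x <= y * iq * x ->
      m' * d * (w' + 1) <= y ^+ 2 * (w' + 1) -> t * d <= t * y -> p' * (y * c) * d <= y ^+ 3 * c ->
      x - y * iq * x <= y ^+ 2 * (w' + 1) + t * y + y ^+ 3 * c by lra.
  exact: gen H5 H6 H7 H8 H9 H10.
rewrite -[leLHS](_ : q.+1%:R * (n%:R - q%:R / q.+1%:R * n%:R) = n%:R).
  by rewrite ler_wpM2l // ltW.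
by rewrite {1}qS; move: Q0; rewrite qS => Q0; field; exact: lt0r_neq0.
Qed.

Lemma numeric_eq (n q dF tau0 c0 o mu : nat) (w eps : R) : 0 <= w -> (0 < dF <= q)%N ->
  dF%:R * ((q%:R - eps) * n%:R / dF%:R - w - 1) - tau0%:R < o%:R ->
  (o + mu <= q * (n + q * c0))%N ->
  mu%:R < eps * n%:R + q%:R ^+ 2 * c0%:R + q%:R * (w + 1) + tau0%:R.
Proof.
move=> w0 /andP[d0 dq] H1 H2.
have D0 : 0 < dF%:R :> R by rewrite ltr0n.
have H2' : o%:R + mu%:R <= q%:R * (n%:R + q%:R * c0%:R) :> R.
  by rewrite -!natrM -!natrD -natrM ler_nat.
have E : dF%:R * ((q%:R - eps) * n%:R / dF%:R - w - 1) = (q%:R - eps) * n%:R - dF%:R * (w + 1).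
  by field; exact: lt0r_neq0.
rewrite E in H1.
have w1 : 0 <= w + 1 by lra.
have H3 : dF%:R * (w + 1) <= q%:R * (w + 1) by rewrite ler_wpM2r // ler_nat.
have -> : q%:R ^+ 2 * c0%:R = q%:R * (q%:R * c0%:R) :> R by ring.
move: H1 H2'; rewrite mulrBl mulrDr; lra.
Qed.

End Numeric.

(** * Rank at a regular point and the final assembly *)

Section ZeroEstimate.
Variable R : realType.
Local Notation C := (R[i]).
Hint Extern 0 (is_true (@Order.le _ _ _ (cabs _))) => exact: cabs_ge0 : core.

(** A vector in the left kernel is killed by the numerators [prow] at [al], since [a] is non-zero
    there; by [Trow_span] it is killed by the rows [t k], and [Trow_rank] applies. *)
Lemma Pmat_rank q (A : 'M[{fraction {poly C}}]_q) a (At : 'M[{poly C}]_q) (P : 'I_q -> {poly C})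
    (t : nat -> 'rV[{poly C}]_q) (al : C) mu m :
  (forall i j, A i j = tofrac (At i j) / tofrac a) -> a.[al] != 0 ->
  t 0%N = \row_i P i -> (forall k, t k.+1 = Trow a At (t k)) ->
  ~~ (('X - al%:P) ^+ mu.+1 %| \det (\matrix_(i < q) t i)) -> (q + mu <= m)%N ->
  \rank (Pmat A P m al) = q.
Proof.
move=> AE aal t0 tS ndv qm.
have a0 : a != 0 by apply: contraNneq aal => ->; rewrite horner0.
suff /eqP : row_free (Pmat A P m al) by [].
apply: inj_row_free => la Hla; apply: trmx_inj; rewrite trmx0.
have Hp k : (k < m)%N -> \sum_i (prow a At (t 0%N) k 0 i).[al] * la 0 i = 0.
  move=> km; have /rowP/(_ (Ordinal km)) := Hla; rewrite !mxE => H.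
  have ak : (a ^+ k).[al] != 0 by rewrite horner_exp expf_neq0.
  apply: (mulIf (invr_neq0 ak)); rewrite mul0r -[RHS]H mulr_suml; apply: eq_bigr => i _.
  rewrite mxE (fevalE ak (Pk_prow P k i a0 AE)) t0; ring.
apply: (Trow_rank aal tS ndv) => k kq.
have km := leq_trans kq qm; have [g gE] := Trow_span k tS.
have -> : \sum_i (t k 0 i).[al] * la^T i 0 =
    \sum_(j < k.+1) (g j).[al] * \sum_i (prow a At (t 0%N) j 0 i).[al] * la 0 i.
  under [RHS]eq_bigr do rewrite mulr_sumr.
  rewrite exchange_big /=; apply: eq_bigr => i _.
  rewrite gE summxE horner_sum mulr_suml mxE; apply: eq_bigr => j _.
  by rewrite mxE hornerM; ring.
by rewrite big1 // => j _; rewrite Hp ?mulr0 //; apply: leq_ltn_trans km; rewrite -ltnS.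
Qed.

Lemma sub_trmx q s (Cz : 'M[C]_(q, s)) (v : 'rV[C]_q) :
  (exists u, v^T = Cz *m u) <-> (v <= Cz^T)%MS.
Proof.
split=> [[u uE]|/submxP[u uE]]; last by exists u^T; rewrite uE trmx_mul trmxK.
by apply/submxP; exists u^T; rewrite -trmx_mul -uE trmxK.
Qed.

End ZeroEstimate.

Unset Implicit Arguments.

Theorem theorem3 (R : realType) (K : {pred R[i]}) (q : nat)
  (A : 'M[{fraction {poly R[i]}}]_q) :
  GRing.divring_closed K ->
  (0 < q)%N ->
  (forall i j, in_Kz K (A i j)) ->
  exists2 c1 : R, 0 < c1 &
  forall w : R, 0 <= w ->
  exists N : nat,
  forall (r : R) (F : set (R[i] -> 'cV[R[i]]_q)) (dF : nat)
         (eps : R) (n : nat) (P : 'I_q -> {poly R[i]}),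
    (* S = solutions of Y' = AY on the slit punctured disk D_r, r small *)
    0 < r -> (forall z, 0 < cabs z < r -> ~ singular A z) ->
    (* F is a non-zero subspace of S, nondegenerate over K, dim F = dF *)
    lin_subspace F -> F `<=` sol_space A (slitdisk r) ->
    F <> [set fun _ => 0] ->
    nondegenerate_over K A (slitdisk r) F ->
    has_dim F dF ->
    0 <= eps -> eps <= (q.+1%:R)^-1 ->
    (N <= n)%N ->
    (forall i, P i \in polyOver K) ->
    (forall i, (size (P i) <= n.+1)%N) ->
    (exists i, P i != 0) ->
    (forall Y, F Y ->
       nilsson_class r (remainder P Y) /\
       vanishes_order_ge r (remainder P Y)
         ((q%:R - eps) * n%:R / dF%:R - w)) ->
    Rspace A (slitdisk r) P = [set fun _ => 0] /\
    forall alpha : R[i], alpha != 0 -> ~ singular A alpha ->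
      forall m : nat,
        m%:R < c1 + (w + 1) * q%:R + n%:R * eps ->
        c1 + (w + 1) * q%:R + n%:R * eps <= m.+1%:R ->
        \rank (Pmat A P m alpha) = q.
Proof.
move=> _ q0 _; pose C := R[i].
have [a [b [kp [At [aE b0 AE aS]]]]] := system_data A.
have bn0 : b != 0 by apply: contraNneq b0 => ->; rewrite horner0.
have an0 : a != 0 by rewrite aE !mulf_neq0 ?expf_neq0 ?polyX_eq0.
have [rho rho0 Hrho] := punctured_radius an0.
have arho z : slitdisk rho z -> a.[z] != 0 by move=> [h _]; exact: Hrho.
have rho2 : 0 < rho / 2 < rho by apply/andP; split; lra.
have [Phi [_ sPhi uPhi]] := @fund_exists R q a At rho arho _ rho2.
(* [Phi] and [tau0] are fixed here, before the disk, the subspace and the polynomials are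
   introduced. *)
have [tau0 Htau] := order_bound rho0 arho aE b0 sPhi uPhi.
pose c0 := maxn (size a) (\max_(ij : 'I_q * 'I_q) size (At ij.1 ij.2)).
have sa : (size a <= c0.+1)%N by rewrite leqW // leq_maxl.
have sAt i j : (size (At i j) <= c0.+1)%N.
  apply: leqW; apply: leq_trans (leq_maxr _ _).
  exact: (@leq_bigmax _ (fun ij : 'I_q * 'I_q => size (At ij.1 ij.2)) (i, j)).
(* The first term bounds the degree gained by differentiating the [q] rows, the second is the loss
   in the order at [0], and [q] counts the rows of the determinant; the final 1 makes positivity
   immediate. *)
pose c1 : R := q%:R ^+ 2 * c0%:R + tau0%:R + q%:R + 1.
have c10 : 0 < c1 by rewrite /c1 ltr_wpDl // !addr_ge0 // mulr_ge0 // exprn_ge0.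
exists c1 => // w w0.
(* The bound of [numeric_lt] on [n]; taking [n] above it excludes [p < q]. *)
pose X0 : R := q.+1%:R * (q%:R ^+ 2 * (w + 1) + tau0%:R * q%:R + q%:R ^+ 3 * c0%:R).
have X00 : 0 <= X0.
  by rewrite mulr_ge0 // !addr_ge0 // ?mulr_ge0 ?exprn_ge0 // addr_ge0.
exists (Num.Def.archi_bound X0).
move=> r F dF eps n P r0 Hs Flin FS Fn0 Fnd FdF e0 e1 Nn PK Psz [i0 Pi0] Prem.
have nX : X0 < n%:R by apply: lt_le_trans (archi_boundP X00) _; rewrite ler_nat.
have ar z : slitdisk r z -> a.[z] != 0.
  move=> [zr _]; apply: aS; last exact: Hs.
  by case/andP: zr => z0 _; rewrite -cabs_gt0.
pose t k : 'rV[{poly C}]_q := iter k (Trow a At) (\row_i P i).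
have tS k : t k.+1 = Trow a At (t k) by [].
have t0 : t 0%N != 0.
  by apply: contraNneq Pi0 => /rowP/(_ i0); rewrite !mxE => ->.
have remE Y z : remainder P Y z = rdot (t 0%N) Y z.
  by apply: eq_bigr => i _; rewrite mxE.
have [p [pq tf [de de0 [c tp]]]] := dep_exists t0; have /andP[p0 pq'] := pq.
pose r1 := Num.min r rho.
have r10 : 0 < r1 by rewrite lt_min r0.
have r1r : r1 <= r by rewrite ge_min lexx.
have r1rho : r1 <= rho by rewrite ge_min lexx orbT.
have [Sol [S1 S2 S3 S4 S5]] := sol_param AE r0 rho0 ar arho sPhi uPhi.
have sSol y : psol a At r (Sol y) := is_sol_psol AE ar (S1 y).
have rdotS V y z : slitdisk r1 z -> rdot V (Sol y) z = rdot V (fun z => Phi z *m y) z.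
  by move=> Dz; apply: eq_bigr => i _; rewrite S2.
have cont1 (r' : R) y : 0 < r' <= r1 -> (forall z, slitdisk r' z -> rdot (t 0%N) (Sol y) z = 0) ->
    forall z, slitdisk rho z -> rdot (t 0%N) (fun z => Phi z *m y) z = 0.
  move=> /andP[r'0 r'1] H.
  apply: (rdot_continue arho (r1 := r') _ tS tp de0 p0 (sPhi y)).
    by rewrite r'0 (le_trans r'1).
  by move=> z Dz; rewrite -rdotS ?H //; exact: slitdisk_le Dz.
have [E0 dE0] := col_selection tf.
have [s [Cz [qE rC] HCz]] := rel_kernel rho0 arho sPhi uPhi tS tp de0 p0 dE0.
have HR (v : 'rV[C]_q) : Rspace A (slitdisk r) P (Sol v^T) <-> (v <= Cz^T)%MS.
  rewrite -sub_trmx -HCz; split=> [[_ H]|H].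
    apply: (cont1 r1); first by rewrite r10 lexx.
    by move=> z Dz; rewrite -remE; apply: H; exact: slitdisk_le Dz.
  split; first exact: S1.
  move=> z Dz; rewrite remE; move: z Dz.
  apply: (rdot_continue ar (r1 := r1) _ tS tp de0 p0 (sSol _)); first by rewrite r10.
  by move=> z Dz; rewrite rdotS // H //; exact: slitdisk_le Dz.
have RS Y : Rspace A (slitdisk r) P Y -> exists y, Y = Sol y by move=> [sY _]; exact: S3.
have [FV0 FVD FVZ] := Flin.
have [||MF HMF] := @subspace_mx C q (fun v => F (Sol v^T)).
- have -> : Sol (0 : 'rV_q)^T = fun=> 0 by apply/funext => z; rewrite trmx0 (Sol0E S4).
  exact: FV0.
- move=> k u v Fu Fv; have -> : Sol (k *: u + v)^T = fun z => k *: Sol u^T z + Sol v^T z.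
    by apply/funext => z; rewrite linearP /= S4.
  by apply: FVD => //; exact: FVZ.
have FSol Y : F Y -> exists y, Y = Sol y by move=> /FS; exact: S3.
have dFE : dF = \rank MF := dim_unique S4 S5 FSol HMF FdF.
have dF0 : (0 < dF)%N.
  rewrite lt0n; apply/eqP => d0; apply: Fn0; apply/seteqP; split=> [Y FY|Y ->] /=; last exact: FV0.
  have [y yE] := FSol Y FY; have : (y^T <= MF)%MS by apply/HMF; rewrite trmxK -yE.
  have /eqP -> : MF == 0 by rewrite -mxrank_eq0 -dFE d0.
  rewrite submx0 => /eqP/(congr1 trmx); rewrite trmxK trmx0 yE => ->.
  by apply/funext => z; rewrite (Sol0E S4).
have dFq : (dF <= q)%N by rewrite dFE rank_leq_col.
(* A complement in [F] of its intersection with the relation space: non-zero combinations of its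
   basis have a non-zero remainder, as a leading term requires. *)
pose Md := (MF :\: Cz^T)%MS; pose m := \rank Md; pose Cy : 'M[C]_(q, m) := (row_base Md)^T.
have dimE : (\rank (MF :&: Cz^T)%MS + m = dF)%N by rewrite dFE mxrank_cap_compl.
have mdF : (m <= dF)%N by rewrite -dimE leq_addl.
pose T : R := (q%:R - eps) * n%:R / dF%:R - w.
have CyF (y : 'cV[C]_m) : F (Sol (Cy *m y)).
  rewrite -[Cy *m y]trmxK; apply/HMF; rewrite trmx_mul trmxK.
  by rewrite (submx_trans (submxMl _ _)) // eq_row_base diffmxSl.
have CyR (y : 'cV[C]_m) : y != 0 ->
    ~ (forall z, slitdisk rho z -> rdot (t 0%N) (fun z => Phi z *m (Cy *m y)) z = 0).
  move=> y0 /HCz[u uE]; apply/negP: y0; apply/negPn.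
  have h1 : ((Cy *m y)^T <= Md)%MS by rewrite trmx_mul trmxK (submx_trans (submxMl _ _)) // eq_row_base.
  have h2 : ((Cy *m y)^T <= Cz^T)%MS by apply/sub_trmx; exists u; rewrite trmxK.
  have : ((Cy *m y)^T <= Md :&: Cz^T)%MS by rewrite sub_capmx h1.
  rewrite capmx_diff submx0 trmx_mul trmxK => /eqP h3.
  have : y^T = 0 by apply: (row_free_inj (row_base_free Md)); rewrite h3 mul0mx.
  by move=> /(congr1 trmx); rewrite trmxK trmx0 => ->.
have OE tau y g : Osec tau (fun z => remainder P (Sol y) z - g z) ->
    Osec tau (fun z => rdot (t 0%N) (fun z => Phi z *m y) z - g z).
  apply: Osec_ext r10 _ => z Rz zr; rewrite remE rdotS //; split.
    by rewrite zr cabs_gt0 andbT; apply: contraTneq Rz => ->; rewrite /= ltxx.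
  by move=> [_]; lra.
have HL (y : 'cV[C]_m) : y != 0 -> has_lead (fun z => Phi z *m Cy) (t 0%N) y.
  move=> y0; have [_ [E [I [h [rep nor _]]]]] := Prem _ (CyF y).
  (* An empty set of exponents makes the remainder zero near [0], hence everywhere by continuation,
     against [CyR]. *)
  have E0' : E != [::].
    apply/eqP => En; apply: (CyR y y0).
    have [_ _ [r' r'0 H']] := rep.
    apply: (cont1 (Num.min r1 r')); first by rewrite lt_min r10 r'0 ge_min lexx.
    move=> z [/andP[z0]]; rewrite lt_min => /andP[z1 z2] nz.
    rewrite -remE H' //; first by rewrite En big_nil.
    by split=> //; rewrite z0 (lt_le_trans z1).
  have [sg [dl [E' [p' [d01 [uE' hE' hp' hO] ex]]]]] := nilsson_lead r0 rep nor E0'.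
  exists sg, dl, E', p'; split=> //; split=> //.
  have := OE _ _ _ hO; congr Osec; apply/funext => z; congr (_ - _).
  by apply: eq_bigr => i _; rewrite mulmxA.
have HT j : Osec (T - 1) (rdot (t 0%N) (fun z => Phi z *m col j Cy)).
  have [_ [E [I [h [rep _ HT]]]]] := Prem _ (CyF (delta_mx j 0)).
  have := OE (T - 1) (Cy *m delta_mx j 0) (fun=> 0).
  rewrite -colE => OE'; apply: Osec_ext ltr01 _ (OE' _) => [z _ _|]; first by rewrite subr0.
  apply: Osec_ext ltr01 _ (nilsson_small r0 rep HT) => z _ _; by rewrite subr0 colE.
have [E dE HE] := Htau t p de c m Cy T tS tp de0 pq tf HL HT.
set De := \det _ in dE HE.
have st k i : (size (t k 0%R i) <= (n + k * c0).+1)%N.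
  by apply: (size_Trow tS sa sAt) => l; rewrite mxE.
have sDe : (size De <= (p * (n + q * c0)).+1)%N.
  apply: size_det_bound => k j; rewrite mxE; apply: size_sum_bound => i _.
  rewrite !mxE mulrC mul_polyC; apply: leq_trans (size_scale_leq _ _) _.
  apply: leq_trans (st _ _) _; rewrite ltnS leq_add2l leq_mul2r.
  by rewrite (leq_trans (ltnW (ltn_ord k)) pq') orbT.
have mult al : al != 0 -> exists o mu : nat, [/\ ~~ (('X - al%:P) ^+ mu.+1 %| De),
    m%:R * (T - 1) - tau0%:R < o%:R & (o + mu <= p * (n + q * c0))%N].
  move=> al0; have [k [mu [h1 h2 h3]]] := mult_bound dE al0; exists k, mu; split=> //.
    exact: HE.
  by rewrite -ltnS (leq_trans h3).
have TE : T - 1 = (q%:R - eps) * n%:R / dF%:R - w - 1 by [].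
have pE : p = q.
  apply/eqP; rewrite eqn_leq pq' leqNgt; apply/negP => ltpq.
  have [od [mu [_ ho hom]]] := mult 1 (oner_neq0 _).
  have s0 : (0 < s)%N by rewrite -(ltn_add2l p) addn0 -qE.
  have sq : (s < q)%N by rewrite qE -{1}[s]add0n ltn_add2r.
  have prop : proper_space A (slitdisk r) (Rspace A (slitdisk r) P).
    split=> RE.
      have : Cz^T = 0.
        apply/row_matrixP => i; rewrite row0; apply: (Sol_tr_inj S4 S5) => z.
        rewrite trmx0 (Sol0E S4).
        have : Rspace A (slitdisk r) P (Sol (row i Cz^T)^T) by apply/HR; exact: row_sub.
        by rewrite RE => /= ->.
      by move=> Cz0; move: rC; rewrite -mxrank_tr Cz0 mxrank0 => s00; rewrite -s00 in s0.
    have : (1%:M <= Cz^T)%MS.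
      apply/row_subP => i; apply/HR; rewrite RE; exact: S1.
    by move=> /mxrankS; rewrite mxrank1 mxrank_tr rC leqNgt sq.
  have := Fnd P PK prop (\rank (MF :&: Cz^T)%MS) s dF q.
  have hd1 : has_dim (F `&` Rspace A (slitdisk r) P) (\rank (MF :&: Cz^T)%MS).
    apply: (dim_exists S4 S5) => [Y [FY _]|v]; first exact: FSol.
    rewrite sub_capmx; split=> [[/HMF -> /HR ->] //|/andP[/HMF h1 /HR h2]]; by split.
  have hd2 : has_dim (Rspace A (slitdisk r) P) s.
    have := @dim_exists R q Sol S4 S5 (Rspace A (slitdisk r) P) RS s Cz^T HR.
    by rewrite mxrank_tr rC.
  have hd3 : has_dim (sol_space A (slitdisk r)) q.
    have := @dim_exists R q Sol S4 S5 (sol_space A (slitdisk r)) S3 q 1%:M; rewrite mxrank1; apply.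
    by move=> v; rewrite submx1; split=> // _; exact: S1.
  move=> /(_ hd1 hd2 FdF hd3) Hnd.
  (* Nondegeneracy with denominators cleared, using that the relation space has dimension
     [s = q - p] and its intersection with [F] has dimension [dF - m]. *)
  have pm : (p * dF < m * q)%N.
    move: Hnd; rewrite ltr_pdivrMr ?ltr0n // mulrAC ltr_pdivlMr ?ltr0n // -!natrM ltr_nat.
    move=> lt; rewrite -(ltn_add2l (\rank (MF :&: Cz^T)%MS * q)) -mulnDl dimE [in X in (_ < X)%N]qE.
    by rewrite mulnDr [(p * dF)%N]mulnC [(dF * p + _)%N]addnC ltn_add2r.
  have := @numeric_lt R n q p m dF tau0 c0 od w eps w0 e0 e1 _ pq' (leq_trans mdF dFq) pm.
  rewrite dF0 dFq -TE => /(_ isT ho (leq_trans (leq_addr _ _) hom)); rewrite -/X0.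
  by rewrite leNgt nX.
have s0 : s = 0%N by apply/eqP; rewrite -(eqn_add2l p) addn0 -qE pE.
split.
  apply/seteqP; split=> [Y RY|Y ->] /=; last first.
    have /HR : ((0 : 'rV[C]_q) <= Cz^T)%MS by exact: sub0mx.
    by rewrite trmx0 (_ : Sol 0 = fun=> 0) //; apply/funext => z; rewrite (Sol0E S4).
  have [y yE] := RS Y RY; have : (y^T <= Cz^T)%MS by apply/HR; rewrite trmxK -yE.
  have /eqP -> : Cz^T == 0 by rewrite -mxrank_eq0 mxrank_tr rC s0.
  move=> /submx0null/(congr1 trmx); rewrite trmxK trmx0 yE => ->.
  by apply/funext => z; rewrite (Sol0E S4).
move=> al al0 nsal M _ HM.
have [od [mu [hmu ho hom]]] := mult al al0.
have mE : m = dF.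
  have rT : \rank Cz^T = 0%N by rewrite mxrank_tr rC.
  have := mxrankS (capmxSr MF Cz^T); rewrite rT leqn0 => /eqP h.
  by rewrite -dimE h.
have hmu' : mu%:R < eps * n%:R + q%:R ^+ 2 * c0%:R + q%:R * (w + 1) + tau0%:R.
  apply: (@numeric_eq R n q dF tau0 c0 od mu w eps w0); first by rewrite dF0.
    by rewrite -TE -mE.
  by rewrite -{1}pE.
(* The bound on the multiplicity [mu] of the determinant at [al] has exactly the shape of the
   threshold, so [M] columns include the first [q + mu]. *)
have qm : (q + mu <= M)%N.
  rewrite -ltnS -(ltr_nat R) natrD; apply: lt_le_trans HM.
  by rewrite /c1 [(w + 1) * _]mulrC [n%:R * _]mulrC; lra.
apply: (Pmat_rank AE (aS al al0 nsal) (erefl (t 0%N)) tS _ qm).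
move: hmu; rewrite /De; clear -pE; subst p; apply: contra.
by rewrite det_mulmx => h; exact: dvdp_mulr.
Qed.
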